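(* Let $X$ be a compact Riemann surface of genus $g$, $p_1,\dots,p_n\in X$ distinct points, and $m_i>-4$ integers with $\sum_im_i=4(2g-2)$. Put $$E(X,p,m)=\Big\{e\ge1,\ e\mid 4\ :\ e\mid m_i\ \text{for all } i\ \text{ and }\ \textstyle\sum_i(m_i/e)p_i\sim (4/e)K_X\Big\},$$ where $\sim$ denotes linear equivalence. Then a $4$-differential $q$ on $X$ with $\operatorname{div}(q)=\sum_im_ip_i$ exists if and only if $1\in E(X,p,m)$, in which case $q$ is unique up to scale and $\operatorname{im}\rho_q=d\mathbb{Z}_4$ with $d=\max E(X,p,m)$.
   Context: $\mathbb{Z}_4=\mathbb{Z}/4\mathbb{Z}$, identified with the fourth roots of unity via $k\mapsto i^k$; its subgroups are $d\mathbb{Z}_4$, $d\in\{1,2,4\}$, with $4\mathbb{Z}_4=0$. $K_X$ is the canonical bundle (or a canonical divisor). A $4$-differential is a nonzero meromorphic section of $K_X^4$. For such $q$ with divisor $\sum_im_ip_i$, its rotational holonomy is the homomorphism $\rho_q\colon H_1(X\setminus\{p_1,\dots,p_n\};\mathbb{Z})\to\mathbb{Z}_4$ given by the monodromy of the local fourth roots of $q$: continuing a local fourth root $q^{1/4}$ (a local $1$-form) along $\gamma$ multiplies it by $i^{\rho_q(\gamma)}$. *)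

(* Defs.v *)
From HB Require Import structures.
From mathcomp Require Import all_boot all_order all_algebra.
From mathcomp Require Import all_classical all_reals all_analysis.
From mathcomp Require Import complex.
From mathcomp.multinomials Require Import freeg.
Import Order.TTheory GRing.Theory Num.Theory.
Import numFieldNormedType.Exports.

Set Implicit Arguments.
Unset Strict Implicit.
Unset Printing Implicit Defensive.

Local Open Scope classical_set_scope.
Local Open Scope ring_scope.

(* `^o` is what carries the normed-module structure of R[i] over itself, so
   that `derivable f z 1` for f : CC R -> CC R is complex differentiability. *)
Notation CC R := (complex R)^o (only parsing).

Section StandardSimplex.
Variable R : realType.

Definition std_simplex n : set 'rV[R]_n.+1 :=
  [set t | (forall j, 0 <= t 0 j) /\ \sum_j t 0 j = 1].
Arguments std_simplex : clear implicits.

Lemma vertex_subproof n (i : 'I_n.+1) : delta_mx 0 i \in std_simplex n.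
Proof.
apply/mem_set; split=> [j|]; first by rewrite mxE; case: (_ && _).
rewrite (bigD1 i) //= mxE !eqxx big1 ?addr0 // => j /negPf ji.
by rewrite mxE ji.
Qed.

Definition vertex n (i : 'I_n.+1) : std_simplex n := SigSub (vertex_subproof i).

Definition face_row n (i : 'I_n.+2) (t : 'rV[R]_n.+1) : 'rV[R]_n.+2 :=
  \row_j oapp (t 0) 0 (unlift i j).

Lemma face_subproof n (i : 'I_n.+2) (t : std_simplex n) :
  face_row i (val t) \in std_simplex n.+1.
Proof.
have /set_mem[t0 t1] := valP t; apply/mem_set; split.
  by move=> j; rewrite mxE; case: unliftP => [k _|_] //=.
rewrite (bigD1_ord i) //= mxE unlift_none /= add0r -[RHS]t1.
by apply: eq_bigr => j _; rewrite mxE liftK.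
Qed.

Definition face n (i : 'I_n.+2) (t : std_simplex n) : std_simplex n.+1 :=
  SigSub (face_subproof i t).

Lemma continuous_face_row n (i : 'I_n.+2) : continuous (@face_row n i).
Proof.
move=> t A [/= P Pt PA].
suff : \forall s \near t, forall j, P 0 j (face_row i s 0 j).
  apply: filterS => s Ps; apply: PA => a b; rewrite ord1; exact: Ps.
apply: (@filter_forall _ _ (fun j s => P 0 j (face_row i s 0 j)) (nbhs t)) => j.
have : {for t, continuous (fun s : 'rV[R]_n.+1 => face_row i s 0 j)}.
  rewrite (_ : (fun s => _) =
    (fun s : 'rV[R]_n.+1 => oapp (s 0) 0 (unlift i j))); last first.
    by apply/funext => s; rewrite mxE.
  case: unlift => [k|] /=; first exact: coord_continuous.
  exact: cst_continuous.
exact.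
Qed.

Lemma continuous_face n (i : 'I_n.+2) : continuous (@face n i).
Proof.
apply: continuous_comp_initial => t.
apply: (@continuous_comp _ _ _ (val : std_simplex n -> _) (@face_row n i)).
  exact: initial_continuous.
exact: continuous_face_row.
Qed.

Lemma face0E (i j : 'I_2) (t : std_simplex 0) : i != j -> face i t = vertex j.
Proof.
move=> ij; apply/val_inj/rowP => k; rewrite !mxE eqxx /=.
have /set_mem[_] := valP t; rewrite big_ord1 => t1.
case: unliftP => [l kl|ki] /=; last by rewrite ki (negPf ij).
rewrite ord1 t1; suff -> : k = j by rewrite eqxx.
by move: i j k l ij kl => [[|[]]//+] [[|[]]//+] [[|[]]//+] [[]//+] => ? ? ? ? //=;
  move=> _ /(congr1 val) //= _; apply/val_inj.
Qed.

End StandardSimplex.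
Arguments std_simplex : clear implicits.

Section SingularHomology.
Variables (R : realType) (X : topologicalType) (Y : set X).

(* Singular n-simplices of the subspace Y. *)
Record simplex n := Simplex {
  simplex_fun :> std_simplex R n -> X;
  simplex_continuous : continuous simplex_fun;
  simplex_in : forall t, Y (simplex_fun t) }.

HB.instance Definition _ n := gen_eqMixin (simplex n).
HB.instance Definition _ n := gen_choiceMixin (simplex n).

Definition simplex_face n (i : 'I_n.+2) (s : simplex n.+1) : simplex n :=
  @Simplex n (s \o face i)
    (fun t => continuous_comp (@continuous_face _ _ i t)
                              (@simplex_continuous _ s (face i t)))
    (fun t => simplex_in s (face i t)).

Definition boundary n (c : {freeg (simplex n.+1)}) : {freeg (simplex n)} :=
  fglift (fun s => \sum_(i < n.+2) << (-1) ^+ i *g simplex_face i s >>) c.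

Lemma boundaryB n : {morph @boundary n : c d / c - d}.
Proof. exact: lift_is_additive. Qed.

Lemma boundary0 n : @boundary n 0 = 0.
Proof. by rewrite -(subrr 0) boundaryB subrr. Qed.

Definition is_cycle : {pred {freeg (simplex 1)}} := fun c => boundary c == 0.

Lemma is_cycle_closed : zmod_closed is_cycle.
Proof.
split=> [|c d]; rewrite !unfold_in ?boundary0 // => /eqP c0 /eqP d0.
by rewrite boundaryB c0 d0 subrr.
Qed.

HB.instance Definition _ := GRing.isZmodClosed.Build _ is_cycle is_cycle_closed.

Record cycle := Cycle { cycle_val :> {freeg (simplex 1)};
                        _ : cycle_val \in is_cycle }.

HB.instance Definition _ := [isSub for cycle_val].
HB.instance Definition _ := [Choice of cycle by <:].
HB.instance Definition _ := [SubChoice_isSubZmodule of cycle by <:].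

Definition is_boundary : {pred cycle} :=
  fun c => `[< exists d, boundary d = cycle_val c >].

Lemma is_boundary_closed : zmod_closed is_boundary.
Proof.
split=> [|c d]; rewrite !unfold_in.
  by apply/asboolP; exists 0; rewrite boundary0.
move=> /asboolP[c' c'E] /asboolP[d' d'E]; apply/asboolP; exists (c' - d').
by rewrite boundaryB c'E d'E.
Qed.

HB.instance Definition _ :=
  GRing.isZmodClosed.Build _ is_boundary is_boundary_closed.

Definition H1 : zmodType := Quotient.quot is_boundary.

Definition is_loop (s : simplex 1) := s (vertex R 0) = s (vertex R 1).

Lemma loop_subproof s : is_loop s -> << s >> \in is_cycle.
Proof.
move=> sl; rewrite unfold_in /boundary liftU scale1r !big_ord_recl big_ord0 /=.
rewrite expr0 expr1 addr0 -freegUN addr_eq0 opprK; apply/eqP.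
suff -> : simplex_face ord0 s = simplex_face (fintype.lift ord0 ord0) s by [].
have sE i j : i != j -> simplex_face i s =1 fun=> s (vertex R j).
  by move=> ij t; rewrite /= (face0E t ij).
have : simplex_face ord0 s =1 simplex_face (fintype.lift ord0 ord0) s.
  by move=> t; rewrite (sE _ 1) // (sE _ 0).
case: simplex_face => f fc fY; case: simplex_face => g gc gY /= /funext fg.
by case: _ / fg in gc gY *; congr Simplex; exact: Prop_irrelevance.
Qed.

Definition loop_class s (sl : is_loop s) : H1 :=
  \pi_(Quotient.quot is_boundary)%qT (Cycle (loop_subproof sl)).

End SingularHomology.

Section RiemannSurface.
Variable R : realType.

Definition holomorphic_at (f : CC R -> CC R) (z : CC R) :=
  \forall w \near z, derivable f w 1.

(* The expansion is required at z itself as well, with 0 ^ k = 0 for every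
   k != 0: a meromorphic function takes the value 0 at its poles and has no
   removable singularities, so equality of meromorphic functions is pointwise. *)
Definition has_order (f : CC R -> CC R) (z : CC R) (k : int) :=
  exists h : CC R -> CC R, [/\ holomorphic_at h z, h z != 0 &
    \forall w \near z, f w = (w - z) ^ k * h w].

Definition meromorphic_at (f : CC R -> CC R) (z : CC R) :=
  (\forall w \near z, f w = 0) \/ exists k, has_order f z k.

Record chart (X : topologicalType) := Chart {
  chart_dom : set X;
  chart_map : X -> CC R;
  chart_inv : CC R -> X;
  chart_dom_open : open chart_dom;
  chart_image_open : open (chart_map @` chart_dom);
  chart_mapK : {in chart_dom, cancel chart_map chart_inv};
  chart_map_continuous : {in chart_dom, continuous chart_map};
  chart_inv_continuous : {in chart_map @` chart_dom, continuous chart_inv} }.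

Record riemannSurface := RiemannSurface {
  rs_carrier :> topologicalType;
  rs_index : Type;
  rs_chart : rs_index -> chart rs_carrier;
  rs_cover : forall x, exists a, chart_dom (rs_chart a) x;
  rs_holomorphic : forall a b x,
    chart_dom (rs_chart a) x -> chart_dom (rs_chart b) x ->
    holomorphic_at (chart_map (rs_chart b) \o chart_inv (rs_chart a))
                   (chart_map (rs_chart a) x);
  rs_hausdorff : hausdorff_space rs_carrier;
  rs_nonempty : [set: rs_carrier] !=set0;
  rs_connected : connected [set: rs_carrier] }.

Variable X : riemannSurface.
Implicit Types (a b : rs_index X) (x y : X) (D K : {freeg X}).

Definition has_genus (g : nat) :=
  exists f : {additive H1 R [set: X] -> 'rV[int]_(2 * g)}, bijective f.

Local Notation dom a := (chart_dom (rs_chart a)).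
Local Notation coord a := (chart_map (rs_chart a)).

(* dz_b / dz_a at x *)
Definition jacobian a b x : CC R :=
  derive1 (coord b \o chart_inv (rs_chart a)) (coord a x).

(* A section s of a power of K_X is given by its coefficients: s = s_a dz_a^k
   on the domain of the chart a, where s_a is written as a function of the
   point of X. The values of s_a outside the domain of a are irrelevant. *)
Definition coefficients := rs_index X -> X -> CC R.
Implicit Types q w : coefficients.

Definition local_expr q a : CC R -> CC R := q a \o chart_inv (rs_chart a).

Definition transforms_at (k : nat) q x := forall a b, dom a x -> dom b x ->
  q a x = q b x * jacobian a b x ^+ k.

Definition meromorphic_section (k : nat) q :=
  (forall x, transforms_at k q x) /\
  (forall a x, dom a x -> meromorphic_at (local_expr q a) (coord a x)).

Definition differential (k : nat) q :=
  meromorphic_section k q /\ exists a x, dom a x /\ q a x != 0.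

Definition has_div q D :=
  forall a x, dom a x -> has_order (local_expr q a) (coord a x) (coeff x D).

Definition canonical_divisor K := exists2 w, differential 1 w & has_div w K.

(* Nonzero meromorphic functions are the nonzero meromorphic sections of K_X^0,
   whose coefficient does not depend on the chart. *)
Definition linearly_equivalent D1 D2 :=
  exists2 f : X -> CC R, differential 0 (fun=> f) & has_div (fun=> f) (D1 - D2).

Definition divisor_of n (p : 'I_n -> X) (m : 'I_n -> int) : {freeg X} :=
  \sum_i << m i *g p i >>.

Definition E_set K n (p : 'I_n -> X) (m : 'I_n -> int) : set nat :=
  [set e | [/\ (0 < e)%N, (e %| 4)%N, forall i, (e%:Z %| m i)%Z &
    linearly_equivalent (divisor_of p (fun i => (m i %/ e%:Z)%Z))
                        (K *+ (4 %/ e)%N)]].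

Definition fourth_root_germ q w x := \forall y \near x,
  transforms_at 1 w y /\
  (forall a, dom a y -> holomorphic_at (local_expr w a) (coord a y) /\
                        w a y ^+ 4 = q a y).

Definition same_germ w w' x :=
  \forall y \near x, forall a, dom a y -> w' a y = w a y.

Section Holonomy.
Variable Y : set X.

(* w t stands for the germ at s t of a local fourth root of q. *)
Definition continuation q (s : simplex R Y 1)
    (w : std_simplex R 1 -> coefficients) :=
  (forall t, fourth_root_germ q (w t) (s t)) /\
  (forall t, \forall u \near t, same_germ (w t) (w u) (s u)).

Definition monodromy q (s : simplex R Y 1) (k : 'Z_4) :=
  exists2 w, continuation q s w &
    same_germ (fun a x => 'i%C ^+ k * w (vertex R 0) a x) (w (vertex R 1))
              (s (vertex R 1)).

(* Classes of loops generate H_1, so this determines rho. *)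
Definition rotational_holonomy q (rho : {additive H1 R Y -> 'Z_4}) :=
  forall (s : simplex R Y 1) (sl : is_loop s),
    monodromy q s (rho (loop_class sl)).

End Holonomy.
End RiemannSurface.

(* Main.v *)
(* Fix a 1-form w with divisor K. For each e, the (4/e)-differentials with divisor
   sum (m_i / e) p_i correspond, by division by w^(4/e), to the functions that
   witness sum (m_i / e) p_i ~ (4/e) K; two 4-differentials with the same divisor
   have a holomorphic, hence constant, quotient.

   If q = r^e with r a (4/e)-differential, then the local fourth roots v of q
   with v^(4/e) = r are permuted by continuation, so im rho is contained in
   e Z/4. Conversely, if im rho is contained in e Z/4, the power v^(4/e) of a
   continued fourth root v depends only on the end point, which gives a root r
   of q with r^e = q away from the p_i. Near p_i it is a continuous e-th root of
   z^(m_i) times a unit, so turning around p_i shows that e divides m_i, and then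
   r is meromorphic there with order m_i / e. Hence im rho = d Z/4 for the largest
   d in E. Continuation along a loop depends only on the homology class because
   its increments form a cochain on singular 1-simplices that kills boundaries;
   flat sections over a square are glued by bisection.

   Holomorphy means plain complex differentiability. The mean value property,
   and with it the maximum principle, follows from Goursat's bisection applied to
   f (z + exp (u + i v)) on squares of side 2 pi; the continuity of the Jacobians
   of the transition maps is read off w. *)
Require Import Defs.
From HB Require Import structures.
From mathcomp Require Import all_boot all_order all_algebra.
From mathcomp Require Import all_classical all_reals all_analysis.
From mathcomp Require Import complex.
From mathcomp.multinomials Require Import freeg.
From mathcomp Require Import ring lra zify.
Import Order.TTheory GRing.Theory Num.Theory.
Import numFieldNormedType.Exports.

Set Implicit Arguments.
Unset Strict Implicit.
Unset Printing Implicit Defensive.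

Local Open Scope classical_set_scope.
Local Open Scope ring_scope.

(* Num.Theory also has [Re] and [Im], and mathcomp-analysis a [jacobian]. *)
Local Notation Re := (@complex.Re _).
Local Notation Im := (@complex.Im _).
Local Notation jacobian := Defs.jacobian.

(** * Pointwise continuity and complex derivatives *)

(** All exponents are powers of two, so square roots carry the whole analysis of roots: their
    existence near a nonzero value, the differentiability of continuous branches and the orders at
    the punctures are proved for squares and then iterated.

    The local roots form a Z/4-torsor without a continuous global trivialization. Therefore a root
    [ref] is fixed at every point with no continuity at all, and a local branch becomes a function
    [k] to Z/4 for which [branch k], that is, i^k times [ref], is continuous. Transport along a path
    is then a difference in Z/4, and it extends linearly to chains. Taking for [ref] a root of r,
    and not just of q, makes the bound on the image visible: [k *+ 2 ^ j] is locally constant for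
    every branch [k].

    For the opposite inclusion it is enough to compare d with 2d, because the subgroups of Z/4 form
    a chain: an image smaller than d Z/4 lies in 2d Z/4, and this would put 2d into E, against the
    choice of d. *)

Lemma near_imp (T : topologicalType) (x : T) (P Q : T -> Prop) :
  (\forall y \near x, P y) -> (forall y, P y -> Q y) -> \forall y \near x, Q y.
Proof. by move=> nP PQ; exact: filterS nP. Qed.

Lemma near_imp2 (T : topologicalType) (x : T) (P Q S : T -> Prop) :
  (\forall y \near x, P y) -> (\forall y \near x, Q y) ->
  (forall y, P y -> Q y -> S y) -> \forall y \near x, S y.
Proof. by move=> nP nQ PQ; exact: filterS2 nP nQ. Qed.

Lemma cont_dist (K : numFieldType) (V : pseudoMetricNormedZmodType K)
    (T : topologicalType) (f : T -> V) x :
  {for x, continuous f} <->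
  forall e, 0 < e -> \forall y \near x, `|f x - f y| < e.
Proof. by split; [move=> cf; apply/cvgrPdist_lt|move=> cf; apply/cvgrPdist_lt]. Qed.

Lemma near_comp (T U : topologicalType) (f : T -> U) x (P : U -> Prop) :
  {for x, continuous f} -> (\forall y \near f x, P y) ->
  \forall y \near x, P (f y).
Proof. by move=> cf nP; exact: cf nP. Qed.

Lemma cont_pair (T U V : topologicalType) (f : T -> U) (g : T -> V) x :
  {for x, continuous f} -> {for x, continuous g} ->
  {for x, continuous (fun y => (f y, g y))}.
Proof.
move=> cf cg S [[P Q] /= [nP nQ] PQ].
have H := near_imp2 (near_comp cf nP) (near_comp cg nQ) (fun _ => @conj _ _).
by apply: (near_imp H) => y fg; exact: (PQ (f y, g y) fg).
Qed.

Section PointwiseContinuity.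
Variables (K : numFieldType) (T : topologicalType) (x : T).
Implicit Types f g : T -> K.

Lemma contD f g : {for x, continuous f} -> {for x, continuous g} ->
  {for x, continuous (fun y => f y + g y)}.
Proof. exact: cvgD. Qed.

Lemma contN f : {for x, continuous f} -> {for x, continuous (fun y => - f y)}.
Proof. exact: cvgN. Qed.

Lemma contB f g : {for x, continuous f} -> {for x, continuous g} ->
  {for x, continuous (fun y => f y - g y)}.
Proof. exact: cvgB. Qed.

Lemma contM f g : {for x, continuous f} -> {for x, continuous g} ->
  {for x, continuous (fun y => f y * g y)}.
Proof. exact: cvgM. Qed.

Lemma contV f : f x != 0 -> {for x, continuous f} ->
  {for x, continuous (fun y => (f y)^-1)}.
Proof. by move=> f0; exact: cvgV. Qed.

Lemma cont_cst (c : K) : {for x, continuous (fun _ : T => c)}.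
Proof. exact: cst_continuous. Qed.
Arguments cont_cst c : clear implicits.

Lemma contX f n : {for x, continuous f} -> {for x, continuous (fun y => f y ^+ n)}.
Proof.
move=> cf; elim: n => [|n IH].
  rewrite (_ : (fun _ => _) = fun=> 1); first exact: (cont_cst 1).
  by apply/funext => y; rewrite expr0.
rewrite (_ : (fun _ => _) = fun y => f y * f y ^+ n); first exact: contM.
by apply/funext => y; rewrite exprS.
Qed.

Lemma contXz f (k : int) : f x != 0 -> {for x, continuous f} ->
  {for x, continuous (fun y => f y ^ k)}.
Proof.
by case: k => n f0 cf; [exact: contX|apply: contV; [rewrite expf_neq0|exact: contX]].
Qed.

Lemma near_cont_neq f (c : K) : {for x, continuous f} -> f x != c ->
  \forall y \near x, f y != c.
Proof.
move=> cf fc.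
have := cvgr_neq0 _ (contB cf (cont_cst c)); rewrite subr_eq0 => /(_ _ fc).
by apply: filterS => y; rewrite subr_eq0.
Qed.

Lemma near_eq_cont f g : (\forall y \near x, f y = g y) ->
  {for x, continuous f} -> {for x, continuous g}.
Proof.
move=> fg cf; have fgx := nbhs_singleton fg.
rewrite /prop_for /continuous_at -fgx; apply: cvg_trans cf.
by apply: near_eq_cvg; apply: filterS fg => y ->.
Qed.

End PointwiseContinuity.

Arguments cont_cst {K T x} c.

Section Caratheodory.
Variable K : numFieldType.
Implicit Types (f g phi : K -> K) (z : K).

Lemma derivable_slope f z : derivable f z 1 -> exists phi : K -> K,
  [/\ {for z, continuous phi}, forall w, f w = f z + (w - z) * phi w
    & phi z = derive1 f z].
Proof.
move=> df; pose phi w := if w == z then derive1 f z else (f w - f z) / (w - z).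
exists phi; split; last by rewrite /phi eqxx.
- apply/continuous_withinNshiftx; rewrite /phi eqxx.
  have F1 : h^-1 *: ((f \o shift z) h%:A - f z) @[h --> 0^'] --> derive1 f z.
    by rewrite derive1E; exact: df.
  apply: cvg_trans F1; apply: near_eq_cvg; near=> i => /=.
  rewrite ifN; first by rewrite addrK mulrC [_%:A]mulr1.
  rewrite -subr_eq0 addrK.
  by near: i; rewrite near_withinE /=; near=> x1.
- move=> w; rewrite /phi; case: eqP => [->|/eqP wz].
    by rewrite subrr mul0r addr0.
  by rewrite mulrC divfK ?subr_eq0// addrC subrK.
Unshelve. all: by end_near. Qed.

Lemma slope_derivable f phi z : {for z, continuous phi} ->
  (\forall w \near z, f w = f z + (w - z) * phi w) ->
  derivable f z 1 /\ derive1 f z = phi z.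
Proof.
move=> cphi fE.
suff H : h^-1 *: ((f \o shift z) h%:A - f z) @[h --> 0^'] --> phi z.
  split; first by apply/cvg_ex; exists (phi z).
  by rewrite derive1E; exact: cvg_lim.
have F1 : (phi \o shift z) y @[y --> 0^'] --> phi z.
  exact/continuous_withinNshiftx.
apply: cvg_trans F1; apply: near_eq_cvg; near=> y => /=.
have y0 : y != 0 by near: y; rewrite near_withinE /=; near=> x1.
rewrite [y%:A]mulr1 (_ : f (y + z) = f z + y * phi (y + z)).
  by rewrite addrAC subrr add0r [RHS]mulrA mulVf ?mul1r.
rewrite -{2}[y](addrK z); near: y; apply: nbhs_dnbhs.
have cz : (y + z) @[y --> (0 : K)] --> z.
  have := @cvgD K K K (nbhs (0:K)) _ idfun (cst z) 0 z.
  by rewrite add0r; apply; [exact: cvg_id|exact: cvg_cst].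
exact: cz fE.
Unshelve. all: by end_near. Qed.

Lemma derivable_cont f z : derivable f z 1 -> {for z, continuous f}.
Proof.
by move=> df; apply/differentiable_continuous/derivable1_diffP.
Qed.

Lemma near_eq_derive f g z : (\forall w \near z, f w = g w) ->
  derivable f z 1 -> derivable g z 1 /\ derive1 g z = derive1 f z.
Proof.
move=> fg /derivable_slope[phi [cphi fE <-]]; apply: (slope_derivable cphi).
have fgz := nbhs_singleton fg.
by apply: filterS fg => w fgw; rewrite -fgw fE fgz.
Qed.

Lemma chain_rule f g z : derivable f z 1 -> derivable g (f z) 1 ->
  derivable (g \o f) z 1 /\ derive1 (g \o f) z = derive1 g (f z) * derive1 f z.
Proof.
move=> df dg; have cf := derivable_cont df.
have [phi [cphi fE <-]] := derivable_slope df.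
have [psi [cpsi gE <-]] := derivable_slope dg.
apply: (@slope_derivable _ (fun w => psi (f w) * phi w) z).
  exact: (contM (continuous_comp cf cpsi) cphi).
apply: (@filterE _ (nbhs z)) => w /=.
have fwz : f w - f z = (w - z) * phi w by rewrite (fE w) addrC addKr.
by rewrite gE fwz; ring.
Qed.

Lemma derivable_pow f z n : derivable f z 1 -> derivable (fun w => f w ^+ n) z 1.
Proof.
move=> df; elim: n => [|n IH].
  rewrite (_ : (fun _ => _) = cst 1); first exact: derivable_cst.
  by apply/funext => w; rewrite expr0.
rewrite (_ : (fun _ => _) = (f * (fun w => f w ^+ n))); last first.
  by apply/funext => w; rewrite exprS.
exact: (derivableM df IH).
Qed.

(** As [f w ^+ 2 - f z ^+ 2] factors, the slope of [f] is the slope of its square divided by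
    [f w + f z], which tends to twice [f z]. Continuous branches of a root are thereby holomorphic
    where they do not vanish. *)
Lemma derivable_sqrt f z : derivable (fun w => f w ^+ 2) z 1 ->
  {for z, continuous f} -> f z != 0 -> derivable f z 1.
Proof.
move=> /derivable_slope[phi [cphi fE _]] cf fz.
have fz2 : f z + f z != 0 by rewrite -mulr2n mulrn_eq0.
have cs := contD cf (cont_cst (f z)).
suff fS : \forall w \near z, f w = f z + (w - z) * (phi w / (f w + f z)).
  have cq : {for z, continuous (fun w => phi w / (f w + f z))}.
    have H1 := @contV K K z (fun w => f w + f z) fz2 cs.
    exact: (contM cphi H1).
  exact: (slope_derivable cq fS).1.
have := near_cont_neq cs fz2; apply: filterS => w s0.
apply: (mulIf s0); rewrite mulrDl -!mulrA mulVf// mulr1.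
have fwz : f w ^+ 2 - f z ^+ 2 = (w - z) * phi w by rewrite (fE w) addrC addKr.
by rewrite -fwz; ring.
Qed.

End Caratheodory.

(** * Continuous local roots in the complex plane *)

Section ComplexTopology.
Variable R : realType.
Local Notation C := (complex R)^o.
Implicit Types (u v z : C).

Lemma ReN z : Re (- z) = - Re z. Proof. by case: z. Qed.
Lemma ReD z u : Re (z + u) = Re z + Re u. Proof. by case: z; case: u. Qed.
Lemma ImD z u : Im (z + u) = Im z + Im u. Proof. by case: z; case: u. Qed.
Lemma ReB z u : Re (z - u) = Re z - Re u. Proof. by case: z; case: u. Qed.
Lemma ImB z u : Im (z - u) = Im z - Im u. Proof. by case: z; case: u. Qed.
Lemma ReM z u : Re (z * u) = Re z * Re u - Im z * Im u.
Proof. by case: z; case: u. Qed.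
Lemma ImM z u : Im (z * u) = Re z * Im u + Im z * Re u.
Proof. by case: z => a b; case: u => c d /=. Qed.

Lemma normc_ge_Im z : `|Im z|%:C%C <= `|z|.
Proof.
have := normc_ge_Re (z * 'i%C); rewrite ReiNIm normrN normrM.
by rewrite [`|'i%C|]normc_def /= expr0n expr1n add0r sqrtr1 mulr1.
Qed.

Lemma normc_real (x : R) : `|x%:C%C| = `|x|%:C%C.
Proof. by rewrite normc_def /= expr0n addr0 sqrtr_sqr. Qed.

Lemma gt0_complex (e : C) : 0 < e -> exists2 r : R, 0 < r & e = r%:C%C.
Proof.
case: e => a b; rewrite ltcE /= => /andP[/eqP -> a0]; by exists a.
Qed.

Lemma near_dist (K : numFieldType) (z : K) (e : K) : 0 < e ->
  \forall w \near z, `|z - w| < e.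
Proof. by move=> e0; apply/nbhs_ballP; exists e => // w; rewrite -ball_normE. Qed.

Lemma continuous_Re : continuous (Re : C -> R).
Proof.
move=> z; apply/cont_dist => e e0.
have e0' : 0 < e%:C%C by rewrite ltcR.
apply: (near_imp (near_dist z e0')) => w zw; rewrite -ltcR; apply: le_lt_trans zw.
by have := normc_ge_Re (z - w); rewrite ReB.
Qed.

Lemma continuous_Im : continuous (Im : C -> R).
Proof.
move=> z; apply/cont_dist => e e0.
have e0' : 0 < e%:C%C by rewrite ltcR.
apply: (near_imp (near_dist z e0')) => w zw; rewrite -ltcR; apply: le_lt_trans zw.
by have := normc_ge_Im (z - w); rewrite ImB.
Qed.

Lemma continuous_real_complex : continuous (real_complex R : R -> C).
Proof.
move=> x; apply/cont_dist => e /gt0_complex[r r0 ->].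
by apply: (near_imp (near_dist x r0)) => y; rewrite -raddfB normc_real ltcR.
Qed.

Lemma sqr_Re0 z : Re z = 0 -> Re (z ^+ 2) <= 0.
Proof.
by rewrite expr2; case: z => a b /= ->; rewrite mul0r sub0r oppr_le0 -expr2 sqr_ge0.
Qed.

Lemma near_Re_gt0 u : 0 < Re u -> \forall v \near u, 0 < Re v.
Proof.
move=> u0; have /cont_dist/(_ _ u0)/near_imp := @continuous_Re u; apply => v.
by move=> /ltr_distlDr; rewrite ltrDr.
Qed.

(* Unlike [sqrtc], continuous on the whole half-plane [0 < Re u]. *)
Definition half_sqrt u : C :=
  if 0 < Re (sqrtc u) then sqrtc u else - sqrtc u.

Lemma half_sqrtK u : half_sqrt u ^+ 2 = u.
Proof. by rewrite /half_sqrt; case: ifP => _; rewrite ?sqrrN sqr_sqrtc. Qed.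

Lemma half_sqrt_gt0 u : 0 < Re u -> 0 < Re (half_sqrt u).
Proof.
move=> u0; rewrite /half_sqrt; case: (ltP 0 (Re (sqrtc u))) => // s0.
rewrite ReN oppr_gt0 lt_neqAle s0 andbT; apply/eqP => /sqr_Re0.
by rewrite sqr_sqrtc leNgt u0.
Qed.

(** The difference of two such roots times their sum is [u - v], and the sum has real part at least
    [s], both roots lying in the right half-plane. So the roots differ by at most [|u - v|] divided
    by [s]. *)
Lemma half_sqrt_cont u : 0 < Re u -> {for u, continuous half_sqrt}.
Proof.
move=> u0; have s0 := half_sqrt_gt0 u0; set s := Re _ in s0.
have nu : \forall v \near u, 0 < Re v.
  by apply: near_Re_gt0.
apply/cont_dist => e e0.
have e0' : 0 < e * s%:C%C by rewrite mulr_gt0 ?ltcR.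
near=> v.
have v0 : 0 < Re v by near: v.
have vs : s%:C%C <= `|half_sqrt u + half_sqrt v|.
  apply: le_trans (normc_ge_Re _); rewrite lecR ReD ger0_norm.
    by rewrite lerDl ltW// half_sqrt_gt0.
  by rewrite addr_ge0// ltW// half_sqrt_gt0.
have s0' : 0 < s%:C%C :> C by rewrite ltcR.
rewrite -(ltr_pM2r s0'); apply: le_lt_trans (_ : `|u - v| < _).
  rewrite -[in leRHS](half_sqrtK u) -[in leRHS](half_sqrtK v) subr_sqr normrM.
  by rewrite ler_wpM2l.
by near: v; exact: near_dist.
Unshelve. all: by end_near. Qed.

(** Division by [u] moves the point to 1, well inside the half-plane where [half_sqrt] is
    continuous; the constant [sqrtc u] undoes the scaling. *)
Lemma local_sqrt u : u != 0 -> exists S : C -> C,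
  \forall v \near u, S v ^+ 2 = v /\ {for v, continuous S}.
Proof.
move=> u0; exists (fun v => sqrtc u * half_sqrt (v / u)).
have cd : forall v, {for v, continuous (fun v => v / u)}.
  by move=> v; exact: (contM (@cvg_id _ (nbhs v)) (cont_cst _)).
have : \forall v \near u, 0 < Re (v / u).
  have u1 : 0 < Re (u / u) by rewrite divff.
  exact: (cd u _ (near_Re_gt0 u1)).
move=> /near_imp; apply => v v0; split.
  by rewrite exprMn sqr_sqrtc half_sqrtK mulrC divfK.
apply: (contM (cont_cst (sqrtc u))).
exact: continuous_comp (cd v) (half_sqrt_cont v0).
Qed.

Lemma local_root u k : u != 0 -> exists S : C -> C,
  \forall v \near u, S v ^+ (2 ^ k) = v /\ {for v, continuous S}.
Proof.
elim: k u => [|k IH] u u0.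
  by exists id; apply: (@filterE _ (nbhs u)) => v; split => //; exact: cvg_id.
have [S HS] := IH _ u0.
have [Su cS] := nbhs_singleton HS.
have Su0 : S u != 0.
  by apply: contra_neq u0 => Su0; rewrite -Su Su0 expr0n expn_eq0.
have [T HT] := local_sqrt Su0; exists (T \o S).
have HTS := near_comp cS HT.
have H : forall v, S v ^+ (2 ^ k) = v /\ {for v, continuous S} ->
    T (S v) ^+ 2 = S v /\ {for S v, continuous T} ->
    (T \o S) v ^+ (2 ^ k.+1) = v /\ {for v, continuous (T \o S)}.
  move=> v [Sv cSv] [Tv cTv]; split; first by rewrite expnS exprM Tv.
  exact: (continuous_comp cSv cTv).
exact: (near_imp2 HS HTS H).
Qed.

End ComplexTopology.

Lemma connected_locally_constant (T : topologicalType) (A : set T) (V : Type)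
    (f : T -> V) : connected A ->
  (forall t, A t -> \forall u \near t, A u -> f u = f t) ->
  forall s t, A s -> A t -> f s = f t.
Proof.
move=> cA lf s t As At.
suff BA : [set u | A u /\ f s = f u] = A by move: At; rewrite -{1}BA => -[].
apply: cA; first by exists s.
- exists (interior [set u | A u -> f s = f u]); first exact: open_interior.
  apply/seteqP; split => u /=.
    move=> [Au fu]; split => //; apply: (near_imp (lf _ Au)) => v vu Av.
    by rewrite (vu Av).
  by move=> [Au /interior_subset/(_ Au)].
- exists (~` interior [set u | A u -> f s <> f u]).
    exact/open_closedC/open_interior.
  apply/seteqP; split => u /=.
    by move=> [Au fu]; split => // /interior_subset/(_ Au).
  move=> [Au nu]; split => //; apply: contrapT => fu; apply: nu.
  by apply: (near_imp (lf _ Au)) => v vu Av; rewrite (vu Av).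
Qed.

(** * The real mean value theorem along horizontal lines *)

Section RealSlices.
Variable R : realType.
Local Notation C := (complex R)^o.

Lemma ReZ (r : R) (z : C) : Re (r%:C%C * z) = r * Re z.
Proof. by rewrite ReM /= mul0r subr0. Qed.

Lemma ImZ (r : R) (z : C) : Im (r%:C%C * z) = r * Im z.
Proof. by rewrite ImM /= mul0r addr0. Qed.

Lemma cont_shift_real (z : C) (t : R) :
  {for t, continuous (fun s : R => z + s%:C%C : C)}.
Proof. exact: (contD (cont_cst z) (@continuous_real_complex R t)). Qed.

Lemma derive_real_slice (f : C -> C) (z : C) (t : R) :
  derivable f (z + t%:C%C) 1 ->
  is_derive t 1 (fun s => Re (f (z + s%:C%C))) (Re (derive1 f (z + t%:C%C))).
Proof.
move=> /derivable_slope[phi [cphi fE <-]].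
have c1 : {for t, continuous (fun s : R => phi (z + s%:C%C))}.
  exact: (continuous_comp (@cont_shift_real z t) cphi).
have c2 : {for t, continuous (fun s : R => Re (phi (z + s%:C%C)))}.
  exact: (continuous_comp c1 (@continuous_Re R _)).
have [//|d dE] := @slope_derivable R (fun s => Re (f (z + s%:C%C)))
  (fun s => Re (phi (z + s%:C%C))) t c2 _.
  apply: (@filterE _ (nbhs t)) => s; rewrite (fE (z + s%:C%C)) ReD.
  by rewrite opprD addrACA subrr add0r -raddfB ReZ.
by apply: DeriveDef => //; rewrite -derive1E.
Qed.

Lemma mean_value (f df : R -> R) (a b : R) : a < b ->
  (forall x : R, a <= x <= b -> is_derive x 1 f (df x)) ->
  exists2 c, a < c < b & f b - f a = df c * (b - a).
Proof.
move=> ab dfx; have [||c] := @MVT R f df a b ab.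
- by move=> s; rewrite in_itv /= => /andP[s0 st]; apply: dfx; rewrite !ltW.
- apply: derivable_within_continuous => s; rewrite in_itv /= => ss.
  exact: (@ex_derive _ _ _ _ _ _ _ (dfx s ss)).
by rewrite in_itv /= => cc; exists c.
Qed.

(** The mean value theorem fails for complex values. Multiplying [f w - l * w] by the conjugate of
    the supposed error [d] makes its derivative at [z] the positive real number |d|^2, so that the
    real theorem applies to the real part. *)
Lemma derive1_limit (f : C -> C) (z l : C) :
  (\forall w \near z, derivable f w 1) ->
  (forall e : C, 0 < e -> \forall w \near z, w != z -> `|derive1 f w - l| < e) ->
  derive1 f z = l.
Proof.
move=> df dl; apply/eqP; rewrite -subr_eq0; apply/negP => /negP d0.
set d := _ - _ in d0.
(* On a horizontal segment from z, the slopes of Re g tend to |d|^2 > 0,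
   whereas its derivatives tend to 0. *)
pose g (w : C) := (d^*%C : C) * (f w - l * w).
have dg : \forall w \near z, derivable g w 1 /\ derive1 g w = d^*%C * (derive1 f w - l).
  apply: (near_imp df) => w /derivable_slope[phi [cphi fE <-]].
  apply: (@slope_derivable _ g (fun v => d^*%C * (phi v - l)) w).
    exact: (contM (cont_cst _) (contB cphi (cont_cst l))).
  by apply: (@filterE _ (nbhs w)) => v; rewrite /g fE; ring.
have nd : 0 < `|d| by rewrite normr_gt0.
have [r r0 rE] := gt0_complex nd.
have [dgz dgzE] := nbhs_singleton dg.
have dd : Re (derive1 g z) = r ^+ 2.
  rewrite dgzE mulrC -/d -[LHS]/(Re ((d * d^*%C) : C)).
  by rewrite -sqr_normc rE -rmorphXn.
have small : \forall w \near z, w != z -> `|Re (derive1 g w)| < r ^+ 2 / 2.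
  have e0 : 0 < (r / 2)%:C%C :> C by rewrite ltcR divr_gt0.
  apply: (near_imp2 dg (dl _ e0)) => w [_ ->] H wz.
  have {}H := H wz.
  rewrite -ltcR; apply: le_lt_trans (normc_ge_Re _) _.
  have -> : (r ^+ 2 / 2)%:C%C = `|d| * (r / 2)%:C%C :> C.
    by rewrite rE -rmorphM mulrA expr2.
  by rewrite normrM normcJ (ltr_pM2l nd).
have sl := derive_real_slice (z := z) (t := 0).
rewrite addr0 in sl. have {}sl := sl _ dgz.
have /derivable_slope[psi [cpsi gE]] := @ex_derive _ _ _ _ _ _ _ sl.
rewrite derive1E (@derive_val _ _ _ _ _ _ _ sl) dd => psi0.
have c0 : {for (0:R), continuous (fun s : R => z + s%:C%C : C)} := @cont_shift_real z 0.
have z0 : z = z + (0:R)%:C%C by rewrite addr0.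
rewrite z0 in small dg.
have N1 := near_comp c0 small.
have N2 := near_comp c0 dg.
have r2 : 0 < r ^+ 2 / 2 by rewrite divr_gt0 ?exprn_gt0.
have /cont_dist/(_ _ r2) N3 := cpsi.
have /nbhs_ballP[e /= e0 He] : nbhs (0 : R) (fun s =>
    ((z + s%:C%C != z + (0 : R)%:C%C ->
        `|Re (derive1 g (z + s%:C%C))| < r ^+ 2 / 2) /\
      derivable g (z + s%:C%C) 1) /\
    `|psi 0 - psi s| < r ^+ 2 / 2).
  apply: (near_imp2 (near_imp2 N1 N2 (fun s a b => conj a b.1)) N3).
  by [].
have He' s : `|s| < e -> _ := fun h => He s _.
pose t := e / 2. have t0 : 0 < t by rewrite divr_gt0.
have inb s : 0 <= s <= t -> ball (0:R) e s.
  move=> /andP[s0 st]; rewrite -ball_normE /= sub0r normrN ger0_norm//.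
  by apply: le_lt_trans st _; rewrite /t; lra.
have dd' s : 0 <= s <= t ->
    is_derive s 1 (fun s => Re (g (z + s%:C%C))) (Re (derive1 g (z + s%:C%C))).
  by move=> /inb/He[[_ ?] _]; exact: derive_real_slice.
have [c /andP[c00 ct]] := mean_value t0 dd'.
rewrite gE !subr0 addrAC subrr add0r mulrC => /(mulIf (lt0r_neq0 t0)) pt.
have tt : 0 <= t <= t by rewrite lexx ltW.
have [_ p2] := He t (inb t tt).
have cc : 0 <= c <= t by rewrite !ltW.
have [[p1 _] _] := He c (inb c cc).
have cz : z + c%:C%C != z + (0 : R)%:C%C.
  rewrite (inj_eq (addrI z)) -subr_eq0 -rmorphB subr0 -(rmorph0 (real_complex R)).
  by rewrite (inj_eq (@complexI R)) gt_eqF.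
have {}p1 := p1 cz; rewrite pt psi0 in p2.
(* The slope over [[0, t]] is the derivative at [c]: it is below half of [r ^+ 2], and yet within
   half of [r ^+ 2] from the value [r ^+ 2]. *)
move: p1 p2; rewrite !ltr_norml => /andP[_ h1] /andP[_ h2].
by have := ltrD h1 h2; rewrite addrC subrK -splitr ltxx.
Qed.

End RealSlices.

(** * Fourth roots of unity *)

Section FourthRootsOfUnity.
Variable R : realType.
Local Notation C := (complex R)^o.
Implicit Types (k l : 'Z_4) (u v : C).

Definition iZ k : C := 'i%C ^+ k.

Lemma i_exp4 : ('i%C : C) ^+ 4 = 1.
Proof. by rewrite (exprM _ 2 2) sqr_i sqrrN expr1n. Qed.

Lemma iZ0 : iZ 0 = 1. Proof. exact: expr0. Qed.

Lemma iZD k l : iZ (k + l) = iZ k * iZ l.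
Proof.
rewrite /iZ -exprD [RHS](_ : _ = 'i%C ^+ ((k + l) %% 4))//.
by rewrite {1}(divn_eq (k + l) 4) exprD mulnC exprM i_exp4 expr1n mul1r.
Qed.

Lemma iZ_X4 k : iZ k ^+ 4 = 1.
Proof. by rewrite /iZ -exprM mulnC exprM i_exp4 expr1n. Qed.

Lemma iZ_neq0 k : iZ k != 0.
Proof.
by apply/negP => /eqP k0; have := iZ_X4 k; rewrite k0 expr0n => /eqP;
  rewrite eq_sym oner_eq0.
Qed.

Lemma iZ_eq1 k : iZ k = 1 -> k = 0.
Proof.
case: k => [[|[|[|[|//]]]] kp] /=; rewrite /iZ /=.
- by move=> _; apply: val_inj.
- by rewrite expr1 => /(congr1 (@complex.Re _)) /= /eqP; rewrite eq_sym oner_eq0.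
- rewrite sqr_i => /(congr1 (@complex.Re _)) /= /eqP.
  by rewrite -subr_eq0 -opprD oppr_eq0 paddr_eq0 ?ler01 ?oner_eq0.
- rewrite exprS sqr_i mulrN1 => /(congr1 (@complex.Re _)) /= /eqP.
  by rewrite oppr0 eq_sym oner_eq0.
Qed.

Lemma iZ_inj : injective iZ.
Proof.
move=> k l kl; apply/eqP; rewrite -subr_eq0; apply/eqP/iZ_eq1.
have /mulIf := iZ_neq0 l; apply.
by rewrite -iZD subrK mul1r.
Qed.

Lemma iZ_pow k n : iZ (k *+ n) = iZ k ^+ n.
Proof. by elim: n => [|n IH]; rewrite ?mulr0n ?iZ0 ?expr0// mulrS iZD IH exprS. Qed.

Lemma root4 u v : v != 0 -> u ^+ 4 = v ^+ 4 -> exists k, u = iZ k * v.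
Proof.
move=> v0 uv; pose t := u / v.
have t4 : t ^+ 4 = 1 by rewrite /t expr_div_n uv divff ?expf_neq0.
have -> : u = t * v by rewrite /t divfK.
have : (t ^+ 2 - 1) * (t ^+ 2 + 1) = 0.
  by rewrite -subr_sqr_1 -exprM t4 subrr.
move/eqP; rewrite mulf_eq0 => /orP[|].
  rewrite subr_sqr_1 mulf_eq0 => /orP[]; rewrite ?subr_eq0 ?addr_eq0 => /eqP ->.
    by exists 0; rewrite iZ0.
  by exists 2; rewrite /iZ /= sqr_i.
rewrite -[1]opprK -sqr_i subr_sqr mulf_eq0 => /orP[].
  by rewrite subr_eq0 => /eqP ->; exists 1; rewrite /iZ /= expr1.
rewrite addr_eq0 => /eqP ->; exists 3.
by rewrite /iZ /= exprS sqr_i mulrN1.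
Qed.

(** The ratio of [f] and [g] is continuous with at most four values, so near [x] it avoids those
    other than its value at [x]. Nothing is assumed on the continuity of [k]: this is how continuity
    of branches turns into local constancy in Z/4. *)
Lemma root_ratio_locally_constant (T : topologicalType) (x : T) (f g : T -> C)
    (k : T -> 'Z_4) :
  (\forall y \near x, f y = iZ (k y) * g y) -> {for x, continuous f} ->
  {for x, continuous g} -> g x != 0 -> \forall y \near x, k y = k x.
Proof.
move=> fE cf cg g0; have fx := nbhs_singleton fE.
pose h y := f y / g y.
have ch : {for x, continuous h} by exact: (contM cf (contV g0 cg)).
have hx : h x = iZ (k x) by rewrite /h fx mulfK.
have H : \forall y \near x, forall j : 'Z_4, j != k x -> h y != iZ j.
  apply: (@filter_forall _ _ (fun j y => j != k x -> h y != iZ j) (nbhs x)) => j.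
  have [->|jk] := eqVneq j (k x); first by apply: (@filterE _ (nbhs x)).
  have hj : h x != iZ j by rewrite hx (inj_eq iZ_inj) eq_sym.
  by apply: (near_imp (near_cont_neq ch hj)).
have g0' := near_cont_neq cg g0.
apply: (near_imp2 H (near_imp2 fE g0' (fun y a b => conj a b))) => y Hy [fy gy].
apply/eqP; apply: contraT => kk; have := Hy _ kk.
by rewrite /h fy mulfK// eqxx.
Qed.

End FourthRootsOfUnity.

(** The annihilator of 4/e in Z/4 is e Z/4; bounds on the image of the holonomy are proved in the
    form of annihilation. *)
Lemma Z4_multiples (k : 'Z_4) (e : nat) : (e %| 4)%N -> k *+ (4 %/ e) = 0 ->
  exists j : 'Z_4, k = e%:R * j.
Proof.
have [] : e = 0%N \/ (e < 5)%N \/ (4 < e)%N by lia.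
  by move=> ->.
case=> [|e4 /dvdn_leq]; last by lia.
move: e => [|[|[|[|[|//]]]]] //= _ _.
- by exists k; rewrite mul1r.
- case: k => [[|[|[|[|//]]]] kp] /eqP //= _; [exists 0|exists 1];
    by apply/val_inj.
- by rewrite mulr1n => ->; exists 0; rewrite mulr0.
Qed.

(** * Sections of powers of the canonical bundle *)

Lemma near_near (T : topologicalType) (x : T) (P : T -> Prop) :
  (\forall y \near x, P y) -> \forall y \near x, \forall z \near y, P z.
Proof. by move=> /nbhs_interior. Qed.

Section Charts.
Variables (R : realType) (X : riemannSurface R).
Local Notation C := (complex R)^o.
Local Notation dom a := (chart_dom (rs_chart a)).
Local Notation coord a := (chart_map (rs_chart a)).
Local Notation inv a := (chart_inv (rs_chart a)).
Implicit Types (a b c : rs_index X) (x y : X).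

Lemma near_dom a x : dom a x -> \forall y \near x, dom a y.
Proof. by move=> ax; apply: open_nbhs_nbhs; split => //; exact: chart_dom_open. Qed.

Lemma coordK a x : dom a x -> inv a (coord a x) = x.
Proof. by move=> /mem_set/(@chart_mapK _ _ (rs_chart a)). Qed.

Lemma coord_cont a x : dom a x -> {for x, continuous (coord a : X -> C)}.
Proof. by move=> /mem_set/(@chart_map_continuous _ _ (rs_chart a)). Qed.

Lemma inv_cont a x : dom a x -> {for coord a x, continuous (inv a : C -> X)}.
Proof.
move=> ax; have : coord a x \in coord a @` dom a by apply/mem_set; exists x.
by move=> /(@chart_inv_continuous _ _ (rs_chart a)).
Qed.

Lemma near_coord a x (P : C -> Prop) : dom a x ->
  (\forall w \near (coord a x : C), P w) -> \forall y \near x, P (coord a y).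
Proof. by move=> ax nP; exact: (near_comp (coord_cont ax) nP). Qed.

Lemma near_inv a x (P : X -> Prop) : dom a x ->
  (\forall y \near x, P y) -> \forall w \near (coord a x : C), P (inv a w).
Proof.
move=> ax nP; apply: (near_comp (inv_cont ax)).
by rewrite (coordK ax).
Qed.

Lemma near_image a x : dom a x ->
  \forall w \near (coord a x : C), dom a (inv a w) /\ coord a (inv a w) = w.
Proof.
move=> ax; have im : (coord a @` dom a) (coord a x) by exists x.
have := open_nbhs_nbhs (conj (@chart_image_open _ _ (rs_chart a)) im).
by move=> /near_imp; apply => _ [y ay <-]; rewrite coordK.
Qed.

Lemma cont_expr a x (f : X -> C) : dom a x ->
  {for (coord a x : C), continuous (f \o inv a : C -> C)} ->
  {for x, continuous f}.
Proof.
move=> ax cf; have := continuous_comp (coord_cont ax) cf.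
apply: near_eq_cont; apply: (near_imp (near_dom ax)) => y ay /=.
by rewrite coordK.
Qed.

Lemma expr_cont a x (f : X -> C) : dom a x -> {for x, continuous f} ->
  {for (coord a x : C), continuous (f \o inv a : C -> C)}.
Proof.
move=> ax cf; apply: (continuous_comp (inv_cont ax)).
by rewrite (coordK ax).
Qed.

(* Images of charts are open in the plane, so points are never isolated. *)
Lemma near_punctured x (P : X -> Prop) :
  (\forall y \near x, P y) -> exists2 y, y != x & P y.
Proof.
have [a ax] := rs_cover x => nP.
have := near_imp2 (near_inv ax nP) (near_image ax) (fun w p q => conj p q).
move=> /nbhs_ballP[e /= e0 He].
have [r r0 rE] := gt0_complex e0.
pose w : C := coord a x + e / 2.
have e2 : 0 < e / 2 :> C by rewrite divr_gt0.
have [|Pw [aw wE]] := He w.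
  rewrite -ball_normE /= /w opprD addrA subrr sub0r normrN gtr0_norm//.
  by rewrite ltr_pdivrMr// mulr_natr mulr2n ltrDl.
exists (inv a w) => //; apply/eqP => wx; move: wE; rewrite wx => /eqP.
by rewrite /w -subr_eq0 opprD addrA subrr sub0r oppr_eq0 gt_eqF.
Qed.

Definition transition a b : C -> C := coord b \o inv a.

Lemma transition_derivable a b x : dom a x -> dom b x ->
  \forall w \near (coord a x : C), derivable (transition a b) w 1.
Proof. by move=> ax bx; exact: rs_holomorphic ax bx. Qed.

Lemma jacobian_id a x : dom a x -> jacobian a a x = 1.
Proof.
move=> ax.
have fE : \forall w \near (coord a x : C),
    transition a a w = transition a a (coord a x) + (w - coord a x) * 1.
  apply: (near_imp (near_image ax)) => w [_ wE].
  by rewrite /transition /= wE coordK// mulr1 addrC subrK.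
exact: (slope_derivable (cont_cst 1) fE).2.
Qed.

Lemma jacobian_trans a b c x : dom a x -> dom b x -> dom c x ->
  jacobian a c x = jacobian a b x * jacobian b c x.
Proof.
move=> ax bx cx.
have dab := nbhs_singleton (transition_derivable ax bx).
have dbc := nbhs_singleton (transition_derivable bx cx).
have E : transition a b (coord a x) = coord b x by rewrite /transition /= coordK.
rewrite -E in dbc; have [dd ddE] := chain_rule dab dbc.
rewrite /jacobian mulrC -E -ddE.
apply: (near_eq_derive _ dd).2.
have nb : \forall w \near (coord a x : C), dom b (inv a w).
  exact: (near_inv ax (near_dom bx)).
by apply: (near_imp nb) => w bw; rewrite /transition /= (coordK bw).
Qed.

Lemma jacobian_neq0 a b x : dom a x -> dom b x -> jacobian a b x != 0.
Proof.
move=> ax bx; apply/eqP => J0; have := jacobian_trans ax bx ax.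
by rewrite J0 mul0r jacobian_id// => /eqP; rewrite oner_eq0.
Qed.

End Charts.

Section Orders.
Variable R : realType.
Local Notation C := (complex R)^o.
Implicit Types (f g h : C -> C) (z : C) (k l : int).

(** Unlike [has_order], this leaves the value at [z] free, and so it is stable under pointwise
    products, inverses and powers. *)
Definition punctured_order f z k := exists h : C -> C,
  [/\ holomorphic_at h z, h z != 0 &
    \forall w \near z, w != z -> f w = (w - z) ^ k * h w].

Lemma has_order_punctured f z k : has_order f z k -> punctured_order f z k.
Proof.
by move=> [h [hh h0 fE]]; exists h; split => //; apply: (near_imp fE) => w ->.
Qed.

Lemma holomorphic_cont f z : holomorphic_at f z -> {for z, continuous f}.
Proof. by move=> hf; exact: derivable_cont (nbhs_singleton hf). Qed.

Lemma holomorphic_near_cont f z : holomorphic_at f z ->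
  \forall w \near z, {for w, continuous f}.
Proof. by move=> hf; apply: (near_imp hf) => w; exact: derivable_cont. Qed.

Lemma holomorphicM f g z : holomorphic_at f z -> holomorphic_at g z ->
  holomorphic_at (fun w => f w * g w) z.
Proof. by move=> hf hg; apply: (near_imp2 hf hg) => w df dg; exact: (derivableM df dg). Qed.

Lemma holomorphicV f z : holomorphic_at f z -> f z != 0 ->
  holomorphic_at (fun w => (f w)^-1) z.
Proof.
move=> hf f0; have nf := near_cont_neq (holomorphic_cont hf) f0.
by apply: (near_imp2 hf nf) => w df fw; exact: (derivableV fw df).
Qed.

Lemma holomorphicX f z n : holomorphic_at f z ->
  holomorphic_at (fun w => f w ^+ n) z.
Proof. by move=> hf; apply: (near_imp hf) => w df; exact: derivable_pow. Qed.

Lemma punctured_orderM f g z k l : punctured_order f z k ->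
  punctured_order g z l -> punctured_order (fun w => f w * g w) z (k + l).
Proof.
move=> [h1 [hh1 h10 fE]] [h2 [hh2 h20 gE]]; exists (fun w => h1 w * h2 w); split.
- exact: holomorphicM.
- by rewrite mulf_neq0.
apply: (near_imp2 fE gE) => w fw gw wz; rewrite fw// gw// expfzDr ?subr_eq0//.
by ring.
Qed.

Lemma punctured_orderV f z k : punctured_order f z k ->
  punctured_order (fun w => (f w)^-1) z (- k).
Proof.
move=> [h [hh h0 fE]]; exists (fun w => (h w)^-1); split.
- exact: holomorphicV.
- by rewrite invr_eq0.
by apply: (near_imp fE) => w fw wz; rewrite fw// invfM invr_expz.
Qed.

Lemma punctured_orderX f z k n : punctured_order f z k ->
  punctured_order (fun w => f w ^+ n) z (k *+ n).
Proof.
move=> [h [hh h0 fE]]; exists (fun w => h w ^+ n); split.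
- exact: holomorphicX.
- by rewrite expf_neq0.
apply: (near_imp fE) => w fw wz; rewrite fw// exprMn; congr (_ * _).
by rewrite exprnP exprz_exp -[k *+ n]mulr_natr natz.
Qed.

End Orders.

Lemma solve_factor (F : fieldType) (t p h J u : F) n : t != 0 -> p ^ n != 0 -> h != 0 ->
  t * u = t * p ^ n * h * J -> J = u / (p ^ n * h).
Proof.
move=> t0 p0 h0; rewrite -!mulrA => /(mulfI t0) ->.
by rewrite mulrA mulrAC divff ?mul1r// mulf_neq0.
Qed.

Section Sections.
Variables (R : realType) (X : riemannSurface R).
Local Notation C := (complex R)^o.
Local Notation dom a := (chart_dom (rs_chart a)).
Local Notation coord a := (chart_map (rs_chart a)).
Local Notation inv a := (chart_inv (rs_chart a)).
Implicit Types (a b c : rs_index X) (x y : X) (q w : coefficients X).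
Implicit Types (D K : {freeg X}).

Lemma near_expr a x (P : C -> C -> Prop) (f : X -> C) : dom a x ->
  (\forall w \near (coord a x : C), P w (f (inv a w))) ->
  \forall y \near x, P (coord a y) (f y).
Proof.
move=> ax nP; apply: (near_imp2 (near_coord ax nP) (near_dom ax)) => y + ay.
by rewrite (coordK ay).
Qed.

Lemma coord_neq a x y : dom a x -> dom a y -> y != x -> coord a y != coord a x.
Proof. by move=> ax ay; apply: contra_neq => e; rewrite -(coordK ay) e coordK. Qed.

(* The derivative of a transition map is a quotient of coefficients of a
   differential, so it has a limit at every point; by the mean value theorem
   this limit is its value. *)
Lemma jacobian_cont w K a b x : (forall x, transforms_at 1 w x) ->
  has_div w K -> dom a x -> dom b x ->
  {for x, continuous (jacobian a b : X -> C)}.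
Proof.
move=> wt wK ax bx; move: (wK a x ax) (wK b x bx); move: (coeff x K) => k.
move=> [ha [hha ha0 haE]] [hb [hhb hb0 hbE]].
have dt := transition_derivable ax bx.
have [phi [cphi tE phix]] := derivable_slope (nbhs_singleton dt).
have phi0 : phi (coord a x) != 0 by rewrite phix; exact: jacobian_neq0.
(* The formula for the Jacobian off [x]: both coefficients of [w] are expanded at [x], the
   difference of [b]-coordinates is the difference of [a]-coordinates times [phi], and the [k]-th
   powers of the latter cancel. *)
pose G y : C := ha (coord a y) / (phi (coord a y) ^ k * hb (coord b y)).
have cG : {for x, continuous G}.
  have ca := coord_cont ax; have cb := coord_cont bx.
  have c1 := continuous_comp ca (holomorphic_cont hha).
  have c2 := continuous_comp cb (holomorphic_cont hhb).
  have c3 := continuous_comp ca cphi.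
  have c4 := contM (contXz (f := phi \o coord a) (k := k) phi0 c3) c2.
  have n4 : (phi \o coord a) x ^ k * (hb \o coord b) x != 0.
    by rewrite mulf_neq0 ?expfz_neq0.
  exact: (contM c1 (contV (f := fun y => (phi \o coord a) y ^ k * (hb \o coord b) y) n4 c4)).
have JG : \forall y \near x, y != x -> jacobian a b y = G y.
  have n1 := near_expr (P := fun v u => u = (v - coord a x) ^ k * ha v) ax haE.
  have n2 := near_expr (P := fun v u => u = (v - coord b x) ^ k * hb v) bx hbE.
  have n3 := near_imp2 (near_dom ax) (near_dom bx) (fun _ => @conj _ _).
  have n4 := near_cont_neq (continuous_comp (coord_cont ax) cphi) phi0.
  have n5 := near_cont_neq (continuous_comp (coord_cont bx) (holomorphic_cont hhb)) hb0.
  have n45 := near_imp2 n4 n5 (fun _ => @conj _ _).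
  apply: (near_imp2 (near_imp2 n1 n2 (fun _ => @conj _ _))
     (near_imp2 n3 n45 (fun _ => @conj _ _))) => y [E1 E2] [[ay by_] [E4 E5]] yx.
  have := wt y a b ay by_; rewrite E1 E2 expr1.
  have -> : coord b y - coord b x = (coord a y - coord a x) * phi (coord a y).
    have := tE (coord a y); rewrite /transition /= !coordK// => ->.
    by rewrite addrC addKr.
  have u0 : (coord a y - coord a x) ^ k != 0.
    by rewrite expfz_neq0// subr_eq0 coord_neq.
  rewrite expfzMl => E; have p0 : phi (coord a y) ^ k != 0 by rewrite expfz_neq0.
  exact: (solve_factor u0 p0 E5 E).
have JGx : jacobian a b x = G x.
  apply: (derive1_limit dt) => e e0.
  have n1 := near_inv ax JG.
  have cGi := expr_cont ax cG.
  have /cont_dist/(_ _ e0) n2 := cGi.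
  have n3 := near_image ax.
  apply: (near_imp2 (near_imp2 n1 n3 (fun _ => @conj _ _)) n2) => v [vG [av vE]] + vx.
  rewrite /= (coordK ax) distrC => H.
  have vx' : inv a v != x by apply: contra_neq vx => vx; rewrite -vE vx.
  by have := vG vx'; rewrite /jacobian vE => ->.
apply: (near_eq_cont _ cG); apply: (near_imp JG) => y yx.
by have [->|/yx ->] := eqVneq y x.
Qed.

Definition continuable_to (f : X -> C) x (l : C) :=
  {for x, continuous (fun y => if y == x then l else f y)}.

Lemma continuable_unique (f : X -> C) x l (g : X -> C) :
  continuable_to f x l -> {for x, continuous g} ->
  (\forall y \near x, y != x -> f y = g y) -> l = g x.
Proof.
move=> cf cg fg; apply/eqP; rewrite -subr_eq0; apply: contraT => d0.
have d0' : (if x == x then l else f x) - g x != 0 by rewrite eqxx.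
have := near_punctured
  (near_imp2 (near_cont_neq (contB cf cg) d0') fg (fun _ => @conj _ _)).
by move=> [y yx [+ fy]]; rewrite (negPf yx) fy// subrr eqxx.
Qed.

Lemma continuable_near (f g : X -> C) x : {for x, continuous g} ->
  (\forall y \near x, y != x -> f y = g y) -> continuable_to f x (g x).
Proof.
move=> cg fg; apply: (near_eq_cont _ cg); apply: (near_imp fg) => y fy.
by case: eqP => [->//|/eqP/fy ->].
Qed.

(* A pointwise product or quotient of coefficients has the wrong value where a
   zero cancels a pole, since [has_order] prescribes the value 0 at both. *)
Definition limit_coefficient q a x : C :=
  xget 0 [set l | l != 0 /\ continuable_to (q a) x l].

Lemma limit_coefficientE q a x (g : X -> C) : {for x, continuous g} -> g x != 0 ->
  (\forall y \near x, y != x -> q a y = g y) -> limit_coefficient q a x = g x.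
Proof.
move=> cg g0 qg; have cq := continuable_near cg qg.
rewrite /limit_coefficient; case: xgetP => [l _ [l0 cl]|/(_ (g x))].
  exact: continuable_unique cl cg qg.
by move=> H; exfalso; apply: H.
Qed.

Lemma limit_coefficient_order q a x k : dom a x ->
  punctured_order (local_expr q a) (coord a x) k ->
  has_order (local_expr (limit_coefficient q) a) (coord a x) k.
Proof.
move=> ax [h [hh h0 qE]]; exists h; split => //.
set z := coord a x.
have nn := near_near qE; have nh := near_near hh.
have nh0 := near_cont_neq (holomorphic_cont hh) h0.
have nim := near_image ax.
apply: (near_imp2 (near_imp2 nn nh (fun _ => @conj _ _))
  (near_imp2 nh0 nim (fun _ => @conj _ _))) => v [nq nhv] [hv0 [av vE]].
have [vz|vz] := eqVneq v z; last first.
  have ci : {for inv a v, continuous (coord a : X -> C)} := coord_cont av.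
  pose g y : C := (coord a y - z) ^ k * h (coord a y).
  have vz0 : v - z != 0 by rewrite subr_eq0.
  have hv : holomorphic_at h (coord a (inv a v)) by rewrite vE.
  have cg : {for inv a v, continuous g}.
    have c1 := continuous_comp ci (holomorphic_cont hv).
    have c2 := contB ci (cont_cst z).
    have vz0' : (fun y => coord a y - z) (inv a v) != 0 by rewrite vE.
    exact: (contM (contXz (f := fun y => coord a y - z) (k := k) vz0' c2) c1).
  have gv : g (inv a v) = (v - z) ^ k * h v by rewrite /g vE.
  rewrite -gv; apply: limit_coefficientE => //.
    by rewrite gv mulf_neq0// expfz_neq0.
  rewrite -{1}vE in nq.
  have n1 := near_expr (P := fun v u => v != z -> u = (v - z) ^ k * h v) av nq.
  have vz' : coord a (inv a v) != z by rewrite vE.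
  have n2 := near_cont_neq ci vz'.
  by apply: (near_imp2 n1 n2) => y H1 H2 _; exact: H1.
rewrite vz {v vz nq nhv hv0 av vE} subrr /local_expr /=.
rewrite /z coordK// -/z.
have n1 := near_expr (P := fun v u => v != z -> u = (v - z) ^ k * h v) ax qE.
have cx := coord_cont ax.
have n2 : \forall y \near x, y != x -> coord a y != z.
  by apply: (near_imp (near_dom ax)) => y ay yx; exact: coord_neq.
have ch := continuous_comp cx (holomorphic_cont hh).
have czk (n : nat) := contX (n := n) (contB cx (cont_cst z)).
(* At the centre, order 0 gives the limit [h]. For positive order the limit is 0, for negative order
   the inverse tends to 0; neither leaves a nonzero limit, and the default 0 of [xget] is the value
   that [has_order] prescribes. *)
case: k qE n1 {nn nh} => [[|n]|n] qE n1.
- rewrite expr0z mul1r; rewrite -[RHS]/((h \o coord a) x).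
  apply: limit_coefficientE => //.
  by apply: (near_imp2 n1 n2) => y H1 H2 /H2/H1; rewrite expr0z mul1r.
- rewrite -exprnP exprS mul0r mul0r /limit_coefficient; case: xgetP => // l _ [l0 cl].
  have := continuable_unique cl (contM (czk n.+1) ch) _.
  rewrite /= subrr exprS !mul0r => H; exfalso; move/eqP: l0; apply; apply: H.
  by apply: (near_imp2 n1 n2) => y H1 H2 /H2/H1.
- rewrite NegzE -exprnN exprS mul0r invr0 mul0r /limit_coefficient.
  case: xgetP => // l _ [l0 cl].
  have cl' : continuable_to (fun y => (q a y)^-1) x l^-1.
    have l0' : (if x == x then l else q a x) != 0 by rewrite eqxx.
    apply: (near_eq_cont _ (contV l0' cl)); apply: (@filterE _ (nbhs x)) => y.
    by case: ifP.
  have h0' : (h \o coord a) x != 0 by [].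
  have := continuable_unique cl' (contM (czk n.+1) (contV h0' ch)) _.
  rewrite /= subrr exprS !mul0r => H; exfalso; move/eqP: l0; apply.
  apply: invr_inj; rewrite invr0; apply: H.
  apply: (near_imp2 n1 n2) => y H1 H2 /H2/H1 ->.
  by rewrite NegzE -exprnN invfM invrK.
Qed.

(** As the Jacobians are continuous and nonzero, a nonzero limit in one chart gives the transformed
    nonzero limit in the other. Consequently the default 0 also occurs in both charts or in
    neither. *)
Lemma limit_coefficient_transforms k q :
  (forall a b x, dom a x -> dom b x -> {for x, continuous (jacobian a b : X -> C)}) ->
  (forall x, transforms_at k q x) -> forall x, transforms_at k (limit_coefficient q) x.
Proof.
move=> Jc qt x; pose J a b y : C := jacobian a b y.
have step a b l : dom a x -> dom b x -> l != 0 -> continuable_to (q b) x l ->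
    limit_coefficient q a x = l * jacobian a b x ^+ k.
  move=> ax bx l0 cl.
  pose g y : C := (if y == x then l else q b y) * J a b y ^+ k.
  have -> : l * jacobian a b x ^+ k = g x by rewrite /g eqxx.
  apply: limit_coefficientE.
  - exact: (contM cl (contX (n := k) (Jc a b x ax bx))).
  - by rewrite /g eqxx mulf_neq0// expf_neq0// jacobian_neq0.
  apply: (near_imp2 (near_dom ax) (near_dom bx)) => y ay by_ yx.
  by rewrite /g (negPf yx); exact: qt.
move=> a b ax bx; rewrite {2}/limit_coefficient.
case: xgetP => [l _ [l0 cl]|nb]; first exact: step.
rewrite mul0r {1}/limit_coefficient; case: xgetP => // l _ [l0 cl].
have := step b a l bx ax l0 cl; rewrite /limit_coefficient.
case: xgetP => [l' _ Hl'|_ /esym/eqP]; first by case: (nb l').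
by rewrite mulf_eq0 (negPf l0) expf_eq0 (negPf (jacobian_neq0 bx ax)) andbF.
Qed.

Definition section_div k q D := (forall x, transforms_at k q x) /\ has_div q D.

Lemma section_div_nonzero k q D x : section_div k q D ->
  \forall y \near x, y != x -> forall a, dom a y -> q a y != 0.
Proof.
move=> [qt qD]; have [a ax] := rs_cover x.
have [h [hh h0 qE]] := qD a x ax.
have nh0 := near_coord ax (near_cont_neq (holomorphic_cont hh) h0).
have n1 := near_expr (P := fun v u => u = (v - coord a x) ^ (coeff x D) * h v) ax qE.
apply: (near_imp2 (near_imp2 n1 nh0 (fun _ => @conj _ _)) (near_dom ax)).
move=> y [qy hy] ay yx b by_.
rewrite (qt y b a by_ ay) mulf_neq0 ?expf_neq0 ?jacobian_neq0// qy.
by rewrite mulf_neq0// expfz_neq0// subr_eq0 coord_neq.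
Qed.

Lemma section_differential k q D : section_div k q D -> differential k q.
Proof.
move=> qs; have [qt qD] := qs; split.
  by split=> // a x ax; right; exists (coeff x D); exact: qD.
have [x _] := rs_nonempty X.
have [y yx qy] := near_punctured (section_div_nonzero x qs).
by have [a ay] := rs_cover y; exists a, y; split => //; exact: qy.
Qed.

Lemma limit_section k q D :
  (forall a b x, dom a x -> dom b x -> {for x, continuous (jacobian a b : X -> C)}) ->
  (forall x, transforms_at k q x) ->
  (forall a x, dom a x -> punctured_order (local_expr q a) (coord a x) (coeff x D)) ->
  section_div k (limit_coefficient q) D.
Proof.
move=> Jc qt qD; split; first exact: limit_coefficient_transforms.
by move=> a x ax; exact/limit_coefficient_order/qD.
Qed.

Lemma weight0_function q : (forall x, transforms_at 0 q x) ->
  exists f : X -> C, forall a x, dom a x -> f x = q a x.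
Proof.
move=> qt; exists (fun x => q (projT1 (cid (rs_cover x))) x) => a x ax.
have := qt x (projT1 (cid (rs_cover x))) a.
by rewrite expr0 mulr1; apply => //; exact: (projT2 (cid (rs_cover x))).
Qed.

Lemma linearly_equivalent_section w K D k :
  section_div 1 w K ->
  linearly_equivalent D (K *+ k) <-> exists r, section_div k r D.
Proof.
move=> [wt wK]; have Jc a b x := @jacobian_cont w K a b x wt wK.
split.
- move=> [f [[ft _] _] fD].
  exists (limit_coefficient (fun a x => f x * w a x ^+ k)); apply: limit_section => //.
    by move=> x a b ax bx; rewrite (wt x a b ax bx) exprMn expr1 mulrA.
  move=> a x ax; have o1 := has_order_punctured (fD a x ax).
  have o2 := punctured_orderX k (has_order_punctured (wK a x ax)).
  have := punctured_orderM o1 o2.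
  by rewrite coeffB coeffMn subrK.
- move=> [r [rt rD]].
  pose f0 : coefficients X := fun a x => r a x / w a x ^+ k.
  have f0t x : transforms_at 0 f0 x.
    move=> a b ax bx; rewrite /f0 (wt x a b ax bx) (rt x a b ax bx) exprMn expr1.
    rewrite expr0 mulr1 invfM mulrACA mulfV ?mulr1//.
    by rewrite expf_neq0// jacobian_neq0.
  have fD a x : dom a x -> punctured_order (local_expr f0 a) (coord a x) (coeff x (D - K *+ k)).
    move=> ax; have o1 := has_order_punctured (rD a x ax).
    have o2 := punctured_orderV (punctured_orderX k (has_order_punctured (wK a x ax))).
    by have := punctured_orderM o1 o2; rewrite coeffB coeffMn.
  have [ft fs] := limit_section Jc f0t fD.
  have [f fE] := weight0_function ft.
  have fs' : section_div 0 (fun=> f) (D - K *+ k).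
    split; first by move=> x a b _ _; rewrite expr0 mulr1.
    move=> a x ax; have [h [hh h0 hE]] := fs a x ax.
    exists h; split; [exact: hh|exact: h0|].
    apply: (near_imp2 hE (near_image ax)) => v vE [av _].
    by rewrite /local_expr /= (fE a _ av).
  by exists f; [exact: section_differential fs'|exact: fs'.2].
Qed.

End Sections.

(** * The mean value property *)

Section PrimitiveIntegral.
Variable R : realType.
Implicit Types (f F g : R -> R) (a b c p q : R).

Lemma exists_primitive f p q : (forall x, p <= x <= q -> {for x, continuous f}) ->
  exists F, forall x, p < x < q -> is_derive x 1 F (f x).
Proof.
move=> cf.
exists (fun x => (\int[lebesgue_measure]_(t in [set` `[p, x]]) (f t))%R).
move=> x /andP[px xq].
have fi : (@lebesgue_measure R).-integrable `[p, q] (EFin \o f).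
  apply: continuous_compact_integrable; first exact: segment_compact.
  apply: continuous_in_subspaceT => y /set_mem /=; rewrite in_itv /=.
  exact: cf.
have [|dF FE] := continuous_FTC1_closed xq fi px; first by apply: cf; rewrite !ltW.
by apply: DeriveDef => //; rewrite -derive1E.
Qed.

(* The value is 0 if f has no primitive on the segment. *)
Definition integ f a b : R := xget 0 [set s | exists2 F,
  (forall x, a <= x <= b -> is_derive x 1 F (f x)) & s = F b - F a].

Lemma integE f F a b : a < b -> (forall x, a <= x <= b -> is_derive x 1 F (f x)) ->
  integ f a b = F b - F a.
Proof.
move=> ab dF; rewrite /integ; case: xgetP => [_ _ [G dG ->]|]; last first.
  by move=> /(_ (F b - F a)) H; exfalso; apply: H; exists F.
have dGF x : a <= x <= b -> is_derive x 1 (G - F) (f x - f x).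
  by move=> xab; have := dF x xab; have := dG x xab => ? ?; exact: is_deriveB.
have [c _] := mean_value ab dGF.
rewrite subrr mul0r !fctE => /eqP; rewrite subr_eq0 => /eqP E.
by apply/eqP; rewrite -subr_eq0; apply/eqP; move: E; lra.
Qed.

(** A slightly larger segment is asked for because [integ] demands primitives with two-sided
    derivatives at both end points. *)
Definition continuous_around f a b := exists p q : R,
  [/\ p < a, b < q & forall x, p <= x <= q -> {for x, continuous f}].

Lemma continuous_aroundP f a b : continuous_around f a b ->
  exists F, forall x, a <= x <= b -> is_derive x 1 F (f x).
Proof.
move=> [p [q [pa bq cf]]]; have [F dF] := exists_primitive cf; exists F => x.
by move=> /andP[ax xb]; apply: dF; rewrite (lt_le_trans pa) ?(le_lt_trans xb).
Qed.

Lemma integ_split f a b c : a < b -> b < c -> continuous_around f a c ->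
  integ f a c = integ f a b + integ f b c.
Proof.
move=> ab bc /continuous_aroundP[F dF].
have d1 x : a <= x <= b -> is_derive x 1 F (f x).
  by move=> /andP[ax xb]; apply: dF; rewrite ax (le_trans xb) ?ltW.
have d2 x : b <= x <= c -> is_derive x 1 F (f x).
  by move=> /andP[bx xc]; apply: dF; rewrite xc (le_trans (ltW ab)).
rewrite (integE ab d1) (integE bc d2) (integE (lt_trans ab bc) dF).
ring.
Qed.

(** The subtracted term is the exact integral of the affine function. The mean value theorem,
    applied to the difference of the two primitives, bounds the remainder. *)
Lemma integ_approx f a b (u c0 c1 M : R) : a < b -> continuous_around f a b ->
  (forall x, a <= x <= b -> `|f x - (c0 + c1 * (x - u))| <= M) ->
  `|integ f a b - (c0 * (b - a) + c1 * (((b - u) ^+ 2 - (a - u) ^+ 2) / 2))|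
    <= M * (b - a).
Proof.
move=> ab /continuous_aroundP[F dF] fM; rewrite (integE ab dF).
pose P x := c0 * x + c1 * ((x - u) ^+ 2 / 2).
have dP : forall x : R, is_derive x 1 P (c0 + c1 * (x - u)).
  move=> x; pose phi (y : R) := c0 + c1 * ((y - u + (x - u)) / 2).
  have cphi : {for x, continuous phi}.
    have c2 := contB (f := idfun) (x := x) cvg_id (cont_cst u).
    have c3 := contM (contD c2 (cont_cst (x - u))) (cont_cst 2^-1).
    exact: (contD (cont_cst c0) (contM (cont_cst c1) c3)).
  have PE : \forall y \near x, P y = P x + (y - x) * phi y.
    by apply: (@filterE _ (nbhs x)) => y; rewrite /P /phi; field.
  have [d1 d2] := slope_derivable cphi PE.
  by apply: DeriveDef => //; rewrite -derive1E d2 /phi; field.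
have dFP : forall y : R, a <= y <= b -> is_derive y 1 (F - P) (f y - (c0 + c1 * (y - u))).
  move=> y yab; have := dF y yab => ?; have := dP y => ?; exact: is_deriveB.
have [c /andP[ac cb]] := mean_value ab dFP.
rewrite !fctE => E.
have -> : F b - F a - (c0 * (b - a) + c1 * (((b - u) ^+ 2 - (a - u) ^+ 2) / 2)) =
   (f c - (c0 + c1 * (c - u))) * (b - a).
  by rewrite -E /P; ring.
have ba : 0 < b - a by rewrite subr_gt0.
by rewrite normrM (gtr0_norm ba) ler_pM2r// fM// !ltW.
Qed.

(** A primitive is nondecreasing with equal values at the ends, so it is constant and its derivative
    vanishes inside. *)
Lemma integ_ge0_eq0 f a b : a < b -> continuous_around f a b ->
  (forall x, a <= x <= b -> 0 <= f x) -> integ f a b = 0 ->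
  forall x, a < x < b -> f x = 0.
Proof.
move=> ab /continuous_aroundP[F dF] f0; rewrite (integE ab dF) => F0.
have mono x y : a <= x -> x < y -> y <= b -> F x <= F y.
  move=> ax xy yb.
  have dF' z : x <= z <= y -> is_derive z 1 F (f z).
    by move=> /andP[xz zy]; apply: dF; rewrite (le_trans ax) ?(le_trans zy).
  have [c /andP[xc cy] E] := mean_value xy dF'.
  rewrite -subr_ge0 E mulr_ge0 ?subr_ge0 ?(ltW xy)// f0//.
  by rewrite (le_trans ax) ?ltW// (lt_le_trans cy).
have Fc x : a < x < b -> F x = F a.
  move=> /andP[ax xb]; move: F0 => /eqP; rewrite subr_eq0 => /eqP FbE.
  apply/eqP; rewrite eq_le; apply/andP; split.
    by rewrite -FbE; apply: mono => //; exact: ltW.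
  by apply: mono => //; exact: ltW.
move=> x /andP[ax xb].
have dx := dF x _; rewrite !ltW// in dx; have {}dx := dx isT.
rewrite -(@derive_val _ _ _ _ _ _ _ dx) -derive1E.
have [//|_ ->] := @near_eq_derive R (fun=> F a) F x _ (derivable_cst _ _ _).
  have : \forall y \near x, y \in `]a, b[.
    by apply: near_in_itvoo; rewrite in_itv /= ax xb.
  by move=> /near_imp; apply => y; rewrite in_itv /= => /Fc.
by rewrite derive1_cst.
Qed.

End PrimitiveIntegral.

(** * Nested squares *)

Section Bisection.
Variable R : realType.

Lemma geometric_small (t e : R) : 0 < t -> 0 < e -> exists n, t / 2 ^+ n < e.
Proof.
move=> t0 e0; exists (Num.bound (t / e)).
rewrite ltr_pdivrMr ?exprn_gt0// mulrC -ltr_pdivrMr//.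
apply: lt_trans (archi_boundP _) _; first by rewrite divr_ge0 ?ltW.
by rewrite -natrX ltr_nat ltn_expl.
Qed.

Lemma nested_intervals (X T : nat -> R) (t : R) : 0 < t ->
  (forall n, T n = t / 2 ^+ n) ->
  (forall n, X n <= X n.+1 /\ X n.+1 + T n.+1 <= X n + T n) ->
  exists x0, forall n, X n <= x0 <= X n + T n.
Proof.
move=> t0 TE XT.
have T0 n : 0 <= T n by rewrite TE divr_ge0 ?exprn_ge0 ?ltW.
have Xm : {homo X : m n / (m <= n)%N >-> m <= n}.
  by apply: homo_leq => [x|y x z|n]; [exact: lexx|exact: le_trans|case: (XT n)].
have Ym m k : X (m + k)%N + T (m + k)%N <= X m + T m.
  elim: k => [|k IH]; first by rewrite addn0.
  by rewrite addnS; case: (XT (m + k)%N) => _ /le_trans; apply.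
have ub n : ubound (range X) (X n + T n).
  move=> _ [m _ <-]; case: (leqP m n) => mn.
    by rewrite (le_trans (Xm _ _ mn))// lerDl.
  rewrite -(subnKC (ltnW mn)); apply: le_trans (Ym n (m - n)%N).
  by rewrite lerDl.
exists (sup (range X)) => n; apply/andP; split.
  by apply: ub_le_sup; [exists (X 0%N + T 0%N); exact: ub|exists n].
by apply: ge_sup; [exists (X 0%N), 0%N|exact: ub].
Qed.

(** The booleans select a quadrant, and the limit point lies in every selected square. It is used
    twice: with [Q] saying that a circulation is too large, and with [Q] saying that no flat section
    exists. *)
Lemma square_bisection (Q : R -> R -> R -> Prop) (x y t : R) : 0 < t -> Q x y t ->
  (forall x y t, 0 < t -> Q x y t ->
     exists i j : bool, Q (x + i%:R * (t / 2)) (y + j%:R * (t / 2)) (t / 2)) ->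
  exists x0 y0, forall e, 0 < e -> exists x' y' t',
   [/\ 0 < t' < e, x' <= x0 <= x' + t', y' <= y0 <= y' + t' & Q x' y' t'].
Proof.
move=> t0 Q0 step.
pose P (s : R * R * R) := 0 < s.2 /\ Q s.1.1 s.1.2 s.2.
pose next (s s' : {s | P s}) := exists i j : bool,
  sval s' = ((sval s).1.1 + i%:R * ((sval s).2 / 2),
             (sval s).1.2 + j%:R * ((sval s).2 / 2), (sval s).2 / 2).
have [|f [f0 fS]] := @dependent_choice {s | P s} next _ (exist P (x, y, t) (conj t0 Q0)).
  move=> s; apply/cid; case: s => [[[x1 y1] t1] [/= t10 Q1]].
  have [i [j Qij]] := step _ _ _ t10 Q1.
  have t12 : 0 < t1 / 2 by rewrite divr_gt0.
  pose s' := (x1 + i%:R * (t1 / 2), y1 + j%:R * (t1 / 2), t1 / 2).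
  by exists (exist P s' (conj t12 Qij)), i, j.
pose X n := (sval (f n)).1.1; pose Y n := (sval (f n)).1.2; pose T n := (sval (f n)).2.
have TE n : T n = t / 2 ^+ n.
  elim: n => [|n IH]; first by rewrite /T f0 /= divr1.
  by rewrite /T; case: (fS n) => i [j ->] /=; rewrite -/(T n) IH exprSr invfM mulrA.
have T0 n : 0 < T n by rewrite TE divr_gt0 ?exprn_gt0.
have XS n : X n <= X n.+1 /\ X n.+1 + T n.+1 <= X n + T n.
  rewrite /X /T; case: (fS n) => i [j ->] /=; rewrite -/(T n); have := T0 n.
  by case: i => /=; split; lra.
have YS n : Y n <= Y n.+1 /\ Y n.+1 + T n.+1 <= Y n + T n.
  rewrite /Y /T; case: (fS n) => i [j ->] /=; rewrite -/(T n); have := T0 n.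
  by case: j => /=; split; lra.
have [x0 Hx] := nested_intervals t0 TE XS.
have [y0 Hy] := nested_intervals t0 TE YS.
exists x0, y0 => e e0; have [n ne] := geometric_small t0 e0.
exists (X n), (Y n), (T n); split => //; first by rewrite T0 TE.
by case: (svalP (f n)).
Qed.

End Bisection.

(** * Goursat's theorem for squares, in real form *)

Section RealGoursat.
Variable R : realType.
Variables (A B : R -> R -> R) (L : R).

(* The partial slopes of A and B; the condition on their values is one of the
   two Cauchy-Riemann equations, A_u = B_v. *)
Hypothesis AB : forall u0 v0 : R, u0 < L -> exists p q r s : R * R -> R,
  [/\ [/\ {for (u0, v0), continuous p}, {for (u0, v0), continuous q},
      {for (u0, v0), continuous r} & {for (u0, v0), continuous s}],
    p (u0, v0) = s (u0, v0),
    forall u v, A u v = A u0 v0 + (u - u0) * p (u, v) + (v - v0) * q (u, v) &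
    forall u v, B u v = B u0 v0 + (u - u0) * r (u, v) + (v - v0) * s (u, v)].

Let slice_u (p : R * R -> R) u0 v0 : {for (u0, v0), continuous p} ->
  {for u0, continuous (fun u => p (u, v0))}.
Proof.
move=> cp; have c1 : {for u0, continuous (fun u : R => (u, v0))}.
  exact: (cont_pair (f := idfun) (g := cst v0) cvg_id (cvg_cst v0)).
exact: (continuous_comp c1 cp).
Qed.

Let slice_v (p : R * R -> R) u0 v0 : {for (u0, v0), continuous p} ->
  {for v0, continuous (fun v => p (u0, v))}.
Proof.
move=> cp; have c1 : {for v0, continuous (fun v : R => (u0, v))}.
  exact: (cont_pair (f := cst u0) (g := idfun) (cvg_cst u0) cvg_id).
exact: (continuous_comp c1 cp).
Qed.

Lemma A_cont u0 v0 : u0 < L -> {for v0, continuous (A u0)}.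
Proof.
move=> uL; have [p [q [r [s [[cp cq cr cs] _ AE BE]]]]] := AB v0 uL.
have [||d _] := @slope_derivable R (A u0) (fun v => q (u0, v)) v0.
- exact: slice_v.
- by apply: (@filterE _ (nbhs v0)) => v; rewrite AE subrr mul0r addr0.
exact: derivable_cont.
Qed.

Lemma B_cont u0 v0 : u0 < L -> {for u0, continuous (B ^~ v0)}.
Proof.
move=> uL; have [p [q [r [s [[cp cq cr cs] _ AE BE]]]]] := AB v0 uL.
have [||d _] := @slope_derivable R (B ^~ v0) (fun u => r (u, v0)) u0.
- exact: slice_u.
- by apply: (@filterE _ (nbhs u0)) => u; rewrite BE subrr mul0r addr0.
exact: derivable_cont.
Qed.

Lemma A_around u a b : u < L -> continuous_around (A u) a b.
Proof.
by move=> uL; exists (a - 1), (b + 1); split => [||v _]; [lra|lra|exact: A_cont].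
Qed.

Lemma B_around v a b : b < L -> continuous_around (B ^~ v) a b.
Proof.
move=> bL; exists (a - 1), ((b + L) / 2); split => [||u /andP[_ ub]]; [lra|lra|].
by apply: B_cont; lra.
Qed.

(** The counterclockwise integral of B du + A dv along the boundary of a square of side [t]. For A +
    iB holomorphic in u + iv it is the imaginary part of the contour integral, and A_u = B_v says
    that the form is closed. *)
Definition circulation x y t :=
  integ (B ^~ y) x (x + t) - integ (B ^~ (y + t)) x (x + t) +
  integ (A (x + t)) y (y + t) - integ (A x) y (y + t).

Lemma circulation_split (x y t : R) : 0 < t -> x + t < L ->
  circulation x y t = circulation x y (t / 2) + circulation (x + t / 2) y (t / 2)
   + circulation x (y + t / 2) (t / 2) + circulation (x + t / 2) (y + t / 2) (t / 2).
Proof.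
move=> t0 xL; rewrite /circulation.
have tt z : z + t = z + t / 2 + t / 2 by rewrite -addrA -splitr.
have xx z : z < z + t / 2 by rewrite ltrDl divr_gt0.
have xt : x + t / 2 < L by have := xx (x + t / 2); rewrite -tt => /lt_trans; apply.
have Bs v : integ (B ^~ v) x (x + t) = integ (B ^~ v) x (x + t / 2) +
    integ (B ^~ v) (x + t / 2) (x + t / 2 + t / 2).
  by rewrite tt; apply: integ_split => //; apply: B_around; rewrite -tt.
have As u : u < L -> integ (A u) y (y + t) = integ (A u) y (y + t / 2) +
    integ (A u) (y + t / 2) (y + t / 2 + t / 2).
  by move=> uL; rewrite tt; apply: integ_split => //; exact: A_around.
have xL' : x < L by exact: lt_trans xt.
rewrite !Bs As// As// !(tt x) !(tt y); ring.
Qed.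

(** Near the point, [A] and [B] are affine up to a small multiple of [t]. In the affine parts
    opposite sides cancel except for the terms with [p0] and [s0], which cancel each other because
    these are equal. *)
Lemma circulation_small (x0 y0 e : R) : x0 < L -> 0 < e -> exists2 d, 0 < d &
  forall x y t, 0 < t < d -> x <= x0 <= x + t -> y <= y0 <= y + t -> x + t < L ->
    `|circulation x y t| <= e * t ^+ 2.
Proof.
move=> xL e0; have [p [q [r [s [[cp cq cr cs] ps AE BE]]]]] := AB y0 xL.
(* Two slopes, each off by at most e/8, give an error of e/4 times [t] for each function; four sides
   of length [t] add up to [e * t ^+ 2]. *)
have e8 : 0 < e / 8 by rewrite divr_gt0.
have near_ball (h : R * R -> R) : {for (x0, y0), continuous h} -> exists2 d, 0 < d &
    forall u v, `|u - x0| < d -> `|v - y0| < d -> `|h (u, v) - h (x0, y0)| <= e / 8.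
  move=> ch; have /cont_dist/(_ _ e8) := ch.
  move=> /nbhs_ballP[d /= d0 Hd]; exists d => // u v ud vd.
  rewrite distrC ltW//; apply: (Hd (u, v)); split => /=.
    by rewrite -ball_normE /= distrC.
  by rewrite -ball_normE /= distrC.
have [d1 d10 H1] := near_ball _ cp; have [d2 d20 H2] := near_ball _ cq.
have [d3 d30 H3] := near_ball _ cr; have [d4 d40 H4] := near_ball _ cs.
exists (Num.min (Num.min d1 d2) (Num.min d3 d4)).
  by rewrite !lt_min d10 d20 d30 d40.
move=> x y t /andP[t0]; rewrite !lt_min => /andP[/andP[t1 t2] /andP[t3 t4]].
move=> /andP[xx0 x0t] /andP[yy0 y0t] xtL.
have xL' : x < L by lra.
have in_ball z z0 d w : z <= z0 -> z0 <= z + t -> t < d -> z <= w <= z + t -> `|w - z0| < d.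
  by move=> h1 h2 h3 /andP[h4 h5]; rewrite ltr_norml; lra.
have err z z0 w : z <= z0 -> z0 <= z + t -> z <= w <= z + t -> `|w - z0| <= t.
  by move=> h1 h2 /andP[h4 h5]; rewrite ler_norml; lra.
set p0 := p (x0, y0) in ps H1; set q0 := q (x0, y0) in H2.
set r0 := r (x0, y0) in H3; set s0 := s (x0, y0) in ps H4.
have EA u v : x <= u <= x + t -> y <= v <= y + t ->
    `|A u v - (A x0 y0 + (u - x0) * p0 + (v - y0) * q0)| <= e / 4 * t.
  move=> hu hv; rewrite AE.
  have -> : A x0 y0 + (u - x0) * p (u, v) + (v - y0) * q (u, v) -
    (A x0 y0 + (u - x0) * p0 + (v - y0) * q0) =
    (u - x0) * (p (u, v) - p0) + (v - y0) * (q (u, v) - q0) by ring.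
  apply: le_trans (ler_normD _ _) _; rewrite !normrM.
  have -> : e / 4 * t = t * (e / 8) + t * (e / 8) by field.
  apply: lerD; apply: ler_pM => //.
  - exact: err hu.
  - by apply: H1; [exact: in_ball hu|exact: in_ball hv].
  - exact: err hv.
  - by apply: H2; [exact: in_ball hu|exact: in_ball hv].
have EB u v : x <= u <= x + t -> y <= v <= y + t ->
    `|B u v - (B x0 y0 + (u - x0) * r0 + (v - y0) * s0)| <= e / 4 * t.
  move=> hu hv; rewrite BE.
  have -> : B x0 y0 + (u - x0) * r (u, v) + (v - y0) * s (u, v) -
    (B x0 y0 + (u - x0) * r0 + (v - y0) * s0) =
    (u - x0) * (r (u, v) - r0) + (v - y0) * (s (u, v) - s0) by ring.
  apply: le_trans (ler_normD _ _) _; rewrite !normrM.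
  have -> : e / 4 * t = t * (e / 8) + t * (e / 8) by field.
  apply: lerD; apply: ler_pM => //.
  - exact: err hu.
  - by apply: H3; [exact: in_ball hu|exact: in_ball hv].
  - exact: err hv.
  - by apply: H4; [exact: in_ball hu|exact: in_ball hv].
have tx z : z < z + t by rewrite ltrDl.
have endl z : z <= z <= z + t by rewrite lexx ltW.
have endr z : z <= z + t <= z + t by rewrite lexx ltW.
have I1 v : y <= v <= y + t -> `|integ (B ^~ v) x (x + t) -
   ((B x0 y0 + (v - y0) * s0) * (x + t - x) + r0 * (((x + t - x0) ^+ 2 - (x - x0) ^+ 2) / 2))|
   <= e / 4 * t * (x + t - x).
  move=> hv; apply: integ_approx => //; first exact: B_around.
  move=> u hu; have -> : B x0 y0 + (v - y0) * s0 + r0 * (u - x0) =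
     B x0 y0 + (u - x0) * r0 + (v - y0) * s0 by ring.
  exact: EB.
have I2 u : x <= u <= x + t -> `|integ (A u) y (y + t) -
   ((A x0 y0 + (u - x0) * p0) * (y + t - y) + q0 * (((y + t - y0) ^+ 2 - (y - y0) ^+ 2) / 2))|
   <= e / 4 * t * (y + t - y).
  move=> hu; apply: integ_approx => //.
    by apply: A_around; case/andP: hu => _ /le_lt_trans; apply.
  move=> v hv; have -> : A x0 y0 + (u - x0) * p0 + q0 * (v - y0) =
     A x0 y0 + (u - x0) * p0 + (v - y0) * q0 by ring.
  exact: EA.
have := I1 y (endl y); have := I1 (y + t) (endr y).
have := I2 x (endl x); have := I2 (x + t) (endr x).
rewrite /circulation ps.
move: (integ _ _ _) (integ _ _ _) (integ _ _ _) (integ _ _ _) => i1 i2 i3 i4.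
have -> z : z + t - z = t by rewrite addrC addKr.
rewrite !ler_norml => /andP[a1 b1] /andP[a2 b2] /andP[a3 b3] /andP[a4 b4].
have ee : e / 4 * t * t = e * t ^+ 2 / 4 by field.
rewrite ee in a1 b1 a2 b2 a3 b3 a4 b4.
apply/andP; split; lra.
Qed.

Lemma real_goursat (x y t : R) : 0 < t -> x + t < L -> circulation x y t = 0.
Proof.
move=> t0 xtL; apply/eqP; apply: contraT => c0.
have c1 : 0 < `|circulation x y t| by rewrite normr_gt0.
(* The factor 1/2 makes the inequality in [Q] strict for the first square. It passes to some
   quadrant because the four circulations add up while the area is divided by four. *)
pose e := `|circulation x y t| / 2 / t ^+ 2.
have t2 : 0 < t ^+ 2 by rewrite exprn_gt0.
have e0 : 0 < e by rewrite !divr_gt0.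
(* The bounds on [x'] keep all the squares inside the half-plane to the left of [L], where the
   slopes exist. *)
pose Q (x' y' t' : R) := [/\ x <= x', x' + t' <= x + t & e * t' ^+ 2 < `|circulation x' y' t'|].
have Q0 : Q x y t.
  by split; rewrite // /e divfK ?gt_eqF// ltr_pdivrMr// ltr_pMr// ltr1n.
have [|x0 [y0 H]] := square_bisection t0 Q0.
  move=> x1 y1 t1 t10 [h1 h2 h3].
  have x1L : x1 + t1 < L by lra.
  have half : 0 < t1 / 2 by rewrite divr_gt0.
  apply: contrapT => nQ.
  have small (i j : bool) :
      `|circulation (x1 + i%:R * (t1 / 2)) (y1 + j%:R * (t1 / 2)) (t1 / 2)|
      <= e * (t1 / 2) ^+ 2.
    rewrite leNgt; apply/negP => big; apply: nQ; exists i, j; split => //.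
      by rewrite (le_trans h1)// lerDl; case: (i); rewrite ?mul1r ?mul0r// ltW.
    by apply: le_trans h2; case: i {big} => /=; lra.
  have := small false false; have := small true false.
  have := small false true; have := small true true.
  rewrite !mul0r !mul1r !addr0 => s1 s2 s3 s4.
  move: h3; rewrite circulation_split//; apply/negP; rewrite -leNgt.
  have -> : e * t1 ^+ 2 = e * (t1 / 2) ^+ 2 + e * (t1 / 2) ^+ 2 +
      e * (t1 / 2) ^+ 2 + e * (t1 / 2) ^+ 2.
    by field.
  do 3 (apply: le_trans (ler_normD _ _) _; apply: lerD => //).
have x0L : x0 < L.
  have [x' [y' [t' [_ /andP[_ h] _ [_ h2 _]]]]] := H 1 ltr01.
  by rewrite (le_lt_trans h)// (le_lt_trans h2).
have [d d0 Hd] := circulation_small y0 x0L e0.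
have [x' [y' [t' [ht hx hy [h1 h2 h3]]]]] := H d d0.
have := Hd x' y' t' ht hx hy (le_lt_trans h2 xtL).
by rewrite leNgt h3.
Qed.

End RealGoursat.

(** * The exponential as polar coordinates *)

Section PolarCoordinates.
Variable R : realType.
Local Notation C := (complex R)^o.

Lemma cont_complex (T : topologicalType) (x : T) (a b : T -> R) :
  {for x, continuous a} -> {for x, continuous b} ->
  {for x, continuous (fun y => (a y +i* b y)%C : C)}.
Proof.
move=> ca cb.
have c1 := continuous_comp ca (@continuous_real_complex R (a x)).
have c2 := continuous_comp cb (@continuous_real_complex R (b x)).
have c3 := contD c1 (contM (cont_cst ('i%C : C)) c2).
apply: (near_eq_cont _ c3); apply: (@filterE _ (nbhs x)) => y /=.
by rewrite [RHS]complexE.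
Qed.

Definition polar (u v : R) : C := (expR u)%:C%C * (cos v +i* sin v)%C.

Lemma polarE u v : polar u v = (expR u * cos v +i* (expR u * sin v))%C.
Proof. by rewrite /polar; apply/eqP; rewrite eq_complex /= !mul0r subr0 addr0 !eqxx. Qed.

Lemma norm_polar u v : `|polar u v| = (expR u)%:C%C.
Proof.
by rewrite normrM normc_real normc_def /= cos2Dsin2 sqrtr1 mulr1 ger0_norm ?expR_ge0.
Qed.

Lemma polar_period u v : polar u (v + pi *+ 2) = polar u v.
Proof. by rewrite /polar cosD2pi sinD2pi. Qed.

(** The increment of a product is split into one increment in [u], taken at the new [v], and one in
    [v], taken at the old [u]. The relation of [Q] to [P] is the Cauchy-Riemann equation of exp. *)
Lemma polar_slopes (u0 v0 : R) : exists P Q : R * R -> C,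
  [/\ {for (u0, v0), continuous P}, {for (u0, v0), continuous Q},
    Q (u0, v0) = 'i%C * P (u0, v0) &
    forall u v, polar u v =
      polar u0 v0 + (u - u0)%:C%C * P (u, v) + (v - v0)%:C%C * Q (u, v)].
Proof.
have [e1 [ce eE e0]] := derivable_slope (@derivable_expR R u0).
have [c1 [cc cE c0]] := derivable_slope (@derivable_cos R v0).
have [s1 [cs sE s0]] := derivable_slope (@derivable_sin R v0).
rewrite derive1E derive_val in e0; rewrite derive1E derive_val in c0.
rewrite derive1E derive_val in s0.
have cf : {for (u0, v0), continuous (fst : R * R -> R)} by exact: cvg_fst.
have cn : {for (u0, v0), continuous (snd : R * R -> R)} by exact: cvg_snd.
exists (fun x => (e1 x.1)%:C%C * (cos x.2 +i* sin x.2)%C),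
  (fun x => (expR u0)%:C%C * (c1 x.2 +i* s1 x.2)%C); split.
- have h1 := continuous_comp (continuous_comp cf ce) (@continuous_real_complex R _).
  have h2 := cont_complex (continuous_comp cn (@continuous_cos R _))
    (continuous_comp cn (@continuous_sin R _)).
  exact: (contM h1 h2).
- have h2 := cont_complex (continuous_comp cn cc) (continuous_comp cn cs).
  exact: (contM (cont_cst _) h2).
- rewrite /= e0 c0 s0; apply/eqP; rewrite eq_complex /=; apply/andP; split; apply/eqP; ring.
- move=> u v /=; rewrite !polarE.
  apply/eqP; rewrite eq_complex /=; apply/andP; split; apply/eqP.
    by rewrite (eE u) (cE v); ring.
  by rewrite (eE u) (sE v); ring.
Qed.

Lemma polar_surj (w : C) : w != 0 -> exists u v, w = polar u v.
Proof.
move=> w0; have nw : 0 < `|w| by rewrite normr_gt0.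
have [r r0 rE] := gt0_complex nw; exists (ln r).
have eE : expR (ln r) = r by rewrite lnK.
suff [v [cv sv]] : exists v, cos v = Re w / r /\ sin v = Im w / r.
  exists v; rewrite polarE eE cv sv ![r * _]mulrC !divfK ?gt_eqF//.
  by case: (w).
have wr : Re w ^+ 2 + Im w ^+ 2 = r ^+ 2.
  by apply: (@complexI R); rewrite add_Re2_Im2 rE rmorphXn.
have nn : (Re w / r) ^+ 2 + (Im w / r) ^+ 2 = 1.
  by rewrite !expr_div_n -mulrDl wr divff// expf_neq0// gt_eqF.
set x := Re w / r in nn *; set y := Im w / r in nn *.
have y2 : 1 - x ^+ 2 = y ^+ 2 by rewrite -nn addrC addKr.
have x1 : -1 <= x <= 1.
  rewrite -ler_norml -(@ler_pXn2r _ 2)// ?nnegrE//.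
  by rewrite real_normK ?num_real// expr1n -nn lerDl sqr_ge0.
have [y0|y0] := leP 0 y.
  by exists (acos x); rewrite acosK ?in_itv// sin_acos// y2 sqrtr_sqr ger0_norm.
exists (- acos x); rewrite cosN sinN acosK ?in_itv// sin_acos// y2 sqrtr_sqr.
by rewrite ltr0_norm// opprK.
Qed.

End PolarCoordinates.

Section MeanValueProperty.
Variable R : realType.
Local Notation C := (complex R)^o.
Variables (f : C -> C) (z0 : C) (r : R).
Hypothesis r0 : 0 < r.
Hypothesis df : forall w : C, `|w - z0| < r%:C%C -> derivable f w 1.

Let A u v := Re (f (z0 + polar u v)).
Let B u v := Im (f (z0 + polar u v)).

Lemma in_disc (u v : R) : u < ln r -> `|z0 + polar u v - z0| < r%:C%C.
Proof.
by move=> ur; rewrite addrAC subrr add0r norm_polar ltcR -(lnK r0) ltr_expR.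
Qed.

(** The slopes of the composite are [P] and [Q] times the slope of [f]. As [Q] is i times [P] at the
    base point, the imaginary part of the second is the real part of the first. *)
Lemma polar_cauchy_riemann (u0 v0 : R) : u0 < ln r -> exists p q r s : R * R -> R,
  [/\ [/\ {for (u0, v0), continuous p}, {for (u0, v0), continuous q},
      {for (u0, v0), continuous r} & {for (u0, v0), continuous s}],
    p (u0, v0) = s (u0, v0),
    forall u v, A u v = A u0 v0 + (u - u0) * p (u, v) + (v - v0) * q (u, v) &
    forall u v, B u v = B u0 v0 + (u - u0) * r (u, v) + (v - v0) * s (u, v)].
Proof.
move=> ur; have [phi [cphi fE _]] := derivable_slope (df (in_disc v0 ur)).
have [P [Q [cP cQ QP PQ]]] := polar_slopes u0 v0.
pose W (x : R * R) : C := z0 + polar x.1 x.2.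
have cW : {for (u0, v0), continuous W}.
  have cf : {for (u0, v0), continuous (fst : R * R -> R)} by exact: cvg_fst.
  have cn : {for (u0, v0), continuous (snd : R * R -> R)} by exact: cvg_snd.
  have h1 := continuous_comp (contB cf (cont_cst u0)) (@continuous_real_complex R _).
  have h2 := continuous_comp (contB cn (cont_cst v0)) (@continuous_real_complex R _).
  have h3 := contD (contD (cont_cst (polar u0 v0)) (contM h1 cP)) (contM h2 cQ).
  apply: (near_eq_cont _ (contD (cont_cst z0) h3)).
  by apply: (@filterE _ (nbhs (u0, v0))) => -[u v]; rewrite /W /= -PQ.
have cphiW := continuous_comp cW cphi.
pose P' x := P x * phi (W x); pose Q' x := Q x * phi (W x).
have cP' : {for (u0, v0), continuous P'} by exact: (contM cP cphiW).
have cQ' : {for (u0, v0), continuous Q'} by exact: (contM cQ cphiW).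
have E u v : f (z0 + polar u v) = f (z0 + polar u0 v0) +
    (u - u0)%:C%C * P' (u, v) + (v - v0)%:C%C * Q' (u, v).
  have fE' : forall w : C, f w = f (z0 + polar u0 v0) +
    (w - (z0 + polar u0 v0)) * phi w := fE.
  rewrite (fE' (z0 + polar u v)) -[RHS]addrA; congr (_ + _).
  have h : z0 + polar u v - (z0 + polar u0 v0) =
      (u - u0)%:C%C * P (u, v) + (v - v0)%:C%C * Q (u, v).
    by rewrite opprD addrACA subrr add0r PQ addrC !addrA addNr add0r.
  by rewrite h mulrDl -!mulrA.
exists (Re \o P'), (Re \o Q'), (Im \o P'), (Im \o Q'); split.
- by split; [exact: (continuous_comp cP' (@continuous_Re R _))
  |exact: (continuous_comp cQ' (@continuous_Re R _))
  |exact: (continuous_comp cP' (@continuous_Im R _))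
  |exact: (continuous_comp cQ' (@continuous_Im R _))].
- by rewrite /= /Q' QP -mulrA ImM /= mul0r mul1r add0r.
- by move=> u v; rewrite /A E !ReD !ReZ.
- by move=> u v; rewrite /B E !ImD !ImZ.
Qed.

(** The horizontal sides cancel by periodicity; the vertical sides are two circles around [z0]. A
    square forces their logarithmic radii to differ by exactly 2 pi, but iterating this still
    shrinks the circle to [z0]. *)
Lemma integ_radius_period u y : u < ln r ->
  integ (A u) y (y + pi *+ 2) = integ (A (u - pi *+ 2)) y (y + pi *+ 2).
Proof.
move=> ur; have p0 : 0 < pi *+ 2 :> R by rewrite pmulrn_lgt0// pi_gt0.
have := @real_goursat R A B (ln r) polar_cauchy_riemann (u - pi *+ 2) y (pi *+ 2) p0.
rewrite subrK => /(_ ur); rewrite /circulation subrK.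
have -> : B ^~ (y + pi *+ 2) = B ^~ y.
  by apply/funext => x; rewrite /B polar_period.
by rewrite subrr add0r => /eqP; rewrite subr_eq0 => /eqP.
Qed.

Lemma mean_value_property u y : u < ln r ->
  integ (A u) y (y + pi *+ 2) = Re (f z0) * (pi *+ 2).
Proof.
move=> ur; have p0 : 0 < pi *+ 2 :> R by rewrite pmulrn_lgt0// pi_gt0.
have iter n : u - pi *+ 2 *+ n < ln r /\
    integ (A u) y (y + pi *+ 2) = integ (A (u - pi *+ 2 *+ n)) y (y + pi *+ 2).
  elim: n => [|n [IH1 IH2]]; first by rewrite mulr0n subr0.
  have -> : u - pi *+ 2 *+ n.+1 = u - pi *+ 2 *+ n - pi *+ 2.
    by rewrite (mulrSr (pi *+ 2)) opprD addrA.
  by rewrite -integ_radius_period// -IH2; split => //; rewrite ltrBlDr ltr_wpDr// ltW.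
apply/eqP; rewrite -subr_eq0; apply/negP => /negP d0.
set d := _ - _ in d0; have dd : 0 < `|d| by rewrite normr_gt0.
(* An error [e] on the whole circle changes the integral by at most half of [|d|]. *)
pose e := `|d| / 2 / (pi *+ 2).
have e0 : 0 < e by rewrite !divr_gt0.
have dz0 : derivable f z0 1 by apply: df; rewrite subrr normr0 ltcR.
have cf := continuous_comp (derivable_cont dz0) (@continuous_Re R (f z0)).
have /cont_dist/(_ _ e0)/nbhs_ballP[s /= /gt0_complex[s' s0 ->] Hs] := cf.
(* Enough contractions by exp(-2 pi) to bring the circle within distance [s'] of [z0], where the
   real part of [f] is within [e] of its value at [z0]. *)
pose n := Num.bound (`|u - ln s'| / (pi *+ 2)).
have small : u - pi *+ 2 *+ n < ln s'.
  have : `|u - ln s'| / (pi *+ 2) < n%:R by apply: archi_boundP; rewrite divr_ge0// ltW.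
  rewrite ltr_pdivrMr// => h; have := le_lt_trans (ler_norm _) h.
  by rewrite mulr_natl => ?; lra.
have [n1 n2] := iter n.
have yp : y < y + pi *+ 2 by rewrite ltrDl.
have ca := A_around polar_cauchy_riemann y (y + pi *+ 2) n1.
have := @integ_approx R _ y (y + pi *+ 2) 0 (Re (f z0)) 0 e yp ca.
rewrite -n2 mul0r addr0 [y + _ - y]addrC addKr => H.
have {}H : `|d| <= e * (pi *+ 2).
  apply: H => v _; rewrite mul0r addr0 distrC ltW//; apply: Hs.
  rewrite -ball_normE /= opprD addrA subrr sub0r normrN norm_polar ltcR.
  by rewrite -(lnK s0) ltr_expR.
move: H; rewrite /e divfK ?gt_eqF// leNgt => /negP; apply.
by rewrite ltr_pdivrMr// ltr_pMr// ltr1n.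
Qed.

End MeanValueProperty.

(** * Holomorphic functions on a compact surface *)

Section MaximumPrinciple.
Variable R : realType.
Local Notation C := (complex R)^o.

Lemma sqr_norm_le (z w : C) : `|z| <= `|w| ->
  Re z ^+ 2 + Im z ^+ 2 <= Re w ^+ 2 + Im w ^+ 2.
Proof.
move=> zw; rewrite -lecR !add_Re2_Im2.
by rewrite ler_pXn2r// nnegrE normr_ge0.
Qed.

(** Twice the real part of c^*(c - f) equals |c|^2 - |f|^2 + |c - f|^2. It is nonnegative as |f| is
    at most |c|, and where it vanishes, f = c. *)
Lemma local_max_constant (f : C -> C) (z0 : C) : holomorphic_at f z0 ->
  (\forall w \near z0, `|f w| <= `|f z0|) -> \forall w \near z0, f w = f z0.
Proof.
move=> hf mf; set c := f z0.
have := near_imp2 hf mf (fun _ => @conj _ _).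
move=> /nbhs_ballP[e /= /gt0_complex[r r0 ->] He].
have {}He w : `|w - z0| < r%:C%C -> derivable f w 1 /\ `|f w| <= `|c|.
  by move=> wr; apply: He; rewrite -ball_normE /= distrC.
apply/nbhs_ballP; exists r%:C%C => /=; first by rewrite ltcR.
move=> w; rewrite -ball_normE /= distrC => wr.
have [->//|wz] := eqVneq w z0.
have d0 : w - z0 != 0 by rewrite subr_eq0.
have [u [v uvE]] := polar_surj d0.
have ur : u < ln r.
  by rewrite -ltr_expR lnK// -ltcR -(norm_polar u v) -uvE.
(* Re F is nonnegative near z0 and vanishes at z0, hence on circles around it. *)
pose F (w : C) : C := c^*%C * (c - f w).
have dF (w' : C) : `|w' - z0| < r%:C%C -> derivable F w' 1.
  move=> /He[/derivable_slope[phi [cphi fE _]] _].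
  have cF : {for w', continuous (fun w => c^*%C * (- phi w) : C)}.
    exact: (contM (cont_cst (c^*%C : C)) (contN cphi)).
  have FE : \forall v \near w', F v = F w' + (v - w') * (c^*%C * - phi v).
    by apply: (@filterE _ (nbhs w')) => v'; rewrite /F fE; ring.
  exact: (slope_derivable cF FE).1.
have ReF (w' : C) : Re (F w') = Re c * (Re c - Re (f w')) + Im c * (Im c - Im (f w')).
  by rewrite /F ReM ReB ImB; case: (c) => a b /=; ring.
have F0 (w' : C) : `|w' - z0| < r%:C%C -> 0 <= Re (F w').
  move=> /He[_ /sqr_norm_le H]; rewrite ReF.
  move: H; move: (Re c) (Im c) (Re (f w')) (Im (f w')) => a b x y H.
  have := sqr_ge0 (a - x); have := sqr_ge0 (b - y); rewrite !sqrrB; lra.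
(* The angle [v] of the given point becomes interior to the interval of integration; [integ_ge0_eq0]
   says nothing at the ends. *)
pose y := v - pi.
have p0 : 0 < pi :> R by exact: pi_gt0.
have yp : y < y + pi *+ 2 by rewrite ltrDl pmulrn_lgt0.
have MVP := mean_value_property r0 dF y ur.
have ca := A_around (polar_cauchy_riemann r0 dF) y (y + pi *+ 2) ur.
have Fz0 : Re (F z0) = 0 by rewrite ReF -/c !subrr !mulr0 addr0.
rewrite Fz0 mul0r in MVP.
have H0 x : y <= x <= y + pi *+ 2 -> 0 <= Re (F (z0 + polar u x)).
  by move=> _; apply: F0; exact: in_disc.
have vy : y < v < y + pi *+ 2 by rewrite /y mulr2n; lra.
have := integ_ge0_eq0 yp ca H0 MVP vy.
rewrite -uvE [z0 + _]addrC subrK ReF => E.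
have [_ /sqr_norm_le H] := He w wr.
suff [E1 E2] : Re (f w) = Re c /\ Im (f w) = Im c.
  by apply/eqP; rewrite eq_complex E1 E2 !eqxx.
move: E H; move: (Re c) (Im c) (Re (f w)) (Im (f w)) => a b p q E H.
have S : (p - a) ^+ 2 + (q - b) ^+ 2 <= 0.
  by rewrite !sqrrB; lra.
have S1 : (p - a) ^+ 2 = 0 by have := sqr_ge0 (p - a); have := sqr_ge0 (q - b); lra.
have S2 : (q - b) ^+ 2 = 0 by have := sqr_ge0 (p - a); have := sqr_ge0 (q - b); lra.
move/eqP: S1; move/eqP: S2; rewrite !sqrf_eq0 !subr_eq0 => /eqP -> /eqP ->.
by [].
Qed.

End MaximumPrinciple.

Section CompactSurface.
Variables (R : realType) (X : riemannSurface R).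
Local Notation C := (complex R)^o.
Local Notation dom a := (chart_dom (rs_chart a)).
Local Notation coord a := (chart_map (rs_chart a)).
Local Notation inv a := (chart_inv (rs_chart a)).
Implicit Types (a b c : rs_index X) (x y : X).
Hypothesis Xc : compact [set: X].

Lemma holomorphic_constant (f : X -> C) :
  (forall a x, dom a x -> holomorphic_at (f \o inv a : C -> C) (coord a x)) ->
  forall x y, f x = f y.
Proof.
move=> hf.
have cf x : {for x, continuous f}.
  have [a ax] := rs_cover x; exact: (cont_expr ax (holomorphic_cont (hf a x ax))).
pose N x : R := Re `|f x|.
have NE x : `|f x| = (N x)%:C%C by rewrite /N RRe_real// normr_real.
have cN : continuous N.
  move=> x; have c1 : {for x, continuous (fun y => `|f y| : C)}.
    exact: (continuous_comp (cf x) (@norm_continuous _ C _)).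
  exact: (continuous_comp c1 (@continuous_Re R _)).
have [x0 _ Hx0] : exists2 x0, x0 \in [set: X] & forall y, y \in [set: X] -> N y <= N x0.
  by apply: compact_EVT_max => //; [exact: rs_nonempty|exact: continuous_subspaceT].
have maxf y : `|f y| <= `|f x0| by rewrite !NE lecR Hx0// inE.
suff H x : f x = f x0 by move=> x y; rewrite !H.
pose P x := `[< f x = f x0 >].
suff : P x = P x0 by move=> PE; apply/asboolP; rewrite -/(P x) PE; apply/asboolP.
suff lc : forall y, [set: X] y -> \forall u \near y, [set: X] u -> P u = P y.
  exact: (connected_locally_constant (@rs_connected _ X) lc (s := x) (t := x0) I I).
move=> y _.
have [a ay] := rs_cover y.
rewrite /P; have [fy|fy] := pselect (f y = f x0).
  have M : \forall w \near (coord a y : C), `|(f \o inv a) w| <= `|(f \o inv a) (coord a y)|.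
    by apply: (@filterE _ (nbhs (coord a y : C))) => w; rewrite /= (coordK ay) fy maxf.
  have := local_max_constant (hf a y ay) M; rewrite /= (coordK ay) => nf.
  have := near_expr (P := fun _ u => u = f y) ay nf.
  by move=> /near_imp; apply => z -> _; rewrite fy.
have := near_cont_neq (cf y) (introN eqP fy).
move=> /near_imp; apply => z /eqP fz _.
by rewrite (asboolF fz) (asboolF fy).
Qed.

(** Orders cancel in the quotient, whose repaired version is holomorphic everywhere and so
    constant. *)
Lemma section_unique k q1 q2 (D : {freeg X}) :
  (forall a b x, dom a x -> dom b x -> {for x, continuous (jacobian a b : X -> C)}) ->
  section_div k q1 D -> section_div k q2 D ->
  exists2 c : R[i], c != 0 & forall a x, dom a x -> q2 a x = c * q1 a x.
Proof.
move=> Jc [t1 D1] [t2 D2].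
pose f0 : coefficients X := fun a x => q2 a x / q1 a x.
have f0t x : transforms_at 0 f0 x.
  move=> a b ax bx; rewrite /f0 (t1 x a b ax bx) (t2 x a b ax bx).
  rewrite expr0 mulr1 invfM mulrACA mulfV ?mulr1//.
  by rewrite expf_neq0// jacobian_neq0.
have f0D a x : dom a x ->
    punctured_order (local_expr f0 a) (coord a x) (coeff x (0 : {freeg X})).
  move=> ax; have o1 := has_order_punctured (D1 a x ax).
  have o2 := has_order_punctured (D2 a x ax).
  have := punctured_orderM o2 (punctured_orderV o1).
  by rewrite coeff0 subrr.
have [ft fs] := limit_section Jc f0t f0D.
have [f fE] := weight0_function ft.
have hf a x : dom a x -> holomorphic_at (f \o inv a : C -> C) (coord a x).
  move=> ax; have [h [hh h0 hE]] := fs a x ax.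
  have E : \forall w \near (coord a x : C), h w = (f \o inv a) w.
    apply: (near_imp2 hE (near_image ax)) => w + [aw _].
    by rewrite /= (fE a _ aw) coeff0 expr0z mul1r => <-.
  by apply: (near_imp2 (near_near E) hh) => w Ew dh; exact: (near_eq_derive Ew dh).1.
have fc := holomorphic_constant hf.
(* At a common zero or pole both coefficients are 0 and their ratio tells nothing, so the relation
   with [f] is read off the leading factors [h1] and [h2]. *)
have fv a x (ax : dom a x) : exists h1 h2 : C -> C, exists k : int,
   [/\ h1 (coord a x) != 0, h2 (coord a x) != 0, q1 a x = 0 ^ k * h1 (coord a x),
     q2 a x = 0 ^ k * h2 (coord a x) & f x = h2 (coord a x) / h1 (coord a x)].
  have [h1 [hh1 h10 E1]] := D1 a x ax; have [h2 [hh2 h20 E2]] := D2 a x ax.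
  exists h1, h2, (coeff x D); split => //.
  - by have := nbhs_singleton E1; rewrite subrr /local_expr /= (coordK ax).
  - by have := nbhs_singleton E2; rewrite subrr /local_expr /= (coordK ax).
  pose G y : C := h2 (coord a y) / h1 (coord a y).
  rewrite (fE a x ax) -/(G x); apply: limit_coefficientE.
  - have c1 := continuous_comp (coord_cont ax) (holomorphic_cont hh1).
    have c2 := continuous_comp (coord_cont ax) (holomorphic_cont hh2).
    exact: (contM c2 (contV (f := h1 \o coord a) h10 c1)).
  - by rewrite /G mulf_neq0 ?invr_eq0.
  have n1 := near_expr (P := fun v u => u = (v - coord a x) ^ (coeff x D) * h1 v) ax E1.
  have n2 := near_expr (P := fun v u => u = (v - coord a x) ^ (coeff x D) * h2 v) ax E2.
  apply: (near_imp2 (near_imp2 n1 n2 (fun _ => @conj _ _)) (near_dom ax)) => y [e1 e2] ay yx.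
  rewrite /f0 e1 e2 /G invfM mulrACA divff ?mul1r//.
  by rewrite expfz_neq0// subr_eq0 coord_neq.
have [x0 _] := rs_nonempty X; have [a0 ax0] := rs_cover x0.
exists (f x0).
  by have [h1 [h2 [k' [n1 n2 _ _ ->]]]] := fv a0 x0 ax0; rewrite mulf_neq0 ?invr_eq0.
move=> a x ax; rewrite (fc x0 x).
have [h1 [h2 [k' [n1 n2 -> -> ->]]]] := fv a x ax.
by rewrite mulrCA divfK.
Qed.

End CompactSurface.

(** * Flat sections over squares and simplices *)

Section LocalSystem.
Variables (R : realType) (X : topologicalType) (Y : set X).
Variable good : (X -> 'Z_4) -> X -> Prop.
Implicit Types (k l : X -> 'Z_4).

(* The meaning of [good k y] is that near y, the function k is a flat section
   of a Z/4-torsor trivialized, discontinuously, over each point of Y. *)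
Hypothesis good_near : forall k y, good k y -> \forall z \near y, good k z.
Hypothesis good_diff : forall k l y, good k y -> good l y ->
  \forall z \near y, k z - l z = k y - l y.
Hypothesis good_ex : forall y, Y y -> exists k, good k y.
Hypothesis good_shift : forall k y (c : 'Z_4), good k y -> good (fun z => k z + c) y.

(** A flat section of the pullback along [f]. It is a function on [T] and need not factor through
    [f]: along a loop it may take two values over one point of [X]. *)
Definition flat (T : topologicalType) (f : T -> X) (S : set T) (F : T -> 'Z_4) :=
  forall t, S t -> exists k, good k (f t) /\ \forall u \near t, S u -> k (f u) = F u.

Section Generic.
Variables (T : topologicalType) (f : T -> X).
Hypothesis cf : continuous f.
Implicit Types (S : set T) (F G : T -> 'Z_4).

Lemma flat_diff S F G t : S t -> flat f S F -> flat f S G ->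
  \forall u \near t, S u -> F u - G u = F t - G t.
Proof.
move=> St /(_ t St)[k [gk kF]] /(_ t St)[l [gl lG]].
have H := near_comp (@cf t) (good_diff gk gl).
apply: (near_imp2 H (near_imp2 kF lG (fun _ => @conj _ _))) => u kl [ku lu] Su.
by rewrite -ku// -lu// kl -(nbhs_singleton kF St) -(nbhs_singleton lG St).
Qed.

Lemma flat_diff_const S F G : connected S -> flat f S F -> flat f S G ->
  forall s t, S s -> S t -> F s - G s = F t - G t.
Proof.
move=> cS fF fG s t Ss St.
have lc u : S u -> \forall v \near u, S v -> F v - G v = F u - G u.
  by move=> Su; exact: flat_diff.
exact: (connected_locally_constant cS lc Ss St).
Qed.

Lemma flat_shift S F c : flat f S F -> flat f S (fun t => F t + c).
Proof.
move=> fF t St; have [k [gk kF]] := fF t St.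
exists (fun z => k z + c); split; first exact: good_shift.
by apply: (near_imp kF) => u ku Su; rewrite ku.
Qed.

Lemma flat_good k S : (forall t, S t -> good k (f t)) -> flat f S (k \o f).
Proof.
by move=> gk t St; exists k; split; [exact: gk|apply: (@filterE _ (nbhs t))].
Qed.

(** On the connected overlap the sections differ by a constant, which is added to the second one.
    Closedness keeps the other piece away from a point that lies in one piece only. *)
Lemma flat_glue S1 S2 F1 F2 : closed S1 -> closed S2 -> connected (S1 `&` S2) ->
  flat f S1 F1 -> flat f S2 F2 -> exists F, flat f (S1 `|` S2) F.
Proof.
move=> c1 c2 cI f1 f2.
have [c cE] : exists c, forall t, S1 t -> S2 t -> F1 t = F2 t + c.
  have [[t0 [t01 t02]]|nI] := pselect (S1 `&` S2 !=set0); last first.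
    by exists 0 => t t1 t2; exfalso; apply: nI; exists t.
  exists (F1 t0 - F2 t0) => t t1 t2.
  have fI1 : flat f (S1 `&` S2) F1.
    move=> s [s1 s2]; have [k [gk kF]] := f1 s s1; exists k; split => //.
    by apply: (near_imp kF) => u ku [u1 u2]; exact: ku.
  have fI2 : flat f (S1 `&` S2) F2.
    move=> s [s1 s2]; have [k [gk kF]] := f2 s s2; exists k; split => //.
    by apply: (near_imp kF) => u ku [u1 u2]; exact: ku.
  rewrite (flat_diff_const cI fI1 fI2 (conj t01 t02) (conj t1 t2)).
  by rewrite addrC subrK.
have f2c := flat_shift c f2.
have off S t : closed S -> ~ S t -> \forall u \near t, ~ S u.
  move=> cS nSt; have oS : open (~` S) by exact: closed_openC.
  by apply: (open_nbhs_nbhs (conj oS _)).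
exists (fun t => if `[< S1 t >] then F1 t else F2 t + c) => t St.
have [t1|t1] := pselect (S1 t); have [t2|t2] := pselect (S2 t).
- have [k [gk kF]] := f1 t t1; have [l [gl lF]] := f2c t t2.
  exists k; split => //.
  have H := near_comp (@cf t) (good_diff gk gl).
  apply: (near_imp2 H (near_imp2 kF lF (fun _ => @conj _ _))) => u kl [ku lu] Su.
  case: asboolP => u1; first exact: ku.
  have u2 : S2 u by case: Su.
  apply/eqP; rewrite -(lu u2) -subr_eq0 kl (nbhs_singleton kF t1).
  by rewrite (nbhs_singleton lF t2) -(cE t t1 t2) subrr.
- have [k [gk kF]] := f1 t t1; exists k; split => //.
  apply: (near_imp2 kF (off S2 t c2 t2)) => u ku nu [u1|//].
  by rewrite asboolT// ku.
- have [k [gk kF]] := f2c t t2; exists k; split => //.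
  apply: (near_imp2 kF (off S1 t c1 t1)) => u ku nu [//|u2].
  by rewrite asboolF// ku.
- by case: St.
Qed.

End Generic.

Lemma flat_comp (T T' : topologicalType) (f : T -> X) (h : T' -> T)
    (S : set T) (S' : set T') F : continuous h -> (forall t, S' t -> S (h t)) ->
  flat f S F -> flat (f \o h) S' (F \o h).
Proof.
move=> ch hS fF t St; have [k [gk kF]] := fF _ (hS _ St).
exists k; split => //.
by apply: (near_imp (near_comp (@ch t) kF)) => u ku Su; apply: ku; exact: hS.
Qed.

Definition rect (x1 x2 y1 y2 : R) : set (R * R) :=
  [set p | x1 <= p.1 <= x2 /\ y1 <= p.2 <= y2].

Lemma rect_closed x1 x2 y1 y2 : closed (rect x1 x2 y1 y2).
Proof.
have cf : continuous (fst : R * R -> R) by move=> p; exact: cvg_fst.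
have cn : continuous (snd : R * R -> R) by move=> p; exact: cvg_snd.
have -> : rect x1 x2 y1 y2 = fst @^-1` `[x1, x2] `&` snd @^-1` `[y1, y2].
  by apply/seteqP; split => p /=; rewrite /rect /= !in_itv.
apply: closedI; apply: (@preimage_closed (R * R)%type R).
- exact: in1W cf.
- exact: interval_closed.
- exact: in1W cn.
- exact: interval_closed.
Qed.

Lemma vsegment_connected (x y1 y2 : R) : connected (rect x x y1 y2).
Proof.
have -> : rect x x y1 y2 = (fun y : R => (x, y)) @` `[y1, y2].
  apply/seteqP; split => [[p q] /= [/= xp yq]|_ [q yq <-]].
    exists q; first by rewrite in_itv.
    by congr (_, _); apply/eqP; rewrite eq_le.
  by split; rewrite /= ?lexx//; move: yq; rewrite /= in_itv.
apply: connected_continuous_connected; first exact: segment_connected.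
apply: continuous_subspaceT => y.
exact: (cont_pair (f := cst x) (g := idfun) (cvg_cst x) cvg_id).
Qed.

Lemma hsegment_connected (x1 x2 y : R) : connected (rect x1 x2 y y).
Proof.
have -> : rect x1 x2 y y = (fun x : R => (x, y)) @` `[x1, x2].
  apply/seteqP; split => [[p q] /= [/= xp yq]|_ [q yq <-]].
    exists p; first by rewrite in_itv.
    by congr (_, _); apply/eqP; rewrite eq_le.
  by split; rewrite /= ?lexx//; move: yq; rewrite /= in_itv.
apply: connected_continuous_connected; first exact: segment_connected.
apply: continuous_subspaceT => x.
exact: (cont_pair (f := idfun) (g := cst y) cvg_id (cvg_cst y)).
Qed.

Lemma flat_square (f : R * R -> X) : continuous f -> (forall t, Y (f t)) ->
  exists F, flat f (rect 0 1 0 1) F.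
Proof.
move=> cf fY; apply: contrapT => nF.
pose Q (x y t : R) := ~ exists F, flat f (rect x (x + t) y (y + t)) F.
have Q0 : Q 0 0 1 by rewrite /Q !add0r.
have [|x0 [y0 H]] := square_bisection ltr01 Q0.
  move=> x y t t0 Qxy; apply: contrapT => nQ; apply: Qxy.
  have half : 0 < t / 2 by rewrite divr_gt0.
  have quarter (i j : bool) : exists F,
      flat f (rect (x + i%:R * (t / 2)) (x + i%:R * (t / 2) + t / 2)
      (y + j%:R * (t / 2)) (y + j%:R * (t / 2) + t / 2)) F.
    by apply: contrapT => nn; apply: nQ; exists i, j.
  have tt z : z + t = z + t / 2 + t / 2 by rewrite -addrA -splitr.
  have zt z : z <= z + t / 2 by rewrite lerDl ltW.
  have glue_h y1 y2 x1 x2 x3 : x1 <= x2 -> x2 <= x3 ->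
    (exists F, flat f (rect x1 x2 y1 y2) F) -> (exists F, flat f (rect x2 x3 y1 y2) F) ->
    exists F, flat f (rect x1 x3 y1 y2) F.
    move=> x12 x23 [F1 f1] [F2 f2].
    have -> : rect x1 x3 y1 y2 = rect x1 x2 y1 y2 `|` rect x2 x3 y1 y2.
      apply/seteqP; split => [p [/andP[p1 p3] p2]|p].
        by case: (leP p.1 x2) => px; [left|right]; split => //; rewrite ?p1 ?p3 ?px ?ltW.
      case=> -[/andP[p1 p3] p2]; split => //.
        by rewrite p1 (le_trans p3).
      by rewrite p3 (le_trans x12).
    apply: (flat_glue cf _ _ _ f1 f2); [exact: rect_closed|exact: rect_closed|].
    have -> : rect x1 x2 y1 y2 `&` rect x2 x3 y1 y2 = rect x2 x2 y1 y2.
      apply/seteqP; split => [p [[/andP[_ p1] p2] [/andP[p3 _] _]]|p [/andP[p1 p3] p2]].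
        by split => //; rewrite p1 p3.
      by split; split => //; rewrite ?p1 ?p3 ?(le_trans x12)// ?(le_trans p3).
    exact: vsegment_connected.
  have glue_v x1 x2 y1 y2 y3 : y1 <= y2 -> y2 <= y3 ->
    (exists F, flat f (rect x1 x2 y1 y2) F) -> (exists F, flat f (rect x1 x2 y2 y3) F) ->
    exists F, flat f (rect x1 x2 y1 y3) F.
    move=> x12 x23 [F1 f1] [F2 f2].
    have -> : rect x1 x2 y1 y3 = rect x1 x2 y1 y2 `|` rect x1 x2 y2 y3.
      apply/seteqP; split => [p [p2 /andP[p1 p3]]|p].
        by case: (leP p.2 y2) => px; [left|right]; split => //; rewrite ?p1 ?p3 ?px ?ltW.
      case=> -[p2 /andP[p1 p3]]; split => //.
        by rewrite p1 (le_trans p3).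
      by rewrite p3 (le_trans x12).
    apply: (flat_glue cf _ _ _ f1 f2); [exact: rect_closed|exact: rect_closed|].
    have -> : rect x1 x2 y1 y2 `&` rect x1 x2 y2 y3 = rect x1 x2 y2 y2.
      apply/seteqP; split => [p [[p2 /andP[_ p1]] [_ /andP[p3 _]]]|p [p2 /andP[p1 p3]]].
        by split => //; rewrite p1 p3.
      by split; split => //; rewrite ?p1 ?p3 ?(le_trans x12)// ?(le_trans p3).
    exact: hsegment_connected.
  rewrite !tt; apply: (glue_v _ _ _ (y + t / 2)) => //;
    apply: (glue_h _ _ _ (x + t / 2)) => //.
  - by have := quarter false false; rewrite !mul0r !addr0.
  - by have := quarter true false; rewrite !mul1r !mul0r !addr0.
  - by have := quarter false true; rewrite !mul1r !mul0r !addr0.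
  - by have := quarter true true; rewrite !mul1r.
(* Around the limit point a single [k] is good, so its pullback is flat on every sufficiently small
   square, contrary to [Q]. *)
have [k gk] := good_ex (fY (x0, y0)).
have /nbhs_ballP[e /= e0 He] := near_comp (@cf (x0, y0)) (good_near gk).
have [x [y [t [/andP[t0 te] /andP[x1 x2] /andP[y1 y2]]]]] := H e e0; apply.
exists (k \o f); apply: flat_good => -[u v] [/= /andP[u1 u2] /andP[v1 v2]].
apply: He; split; rewrite -ball_normE /= ltr_norml; lra.
Qed.

End LocalSystem.

(** * Simplices as retracts of Euclidean spaces *)

Section SimplexCoordinates.
Variable R : realType.

Lemma cont_row (T : topologicalType) n (f : T -> 'rV[R]_n) (x : T) :
  (forall j, {for x, continuous (fun t => f t 0 j)}) -> {for x, continuous f}.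
Proof.
move=> cf A [/= P Pt PA].
suff H : \forall s \near x, forall j, P 0 j (f s 0 j).
  by apply: (near_imp H) => s Ps; apply: PA => a b; rewrite ord1.
apply: (@filter_forall _ _ (fun j s => P 0 j (f s 0 j)) (nbhs x)) => j.
exact: (near_comp (cf j) (Pt 0 j)).
Qed.

Lemma coord_simplex_cont n (j : 'I_n.+1) :
  continuous (fun t : std_simplex R n => val t 0 j).
Proof.
move=> t; apply: (@continuous_comp _ _ _ (val : std_simplex R n -> _)
  (fun v : 'rV[R]_n.+1 => v 0 j)).
  exact: initial_continuous.
exact: coord_continuous.
Qed.

Lemma cont_to_simplex (T : topologicalType) n (f : T -> std_simplex R n) :
  (forall j x, {for x, continuous (fun t => val (f t) 0 j)}) -> continuous f.
Proof.
move=> cf; apply: continuous_comp_initial => x.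
by apply: cont_row => j; exact: cf.
Qed.

Lemma simplex_ge0 n (t : std_simplex R n) j : 0 <= val t 0 j.
Proof. by have /set_mem[t0 _] := valP t. Qed.

Lemma simplex_sum n (t : std_simplex R n) : \sum_j val t 0 j = 1.
Proof. by have /set_mem[_ t1] := valP t. Qed.

Lemma simplex_le1 n (t : std_simplex R n) j : val t 0 j <= 1.
Proof.
by rewrite -(simplex_sum t) (bigD1 j)//= lerDl sumr_ge0// => i _; exact: simplex_ge0.
Qed.

Lemma face_vertex n (i : 'I_n.+2) (j : 'I_n.+1) :
  face i (vertex R j) = vertex R (fintype.lift i j).
Proof.
apply/val_inj/rowP => k; rewrite !mxE eqxx /=.
case: unliftP => [l ->|->] /=; last first.
  by rewrite (negPf (neq_lift _ _)).
by rewrite mxE eqxx /= (inj_eq lift_inj).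
Qed.

Definition row3 (a b : R) : 'rV[R]_3 :=
  \row_j (if j == 0 then 1 - a - b else if j == 1 then a else b).

(** Negative coordinates are replaced by 0, and then both are divided by their sum if it exceeds 1.
    On the simplex neither operation changes anything. *)
Lemma row3_subproof (a b : R) :
  row3 (Num.max a 0 / Num.max 1 (Num.max a 0 + Num.max b 0))
       (Num.max b 0 / Num.max 1 (Num.max a 0 + Num.max b 0)) \in std_simplex R 2.
Proof.
set a' := Num.max a 0; set b' := Num.max b 0; set m := Num.max 1 _.
have a0 : 0 <= a' by rewrite le_max lexx orbT.
have b0 : 0 <= b' by rewrite le_max lexx orbT.
have m1 : 1 <= m by rewrite le_max lexx.
have m0 : 0 < m by exact: lt_le_trans m1.
have ab : a' + b' <= m by rewrite /m le_max lexx orbT.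
apply/mem_set; split => [j|].
  rewrite mxE; case: ifP => _.
    by rewrite -addrA -opprD -mulrDl subr_ge0 ler_pdivrMr// mul1r.
  by case: ifP => _; rewrite divr_ge0// ltW.
rewrite !big_ord_recl big_ord0 !mxE /=; ring.
Qed.

(* A retraction of the plane, which makes the 2-simplex a retract of a square. *)
Definition plane_to_simplex2 (p : R * R) : std_simplex R 2 :=
  SigSub (row3_subproof p.1 p.2).

Definition simplex2_to_plane (t : std_simplex R 2) : R * R := (val t 0 1, val t 0 2).

Lemma cont_max (T : topologicalType) (f g : T -> R) x :
  {for x, continuous f} -> {for x, continuous g} ->
  {for x, continuous (fun t => Num.max (f t) (g t))}.
Proof.
by move=> cf cg; have := @continuous_max _ _ _ _ _ cf cg.
Qed.

Lemma plane_to_simplex2_cont : continuous plane_to_simplex2.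
Proof.
apply: cont_to_simplex => j x.
have cf : {for x, continuous (fst : R * R -> R)} by exact: cvg_fst.
have cn : {for x, continuous (snd : R * R -> R)} by exact: cvg_snd.
have ca := cont_max cf (cont_cst 0); have cb := cont_max cn (cont_cst 0).
have cm := cont_max (cont_cst 1) (contD ca cb).
have m0 : Num.max 1 (Num.max x.1 0 + Num.max x.2 0) != 0.
  by rewrite gt_eqF// lt_max ltr01.
have ci := contV (f := fun x : R * R => Num.max 1 (Num.max x.1 0 + Num.max x.2 0)) m0 cm.
have c1 := contM ca ci; have c2 := contM cb ci.
apply: (near_eq_cont (f := fun p : R * R => row3
  (Num.max p.1 0 / Num.max 1 (Num.max p.1 0 + Num.max p.2 0))
  (Num.max p.2 0 / Num.max 1 (Num.max p.1 0 + Num.max p.2 0)) 0 j)).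
  by apply: (@filterE _ (nbhs x)).
have [j0|j0] := eqVneq j 0.
  apply: (near_eq_cont _ (contB (contB (cont_cst 1) c1) c2)).
  by apply: (@filterE _ (nbhs x)) => y; rewrite mxE j0 eqxx.
have [j1|j1] := eqVneq j 1.
  apply: (near_eq_cont _ c1).
  by apply: (@filterE _ (nbhs x)) => y; rewrite mxE (negPf j0) j1 eqxx.
apply: (near_eq_cont _ c2).
by apply: (@filterE _ (nbhs x)) => y; rewrite mxE (negPf j0) (negPf j1).
Qed.

Lemma simplex2_to_plane_cont : continuous simplex2_to_plane.
Proof.
move=> t; exact: (cont_pair (@coord_simplex_cont 2 1 t) (@coord_simplex_cont 2 2 t)).
Qed.

Lemma simplex2_to_planeK : cancel simplex2_to_plane plane_to_simplex2.
Proof.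
move=> t; apply/val_inj/rowP => j.
have s := simplex_sum t; rewrite !big_ord_recl big_ord0 /= addr0 in s.
have t0 := simplex_ge0 t.
have E1 : fintype.lift ord0 ord0 = 1 :> 'I_3 by exact/val_inj.
have E2 : fintype.lift ord0 (fintype.lift ord0 ord0) = 2 :> 'I_3 by exact/val_inj.
rewrite E1 E2 in s.
rewrite /= !(max_idPl (t0 _)) max_l; last by rewrite -s lerDr.
rewrite !divr1 mxE; case: eqP => [->|j0].
  have solve (a b c : R) : a + (b + c) = 1 -> 1 - b - c = a by lra.
  exact: solve s.
case: eqP => [->//|j1]; congr (val t 0 _).
by case: j j0 j1 => [[|[|[|//]]]] p /eqP j0 /eqP j1; exact/val_inj.
Qed.

Lemma simplex2_to_plane_rect t : rect 0 1 0 1 (simplex2_to_plane t).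
Proof.
by split; rewrite /= simplex_ge0 simplex_le1.
Qed.

Definition row2 (a : R) : 'rV[R]_2 := \row_j (if j == 0 then 1 - a else a).

Lemma row2_subproof (a : R) : row2 (Num.min 1 (Num.max a 0)) \in std_simplex R 1.
Proof.
apply/mem_set; split => [j|].
  rewrite mxE; case: ifP => _; first by rewrite subr_ge0 ge_min lexx.
  by rewrite le_min ler01 le_max lexx orbT.
rewrite !big_ord_recl big_ord0 !mxE /=; ring.
Qed.

Definition line_to_simplex1 (a : R) : std_simplex R 1 := SigSub (row2_subproof a).

Lemma line_to_simplex1_cont : continuous line_to_simplex1.
Proof.
apply: cont_to_simplex => j x.
have c0 : {for x, continuous (fun a : R => Num.min 1 (Num.max a 0))}.
  have cm := cont_max (f := idfun) (x := x) cvg_id (cont_cst 0).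
  by have := @continuous_min _ _ _ _ _ (cont_cst 1) cm.
have [j0|j0] := eqVneq j 0.
  apply: (near_eq_cont _ (contB (cont_cst 1) c0)).
  by apply: (@filterE _ (nbhs x)) => y; rewrite mxE j0 eqxx.
apply: (near_eq_cont _ c0).
by apply: (@filterE _ (nbhs x)) => y; rewrite mxE (negPf j0).
Qed.

Lemma line_to_simplex1K (t : std_simplex R 1) : line_to_simplex1 (val t 0 1) = t.
Proof.
apply/val_inj/rowP => j.
have s := simplex_sum t; rewrite !big_ord_recl big_ord0 /= addr0 in s.
have t0 := simplex_ge0 t.
have E1 : fintype.lift ord0 ord0 = 1 :> 'I_2 by exact/val_inj.
rewrite E1 in s.
rewrite /= !(max_idPl (t0 _)) min_r; last by rewrite -s lerDr.
rewrite mxE; case: eqP => [->|j0]; first by rewrite -s addrK.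
by congr (val t 0 _); case: j j0 => [[|[|//]]] p /eqP j0; exact/val_inj.
Qed.

Lemma simplex1_connected : connected [set: std_simplex R 1].
Proof.
have -> : [set: std_simplex R 1] = line_to_simplex1 @` `[0, 1].
  apply/seteqP; split => // t _; exists (val t 0 1); last exact: line_to_simplex1K.
  by rewrite /= in_itv /= simplex_ge0 simplex_le1.
apply: connected_continuous_connected; first exact: segment_connected.
exact/continuous_subspaceT/line_to_simplex1_cont.
Qed.

End SimplexCoordinates.

Lemma freeg_additive_eq0 (K : choiceType) (V : zmodType) (h : {freeg K} -> V) :
  {morph h : x y / x - y} -> (forall k z, h << k *g z >> = 0) -> forall D, h D = 0.
Proof.
move=> hB h0 D; have hz : h 0 = 0 by have := hB 0 0; rewrite !subrr.
have hN x : h (- x) = - h x by rewrite -[- x]sub0r hB hz sub0r.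
have hD : {morph h : x y / x + y}.
  by move=> x y; have := hB x (- y); rewrite opprK hN opprK.
by rewrite -(freeg_sumE D) (big_morph h hD hz) big1// => z _; exact: h0.
Qed.

(** * Transport as a cocycle, and the homomorphism on homology *)

Section HolonomyHomomorphism.
Variables (R : realType) (X : topologicalType) (Y : set X).
Variable good : (X -> 'Z_4) -> X -> Prop.
Hypothesis good_near : forall k y, good k y -> \forall z \near y, good k z.
Hypothesis good_diff : forall k l y, good k y -> good l y ->
  \forall z \near y, k z - l z = k y - l y.
Hypothesis good_ex : forall y, Y y -> exists k, good k y.
Hypothesis good_shift : forall k y (c : 'Z_4), good k y -> good (fun z => k z + c) y.

Lemma flat_simplex2 (s : simplex R Y 2) : exists F, flat good s setT F.
Proof.
have cs : continuous (s : std_simplex R 2 -> X) := @simplex_continuous _ _ _ _ s.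
have cp := @plane_to_simplex2_cont R.
have cf : continuous (s \o @plane_to_simplex2 R).
  by move=> p; exact: (continuous_comp (@cp p) (@cs _)).
have fY t : Y ((s \o @plane_to_simplex2 R) t) by exact: simplex_in.
have [F fF] := flat_square good_near good_diff good_ex good_shift cf fY.
exists (F \o @simplex2_to_plane R).
have E : (s : std_simplex R 2 -> X) = (s \o @plane_to_simplex2 R) \o @simplex2_to_plane R.
  by apply/funext => t /=; rewrite simplex2_to_planeK.
rewrite E.
exact: (flat_comp (h := @simplex2_to_plane R) (S' := setT)
  (@simplex2_to_plane_cont R) (fun t _ => simplex2_to_plane_rect t) fF).
Qed.

(** The segment is a side of the square, over which the map is extended independently of the second
    coordinate. *)
Lemma flat_simplex1 (s : simplex R Y 1) : exists F, flat good s setT F.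
Proof.
have cs : continuous (s : std_simplex R 1 -> X) := @simplex_continuous _ _ _ _ s.
have cl := @line_to_simplex1_cont R.
have cf1 : continuous (fst : R * R -> R) by move=> p; exact: cvg_fst.
pose f (p : R * R) := s (line_to_simplex1 p.1).
have cf : continuous f.
  by move=> p; exact: (continuous_comp (continuous_comp (@cf1 p) (@cl _)) (@cs _)).
have fY t : Y (f t) by exact: simplex_in.
have [F fF] := flat_square good_near good_diff good_ex good_shift cf fY.
pose h (t : std_simplex R 1) : R * R := (val t 0 1, 0).
have ch : continuous h.
  by move=> t; exact: (cont_pair (@coord_simplex_cont R 1 1 t) (cont_cst 0)).
have hr t : setT t -> rect 0 1 0 1 (h t).
  by move=> _; split; rewrite /= ?lexx ?ler01// simplex_ge0 simplex_le1.
exists (F \o h).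
have E : (s : std_simplex R 1 -> X) = f \o h.
  by apply/funext => t; rewrite /f /= line_to_simplex1K.
rewrite E; exact: (flat_comp ch hr fF).
Qed.

Definition transport (s : simplex R Y 1) : 'Z_4 := xget 0
  [set d | exists2 F, flat good s setT F & d = F (vertex R 1) - F (vertex R 0)].

Lemma transportE (s : simplex R Y 1) F : flat good s setT F ->
  transport s = F (vertex R 1) - F (vertex R 0).
Proof.
move=> fF; rewrite /transport; case: xgetP => [_ _ [G fG ->]|/(_ _)]; last first.
  by move=> /(_ (F (vertex R 1) - F (vertex R 0))) H; exfalso; apply: H; exists F.
have cs : continuous (s : std_simplex R 1 -> X) := @simplex_continuous _ _ _ _ s.
have := flat_diff_const good_diff cs (@simplex1_connected R) fG fF
  (s := vertex R 1) (t := vertex R 0) I I.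
move=> /eqP; rewrite subr_eq => /eqP ->; ring.
Qed.

(** A single flat section over the triangle computes the transport along all three edges, and the
    differences telescope. *)
Lemma transport_face (s : simplex R Y 2) :
  transport (simplex_face 0 s) - transport (simplex_face 1 s) +
  transport (simplex_face 2 s) = 0.
Proof.
have [F fF] := flat_simplex2 s.
have ff (i : 'I_3) : transport (simplex_face i s) =
    F (vertex R (fintype.lift i 1)) - F (vertex R (fintype.lift i 0)).
  have := flat_comp (h := @face R 1 i) (S' := setT) (@continuous_face R 1 i)
     (fun _ _ => I) fF.
  by move=> /(@transportE (simplex_face i s)) ->; rewrite /= !face_vertex.
rewrite !ff.
have -> : fintype.lift 0 1 = 2 :> 'I_3 by exact/val_inj.
have -> : fintype.lift 0 0 = 1 :> 'I_3 by exact/val_inj.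
have -> : fintype.lift 1 1 = 2 :> 'I_3 by exact/val_inj.
have -> : fintype.lift 1 0 = 0 :> 'I_3 by exact/val_inj.
have -> : fintype.lift 2 1 = 1 :> 'I_3 by exact/val_inj.
have -> : fintype.lift 2 0 = 0 :> 'I_3 by exact/val_inj.
ring.
Qed.

(** [zmodule] only equips Z/4 with the scalar action of the integers that [fglift] requires of its
    target. *)
Definition chain_transport (c : {freeg (simplex R Y 1)}) : 'Z_4 :=
  fglift (transport : _ -> zmodule 'Z_4) c.

Lemma chain_transportB : {morph chain_transport : c d / c - d}.
Proof.
by move=> c d; have := @lift_is_additive int _ (zmodule 'Z_4) transport c d.
Qed.

HB.instance Definition _ :=
  GRing.isZmodMorphism.Build _ _ chain_transport chain_transportB.

Lemma chain_transportU k s : chain_transport << k *g s >> = transport s *~ k.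
Proof. by rewrite /chain_transport liftU scalezrE. Qed.

Lemma chain_transport_boundary (d : {freeg (simplex R Y 2)}) :
  chain_transport (boundary d) = 0.
Proof.
apply: (@freeg_additive_eq0 _ _ (fun d => chain_transport (boundary d))).
  by move=> x y; rewrite boundaryB chain_transportB.
move=> k s; rewrite /boundary liftU -[k in LHS]intz scaler_int raddfMz.
rewrite raddf_sum /=.
under eq_bigr => i _ do rewrite chain_transportU.
rewrite !big_ord_recl big_ord0 addr0 /= expr0 expr1 sqrrN expr1n.
have -> : fintype.lift ord0 ord0 = 1 :> 'I_3 by exact/val_inj.
have -> : fintype.lift ord0 (fintype.lift ord0 ord0) = 2 :> 'I_3 by exact/val_inj.
by rewrite addrA mulr1z mulrN1z transport_face mul0rz.
Qed.

Definition holonomy (x : H1 R Y) : 'Z_4 := chain_transport (cycle_val (repr x)).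

Lemma holonomy_pi (c : @Defs.cycle R X Y) :
  holonomy (\pi_(Quotient.quot (@Defs.is_boundary R X Y))%qT c) = chain_transport c.
Proof.
rewrite /holonomy; apply/eqP; rewrite -subr_eq0 -chain_transportB.
have : repr (\pi_(Quotient.quot (@Defs.is_boundary R X Y))%qT c) - c
    \in @Defs.is_boundary R X Y.
  by rewrite Quotient.idealrBE reprK.
rewrite unfold_in => /asboolP[d dE].
by rewrite -[_ - _]/(cycle_val (_ - c)) -dE chain_transport_boundary.
Qed.

Lemma holonomyB : {morph holonomy : x y / x - y}.
Proof.
move=> x y; rewrite -[x]reprK -[y]reprK.
pose pi := \pi_(Quotient.quot (@Defs.is_boundary R X Y))%qT.
have piB (c d : @Defs.cycle R X Y) : pi c - pi d = pi (c - d) by rewrite /pi raddfB.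
rewrite -[X in holonomy X = _]/(pi (repr x) - pi (repr y)) piB.
by rewrite !holonomy_pi -chain_transportB.
Qed.

Lemma holonomy_loop (s : simplex R Y 1) (sl : is_loop s) :
  holonomy (loop_class sl) = transport s.
Proof. by rewrite /loop_class holonomy_pi chain_transportU mulr1z. Qed.

End HolonomyHomomorphism.

(** * Branches of the fourth root *)

Section Branches.
Variables (R : realType) (X : riemannSurface R).
Local Notation C := (complex R)^o.
Local Notation dom a := (chart_dom (rs_chart a)).
Local Notation coord a := (chart_map (rs_chart a)).
Local Notation inv a := (chart_inv (rs_chart a)).
Implicit Types (a b : rs_index X) (x y z : X).
Hypothesis Jc : forall a b x, dom a x -> dom b x ->
  {for x, continuous (jacobian a b : X -> C)}.
Variables (Y : set X) (q r : coefficients X) (e j : nat).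
Hypothesis Yo : open Y.
Hypothesis ej : (e * 2 ^ j = 4)%N.
Hypothesis rt : forall x, transforms_at (2 ^ j) r x.
Hypothesis rY : forall a y, Y y -> dom a y ->
  has_order (local_expr r a) (coord a y) 0.
Hypothesis qE : forall a x, dom a x -> q a x = r a x ^+ e.

Let n := (2 ^ j)%N.

(** At each point an arbitrary root is taken in an arbitrary chart there, and the Jacobian carries
    it to the other charts. It depends on the point without any continuity. *)
Lemma exists_reference_root : exists ref : coefficients X,
  (forall x, transforms_at 1 ref x) /\
  (forall a x, dom a x -> ref a x ^+ n = r a x).
Proof.
pose ch x := projT1 (cid (rs_cover x)).
have chx x : dom (ch x) x := projT2 (cid (rs_cover x)).
have n0 : (0 < n)%N by rewrite expn_gt0.
exists (fun a x => (n.-root (r (ch x) x : R[i]) : C) * jacobian a (ch x) x); split.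
  move=> x a b ax bx; rewrite expr1 -mulrA; congr (_ * _).
  by rewrite (jacobian_trans ax bx (chx x)) mulrC.
move=> a x ax; rewrite exprMn [X in X * _](rootCK n0).
by rewrite (rt ax (chx x)).
Qed.

Variable ref : coefficients X.
Hypothesis reft : forall x, transforms_at 1 ref x.
Hypothesis refn : forall a x, dom a x -> ref a x ^+ n = r a x.

Definition branch (k : X -> 'Z_4) : coefficients X := fun a x => iZ R (k x) * ref a x.

Lemma near_Y y : Y y -> \forall z \near y, Y z.
Proof. by move=> Yy; apply: open_nbhs_nbhs. Qed.

Lemma r_neq0 a y : Y y -> dom a y -> r a y != 0.
Proof.
move=> Yy ay; have [h [hh h0 hE]] := rY Yy ay.
by have := nbhs_singleton hE; rewrite /local_expr /= (coordK ay) expr0z mul1r => ->.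
Qed.

Lemma ref_neq0 a y : Y y -> dom a y -> ref a y != 0.
Proof.
move=> Yy ay; have := r_neq0 Yy ay; rewrite -refn//; apply: contra_neq => ->.
by rewrite expr0n expn_eq0.
Qed.

Lemma ref4 a y : dom a y -> ref a y ^+ 4 = q a y.
Proof. by move=> ay; rewrite qE// -refn// -exprM mulnC ej. Qed.

Lemma branch_neq0 k a y : Y y -> dom a y -> branch k a y != 0.
Proof. by move=> Yy ay; rewrite mulf_neq0 ?iZ_neq0// ref_neq0. Qed.

Lemma branch_transforms k x : transforms_at 1 (branch k) x.
Proof. by move=> a b ax bx; rewrite /branch -mulrA -(reft ax bx). Qed.

(** Continuity is required at all nearby points, and not only at [y], in order that the condition be
    open. *)
Definition good (k : X -> 'Z_4) y := \forall z \near y,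
  Y z /\ forall a, dom a z -> {for z, continuous (branch k a : X -> C)}.

Lemma good_near k y : good k y -> \forall z \near y, good k z.
Proof. exact: near_near. Qed.

Lemma good_Y k y : good k y -> Y y.
Proof. by move=> /nbhs_singleton[]. Qed.

Lemma good_diff k l y : good k y -> good l y ->
  \forall z \near y, k z - l z = k y - l y.
Proof.
move=> gk gl; have [Yy ck] := nbhs_singleton gk; have [_ cl] := nbhs_singleton gl.
have [a ay] := rs_cover y.
apply: (@root_ratio_locally_constant R X y (branch k a) (branch l a) (fun z => k z - l z)).
- by apply: (@filterE _ (nbhs y)) => z; rewrite /branch mulrA -iZD subrK.
- exact: ck.
- exact: cl.
- exact: branch_neq0.
Qed.

Lemma good_shift k y (c : 'Z_4) : good k y -> good (fun z => k z + c) y.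
Proof.
move=> gk; apply: (near_imp gk) => z [Yz ck]; split; first exact: Yz.
move=> a az.
apply: (near_eq_cont _ (contM (cont_cst (iZ R c)) (ck a az))).
by apply: (@filterE _ (nbhs z)) => u; rewrite /branch addrC iZD mulrA.
Qed.

Lemma good_of_function (y : X) a (v : X -> C) : Y y -> dom a y ->
  (\forall z \near y, v z ^+ n = r a z) -> (\forall z \near y, {for z, continuous v}) ->
  exists k, [/\ good k y, \forall z \near y, k z *+ n = 0 &
     \forall z \near y, branch k a z = v z].
Proof.
move=> Yy ay vn cv.
pose k z : 'Z_4 := xget 0 [set d | v z = iZ R d * ref a z].
have N1 := near_imp2 (near_Y Yy) (near_dom ay) (fun _ => @conj _ _).
have kE : \forall z \near y, branch k a z = v z.
  apply: (near_imp2 N1 vn) => z [Yz az] vz.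
  rewrite /branch /k; case: xgetP => [d _ <-//|nod].
  have [d dE] : exists d, v z = iZ R d * ref a z.
    apply: root4; first exact: ref_neq0.
    by rewrite -ej mulnC !exprM vz refn.
  by case: (nod d).
exists k; split => //; last first.
  apply: (near_imp2 (near_imp2 N1 vn (fun _ => @conj _ _)) kE) => z [[Yz az] vz] kz.
  apply: (@iZ_eq1 R); rewrite iZ_pow.
  have rz := r_neq0 Yz az; apply: (mulIf rz).
  by rewrite -{1}(refn az) -exprMn -/(branch k a z) kz vz mul1r.
have N2 := near_imp2 (near_near kE) cv (fun _ => @conj _ _).
apply: (near_imp2 N1 N2) => z [Yz az] [nk cvz]; split; first exact: Yz.
move=> b bz.
have vk : \forall u \near z, v u = branch k a u by apply: (near_imp nk) => u ->.
have ck : {for z, continuous (branch k a : X -> C)} by exact: (near_eq_cont vk cvz).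
apply: (near_eq_cont _ (contM ck (Jc bz az))).
apply: (near_imp2 (near_dom az) (near_dom bz)) => u au bu.
by have := branch_transforms k bu au; rewrite expr1 => ->.
Qed.

Lemma good_ex_killed y : Y y -> exists k, good k y /\ \forall z \near y, k z *+ n = 0.
Proof.
move=> Yy; have [a ay] := rs_cover y.
have [h [hh h0 hE]] := rY Yy ay.
have [S HS] := local_root j h0.
have hcont := holomorphic_near_cont hh.
have N1 := near_comp (nbhs_singleton hcont) HS.
have N2 := near_coord ay (near_imp2 N1 hcont (fun _ => @conj _ _)).
have N3 := near_expr (P := fun u w => w = (u - coord a y) ^ 0 * h u) ay hE.
pose v z : C := S (h (coord a z)).
have vn : \forall z \near y, v z ^+ n = r a z.
  by apply: (near_imp2 N2 N3) => z [[Sz _] _] ->; rewrite expr0z mul1r.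
have cv : \forall z \near y, {for z, continuous v}.
  apply: (near_imp2 N2 (near_dom ay)) => z [[_ cS] ch] az.
  exact: (continuous_comp (continuous_comp (coord_cont az) ch) cS).
by have [k [gk kn _]] := good_of_function Yy ay vn cv; exists k.
Qed.

Lemma good_ex y : Y y -> exists k, good k y.
Proof. by move=> /good_ex_killed[k [gk _]]; exists k. Qed.

(** Near [y], [k] differs by a constant from a branch whose exponents are killed by [n]. *)
Lemma good_killed k y : good k y -> \forall z \near y, k z *+ n = k y *+ n.
Proof.
move=> gk; have [l [gl ln]] := good_ex_killed (good_Y gk).
apply: (near_imp2 (good_diff gk gl) ln) => z kl lz.
have := congr1 (fun d => d *+ n) kl.
by rewrite !mulrnBl lz (nbhs_singleton ln) !subr0.
Qed.

Local Notation transport := (transport good).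

(** A flat section [F] need not be constant, since [ref] jumps, but its multiple by [n] is locally
    constant and so takes the same value at both ends. This is the containment of the image in e
    Z/4. *)
Lemma transport_killed (s : simplex R Y 1) : transport s *+ n = 0.
Proof.
have [F fF] := flat_simplex1 good_near good_diff good_ex good_shift s.
rewrite (transportE good_diff fF) mulrnBl.
apply/eqP; rewrite subr_eq0; apply/eqP.
have cs : continuous (s : std_simplex R 1 -> X) := @simplex_continuous _ _ _ _ s.
have lc t : setT t -> \forall u \near t, setT u -> F u *+ n = F t *+ n.
  move=> _; have [k [gk kF]] := fF t I.
  apply: (near_imp2 (near_comp (@cs t) (good_killed gk)) kF) => u kn ku _.
  by rewrite -(ku I) kn -(nbhs_singleton kF I).
exact: (connected_locally_constant (@simplex1_connected R) lc
  (s := vertex R 1) (t := vertex R 0) I I).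
Qed.

Lemma chain_transport_killed (c : {freeg (simplex R Y 1)}) :
  chain_transport good c *+ n = 0.
Proof.
pose h (c : {freeg (simplex R Y 1)}) : 'Z_4 := chain_transport good c *+ n.
have hB : {morph h : x y / x - y}.
  by move=> x y; rewrite /h chain_transportB mulrnBl.
have h0 k s : h << k *g s >> = 0.
  by rewrite /h chain_transportU pmulrn mulrzAC -pmulrn transport_killed mul0rz.
exact: (freeg_additive_eq0 hB h0 c).
Qed.

(** The fourth power of the branch is a power of the holomorphic coefficient of [r]; taking a
    continuous square root twice preserves differentiability. *)
Lemma branch_derivable k a y : good k y -> dom a y ->
  derivable (local_expr (branch k) a) (coord a y) 1.
Proof.
move=> gk ay; have [Yy ck] := nbhs_singleton gk.
have [h [hh h0 hE]] := rY Yy ay.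
have cf := expr_cont ay (ck a ay).
set f := local_expr (branch k) a; set z : C := coord a y.
have f0 : f z != 0 by rewrite /f /local_expr /= (coordK ay) branch_neq0.
have d4 : derivable (fun w => f w ^+ 4) z 1.
  have dh := derivable_pow (n := e) (nbhs_singleton hh).
  apply: (near_eq_derive _ dh).1.
  apply: (near_imp2 hE (near_image ay)) => w + [aw _].
  rewrite /local_expr /= expr0z mul1r => rw.
  by rewrite /f /local_expr /= /branch exprMn iZ_X4 mul1r ref4// qE// rw.
have d2 : derivable (fun w => f w ^+ 2) z 1.
  apply: derivable_sqrt.
  - apply: (near_eq_derive _ d4).1; apply: (@filterE _ (nbhs z)) => w.
    by rewrite -exprM.
  - exact: (contX cf).
  - by rewrite expf_neq0.
exact: derivable_sqrt d2 cf f0.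
Qed.

Lemma branch_germ k y : good k y -> fourth_root_germ q (branch k) y.
Proof.
move=> gk; apply: (near_imp (good_near gk)) => z gz.
split; first exact: branch_transforms.
move=> a az; split; last by rewrite /branch exprMn iZ_X4 mul1r ref4.
apply: (near_imp2 (near_inv az (good_near gz)) (near_image az)) => w gw [aw wE].
by have := branch_derivable gw aw; rewrite wE.
Qed.

Lemma branch_same_germ k l y (c : 'Z_4) : good k y -> good l y -> l y = k y + c ->
  same_germ (fun a x => iZ R c * branch k a x) (branch l) y.
Proof.
move=> gk gl lk; apply: (near_imp (good_diff gl gk)) => z lkz a az.
rewrite /branch mulrA -iZD; congr (iZ R _ * _).
by apply/eqP; rewrite -subr_eq lkz lk addrC addKr.
Qed.

Lemma transport_monodromy (s : simplex R Y 1) : is_loop s ->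
  monodromy q s (transport s).
Proof.
move=> sl; have [F fF] := flat_simplex1 good_near good_diff good_ex good_shift s.
have cs : continuous (s : std_simplex R 1 -> X) := @simplex_continuous _ _ _ _ s.
(* [K t] is a branch that represents [F] near [t]. At the end of the loop [K] at the first vertex is
   good too, as the two ends coincide, and there the two branches differ by the transport. *)
have [K HK] := choice (fun t => fF t I).
have gK t : good (K t) (s t) by case: (HK t).
have KF t : K t (s t) = F t by case: (HK t) => _ /nbhs_singleton; apply.
exists (fun t => branch (K t)).
  split; first by move=> t; exact: branch_germ.
  move=> t; have [gt nt] := HK t.
  apply: (near_imp2 (near_comp (@cs t) (good_near gt)) nt) => u gu /(_ I) Ku.
  have E : K u (s u) = K t (s u) + 0 by rewrite addr0 KF Ku.
  apply: (near_imp (branch_same_germ gu (gK u) E)) => z H a az.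
  by rewrite H// iZ0 mul1r.
have g0 : good (K (vertex R 0)) (s (vertex R 1)) by rewrite -sl.
have E : K (vertex R 1) (s (vertex R 1)) = K (vertex R 0) (s (vertex R 1)) + transport s.
  by rewrite KF -sl KF (transportE good_diff fF) addrC subrK.
exact: (branch_same_germ g0 (gK _) E).
Qed.

Lemma holonomy_rotational : exists2 rho : {additive H1 R Y -> 'Z_4},
  rotational_holonomy q rho & forall u, rho u = holonomy good u.
Proof.
have hB := holonomyB good_near good_diff good_ex good_shift (R := R).
pose rho : {additive H1 R Y -> 'Z_4} := HB.pack (@holonomy R X Y good)
  (GRing.isZmodMorphism.Build _ _ (@holonomy R X Y good) hB).
exists rho; last by [].
move=> s sl; have -> : rho (loop_class sl) = transport s.
  exact: (holonomy_loop good_near good_diff good_ex good_shift sl).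
exact: transport_monodromy.
Qed.

Lemma simplex_eq k (s s' : simplex R Y k) : (forall t, s t = s' t) -> s = s'.
Proof.
move=> ss; have : (s : _ -> X) = s' by exact/funext.
case: s {ss} => f fc fY; case: s' => g gc gY /= fg.
by case: _ / fg in gc gY *; congr Simplex; exact: Prop_irrelevance.
Qed.

Definition point y (Yy : Y y) : simplex R Y 0 :=
  @Simplex R X Y 0 (fun=> y) (fun t => @cst_continuous _ _ y t) (fun=> Yy).

Lemma boundary_simplex1 (s : simplex R Y 1) x y (Yx : Y x) (Yy : Y y) :
  s (vertex R 0) = x -> s (vertex R 1) = y ->
  boundary << s >> = << point Yy >> - << point Yx >> :> {freeg (simplex R Y 0)}.
Proof.
move=> sx sy; rewrite /boundary liftU scale1r !big_ord_recl big_ord0 /=.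
rewrite expr0 expr1 addr0 freegUN; congr (<< _ >> + << _ *g _ >>); apply: simplex_eq => t.
  by rewrite /= (face0E t (j := 1)).
by rewrite /= (face0E t (j := 0)).
Qed.

Definition joins x y (c : {freeg (simplex R Y 1)}) := exists (Yx : Y x) (Yy : Y y),
  boundary c = << point Yy >> - << point Yx >>.

Lemma joins_refl y : Y y -> joins y y 0.
Proof. by move=> Yy; exists Yy, Yy; rewrite boundary0 subrr. Qed.

Lemma joins_trans x y z c d : joins x y c -> joins y z d -> joins x z (c + d).
Proof.
move=> [Yx [Yy cE]] [Yy' [Yz dE]]; exists Yx, Yz.
rewrite -[d]opprK boundaryB -sub0r boundaryB boundary0 sub0r opprK cE dE.
by rewrite (Prop_irrelevance Yy' Yy) addrC addrA subrK.
Qed.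

Lemma joinsN x y c : joins x y c -> joins y x (- c).
Proof.
by move=> [Yx [Yy cE]]; exists Yy, Yx; rewrite -sub0r boundaryB boundary0 cE sub0r opprB.
Qed.

(* Flat sections over a small disc are functions, so transport along a segment
   starting at its centre is read off such a function. *)
Lemma good_joins k y : good k y -> \forall z \near y, exists2 c,
  joins y z c & chain_transport good c = k z - k y.
Proof.
move=> gk; have [a ay] := rs_cover y.
have N := near_imp2 (near_inv ay (good_near gk)) (near_image ay) (fun _ => @conj _ _).
move: N => /nbhs_ballP[d /= d0 Hd].
have Nd := near_coord ay (near_dist (coord a y : C) d0).
apply: (near_imp2 Nd (near_dom ay)) => z zd az.
set w0 : C := coord a y in Hd zd *; set w1 : C := coord a z in zd *.
pose line (t : std_simplex R 1) : C := w0 + (val t 0 1)%:C%C * (w1 - w0).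
have in_ball t : good k (inv a (line t)) /\
    dom a (inv a (line t)) /\ coord a (inv a (line t)) = line t.
  apply: Hd; rewrite -ball_normE /= /line opprD addrA subrr sub0r normrN.
  rewrite normrM normc_real (ger0_norm (simplex_ge0 t 1)).
  rewrite distrC in zd; apply: le_lt_trans zd.
  have t1 : (val t 0 1)%:C%C <= (1 : R)%:C%C :> C.
    by rewrite lecR simplex_le1.
  by have := ler_wpM2r (normr_ge0 (w1 - w0)) t1; rewrite rmorph1 mul1r.
have cline t : {for t, continuous line}.
  have c1 := continuous_comp (@coord_simplex_cont R 1 1 t) (@continuous_real_complex R _).
  exact: (contD (cont_cst w0) (contM c1 (cont_cst (w1 - w0)))).
have cs : continuous (fun t => inv a (line t)).
  move=> t; have [_ [al lE]] := in_ball t.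
  have ci := inv_cont al; rewrite lE in ci.
  exact: (continuous_comp (cline t) ci).
have sY t : Y (inv a (line t)) by have [/good_Y] := in_ball t.
pose s : simplex R Y 1 := @Simplex R X Y 1 (fun t => inv a (line t)) cs sY.
have s0 : s (vertex R 0) = y.
  by rewrite /s /= /line /= mxE /= mul0r addr0 /w0 coordK.
have s1 : s (vertex R 1) = z.
  by rewrite /s /= /line /= mxE /= mul1r addrC subrK /w1 coordK.
exists << s >>.
  have Yy : Y y by rewrite -s0; exact: sY.
  have Yz : Y z by rewrite -s1; exact: sY.
  by exists Yy, Yz; exact: boundary_simplex1.
have fs : flat good s setT (k \o s) by apply: flat_good => t _; case: (in_ball t).
by rewrite chain_transportU mulr1z (transportE good_diff fs) -s0 -s1.
Qed.

Section GlobalRoot.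
Variables (e' j' : nat).
Hypothesis ej' : (e' * 2 ^ j' = 4)%N.
Let n' := (2 ^ j')%N.
Hypothesis hol_killed : forall u : H1 R Y, holonomy good u *+ n' = 0.

(** Two chains with the same ends differ by a cycle, to which the hypothesis on the holonomy
    applies. *)
Lemma joins_killed x y c d : joins x y c -> joins x y d ->
  chain_transport good c *+ n' = chain_transport good d *+ n'.
Proof.
move=> [Yx [Yy cE]] [Yx' [Yy' dE]].
have cyc : c - d \in @is_cycle R X Y.
  rewrite unfold_in boundaryB cE dE.
  by rewrite (Prop_irrelevance Yx' Yx) (Prop_irrelevance Yy' Yy) subrr.
have := hol_killed (\pi_(Quotient.quot (@Defs.is_boundary R X Y))%qT (Cycle cyc)).
rewrite (holonomy_pi good_near good_diff good_ex good_shift) => E.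
have {}E : chain_transport good (c - d) *+ n' = 0 := E.
by move: E; rewrite chain_transportB mulrnBl => /eqP; rewrite subr_eq0 => /eqP.
Qed.

Let x0 : X := projT1 (cid (@rs_nonempty _ X)).
(** The choice made by [xget] depends on the set alone, and points joined by a chain have the same
    set; so they receive the same base point. *)
Definition base_point y : X := xget x0 [set x | exists c, joins x y c].
(* Transport to y along a chain from a chosen point of its class for [joins];
   that Y is connected is not needed. *)
Definition base_transport y : 'Z_4 := xget 0
  [set d | exists2 c, joins (base_point y) y c & d = chain_transport good c].

Lemma base_transportP y : Y y -> exists2 c, joins (base_point y) y c &
  base_transport y = chain_transport good c.
Proof.
move=> Yy; have [c cj] : exists c, joins (base_point y) y c.
  rewrite /base_point; case: xgetP => [x _ //|/(_ y) ny]; exfalso; apply: ny.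
  by exists 0; exact: joins_refl.
rewrite /base_transport; case: xgetP => [_ _ [d dj ->]|/(_ (chain_transport good c)) nc].
  by exists d.
by exfalso; apply: nc; exists c.
Qed.

Lemma base_transport_joins y z c : joins y z c ->
  base_transport z *+ n' = (base_transport y + chain_transport good c) *+ n'.
Proof.
move=> yz; have [Yy [Yz _]] := yz.
have bE : base_point z = base_point y.
  rewrite /base_point; congr (xget _ _); apply/seteqP; split => x /= [d xd].
    by exists (d - c); exact: joins_trans xd (joinsN yz).
  by exists (d + c); exact: joins_trans xd yz.
have [cy jy ->] := base_transportP Yy; have [cz jz ->] := base_transportP Yz.
rewrite bE in jz.
rewrite (joins_killed jz (joins_trans jy yz)); congr (_ *+ _).
rewrite -[c in LHS]opprK chain_transportB -[- c]sub0r chain_transportB.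
by rewrite raddf0 sub0r opprK.
Qed.

(** The chosen transport is meaningful only up to elements killed by [n'], and the power [n'] of the
    branch sees only its multiple by [n']. *)
Definition global_root : coefficients X := fun a x => branch base_transport a x ^+ n'.

Lemma global_root_transforms x : transforms_at n' global_root x.
Proof.
move=> a b ax bx; rewrite /global_root (branch_transforms base_transport ax bx).
by rewrite expr1 exprMn.
Qed.

Lemma global_root_pow a x : dom a x -> global_root a x ^+ e' = q a x.
Proof.
move=> ax; rewrite /global_root -exprM mulnC ej' /branch exprMn iZ_X4 mul1r.
exact: ref4.
Qed.

(** To reach [z] near [y], a short chain with transport [k z - k y] is appended to the one ending at
    [y]; what remains of the exponent is independent of [z]. *)
Lemma global_root_near a k y : good k y -> exists2 u : C, u != 0 &
  \forall z \near y, global_root a z = u * branch k a z ^+ n'.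
Proof.
move=> gk; exists (iZ R ((base_transport y - k y) *+ n')); first exact: iZ_neq0.
apply: (near_imp (good_joins gk)) => z [c cj cE].
rewrite /global_root /branch !exprMn -!iZ_pow mulrA -iZD; congr (iZ R _ * _).
rewrite (base_transport_joins cj) cE -mulrnDl; congr (_ *+ _).
by rewrite addrA addrAC.
Qed.

Lemma global_root_order a y : Y y -> dom a y ->
  has_order (local_expr global_root a) (coord a y) 0.
Proof.
move=> Yy ay; have [k gk] := good_ex Yy; have [u u0 uE] := global_root_near a gk.
exists (fun w => u * local_expr (branch k) a w ^+ n'); split.
- apply: (near_imp2 (near_inv ay (good_near gk)) (near_image ay)) => w gw [aw wE].
  have := branch_derivable gw aw; rewrite wE => db.
  exact: (derivableM (derivable_cst _ _ _) (derivable_pow (n := n') db)).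
- by rewrite mulf_neq0// expf_neq0// /local_expr /= (coordK ay) branch_neq0.
- by apply: (near_imp (near_inv ay uE)) => w; rewrite expr0z mul1r.
Qed.

End GlobalRoot.

End Branches.

(** * Square roots on a punctured disc *)

Section PuncturedRoots.
Variable R : realType.
Local Notation C := (complex R)^o.
Implicit Types (f g h : C -> C) (z w : C).

Lemma polar_half (u v : R) : polar (u / 2) (v / 2) ^+ 2 = polar u v.
Proof.
have ee : expR u = expR (u / 2) * expR (u / 2) by rewrite -expRD -splitr.
rewrite expr2 !polarE ee [in RHS](splitr v) cosD sinD.
by apply/eqP; rewrite eq_complex /=; apply/andP; split; apply/eqP; ring.
Qed.

Lemma polar_neq0 (u v : R) : polar u v != 0.
Proof. by rewrite -normr_eq0 norm_polar gt_eqF// ltcR expR_gt0. Qed.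

Lemma polar_cont : continuous (fun p : R * R => polar p.1 p.2 : C).
Proof.
move=> x.
have cf : {for x, continuous (fst : R * R -> R)} by exact: cvg_fst.
have cn : {for x, continuous (snd : R * R -> R)} by exact: cvg_snd.
have c1 := continuous_comp (continuous_comp cf (@continuous_expR R _))
  (@continuous_real_complex R _).
have c2 := cont_complex (continuous_comp cn (@continuous_cos R _))
  (continuous_comp cn (@continuous_sin R _)).
exact: (contM c1 c2).
Qed.

Lemma sign_locally_constant (T : topologicalType) (x : T) (t : T -> C) :
  {for x, continuous t} -> (\forall y \near x, t y ^+ 2 = 1) ->
  \forall y \near x, t y = t x.
Proof.
move=> ct t2; have tx := nbhs_singleton t2.
have tn : t x != - t x.
  rewrite -subr_eq0 opprK -mulr2n mulrn_eq0 /=; apply/eqP => t0.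
  by move: tx; rewrite t0 expr0n => /eqP; rewrite eq_sym oner_eq0.
apply: (near_imp2 t2 (near_cont_neq ct tn)) => y ty yn.
have : t y ^+ 2 - t x ^+ 2 = 0 by rewrite ty tx subrr.
rewrite subr_sqr => /eqP; rewrite mulf_eq0 => /orP[|].
  by rewrite subr_eq0 => /eqP.
by rewrite addr_eq0 (negPf yn).
Qed.

(** The exponential maps the half-plane of all u below ln r onto the punctured disc. There every
    point is linked to (u0, 0) by a horizontal and a vertical segment, on which the sign is locally
    constant. *)
Lemma sign_constant_punctured (t : C -> C) z (r : R) : 0 < r ->
  (forall w, w != z -> `|w - z| < r%:C%C -> t w ^+ 2 = 1 /\ {for w, continuous t}) ->
  exists2 c : C, c != 0 & forall w, w != z -> `|w - z| < r%:C%C -> t w = c.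
Proof.
move=> r0 ht.
pose f (p : R * R) : C := z + polar p.1 p.2.
have cf p : {for p, continuous f} by exact: (contD (cont_cst z) (@polar_cont p)).
have fz p : f p != z by rewrite -subr_eq0 addrAC subrr add0r polar_neq0.
have lc p : p.1 < ln r -> \forall p' \near p, t (f p') = t (f p).
  move=> pr; have [tp cp] := ht _ (fz p) (in_disc z r0 p.2 pr).
  have nr : \forall p' \near p, p'.1 < ln r.
    have c1 : {for p, continuous (fun p' : R * R => ln r - p'.1)}.
      by apply: (contB (cont_cst (ln r))); exact: cvg_fst.
    have e0 : 0 < ln r - p.1 by rewrite subr_gt0.
    have /cont_dist/(_ _ e0) := c1; move=> /near_imp; apply => p'.
    by move=> /ltr_distlDr; rewrite ltrDr subr_gt0.
  apply: (sign_locally_constant (continuous_comp (cf p) cp)).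
  by apply: (near_imp nr) => p' p'r; case: (ht _ (fz p') (in_disc z r0 p'.2 p'r)).
pose u0 := ln r - 1.
exists (t (f (u0, 0))).
  have [|t2 _] := ht _ (fz (u0, 0)); first by apply: in_disc; rewrite /u0 /=; lra.
  by apply/eqP => t0; move: t2; rewrite t0 expr0n => /eqP; rewrite eq_sym oner_eq0.
have horiz (u1 u2 v : R) : u1 <= u2 -> u2 < ln r -> t (f (u1, v)) = t (f (u2, v)).
  move=> u12 u2r.
  have lcs p : rect u1 u2 v v p ->
      \forall p' \near p, rect u1 u2 v v p' -> (t \o f) p' = (t \o f) p.
    move=> [/andP[_ pu] _]; apply: (near_imp (lc p (le_lt_trans pu u2r))) => p' h _; exact: h.
  have m1 : rect u1 u2 v v (u1, v) by split; rewrite /= ?lexx ?u12.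
  have m2 : rect u1 u2 v v (u2, v) by split; rewrite /= ?lexx ?u12.
  exact: (connected_locally_constant (@hsegment_connected R u1 u2 v) lcs m1 m2).
have vert (u v1 v2 : R) : v1 <= v2 -> u < ln r -> t (f (u, v1)) = t (f (u, v2)).
  move=> v12 ur.
  have lcs p : rect u u v1 v2 p ->
      \forall p' \near p, rect u u v1 v2 p' -> (t \o f) p' = (t \o f) p.
    move=> [/andP[_ pu] _]; apply: (near_imp (lc p (le_lt_trans pu ur))) => p' h _; exact: h.
  have m1 : rect u u v1 v2 (u, v1) by split; rewrite /= ?lexx ?v12.
  have m2 : rect u u v1 v2 (u, v2) by split; rewrite /= ?lexx ?v12.
  exact: (connected_locally_constant (@vsegment_connected R u v1 v2) lcs m1 m2).
move=> w wz wr; have d0 : w - z != 0 by rewrite subr_eq0.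
have [u [v uvE]] := polar_surj d0.
have ur : u < ln r by rewrite -ltr_expR lnK// -ltcR -(norm_polar u v) -uvE.
have -> : w = f (u, v) by rewrite /f /= -uvE addrC subrK.
have u0r : u0 < ln r by rewrite /u0; lra.
have -> : t (f (u, v)) = t (f (u0, v)).
  case: (leP u u0) => uu; first exact: (horiz u u0 v uu u0r).
  exact: esym (horiz u0 u v (ltW uu) ur).
case: (leP v 0) => vv; first exact: (vert u0 v 0 vv u0r).
exact: esym (vert u0 0 v (ltW vv) u0r).
Qed.

(* On a circle around z, the square root exp((u + iv)/2) of exp(u + iv) changes
   sign as v goes from 0 to 2 pi. *)
Lemma no_sqrt_punctured (t : C -> C) z (r : R) : 0 < r ->
  (forall w, w != z -> `|w - z| < r%:C%C -> t w ^+ 2 = w - z /\ {for w, continuous t}) ->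
  False.
Proof.
move=> r0 ht; pose u := ln r - 1.
have ur : u < ln r by rewrite /u; lra.
pose f (v : R) : C := z + polar u v.
have cf v : {for v, continuous f}.
  have c1 : {for v, continuous (fun v : R => (u, v))}.
    exact: (cont_pair (f := cst u) (g := idfun) (cvg_cst u) cvg_id).
  exact: (contD (cont_cst z) (continuous_comp c1 (@polar_cont (u, v)))).
have fz v : f v != z by rewrite -subr_eq0 addrAC subrr add0r polar_neq0.
pose g (v : R) : C := polar (u / 2) (v / 2).
have cg v : {for v, continuous g}.
  have c0 := contM (f := idfun) (x := v) cvg_id (cont_cst (2^-1 : R)).
  have c1 : {for v, continuous (fun v : R => (u / 2, v / 2))}.
    exact: (cont_pair (f := cst (u / 2)) (cvg_cst (u / 2)) c0).
  exact: (continuous_comp c1 (@polar_cont (u / 2, v / 2))).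
have g0 v : g v != 0 by exact: polar_neq0.
pose l v := t (f v) / g v.
have l2 v : l v ^+ 2 = 1.
  have [t2 _] := ht _ (fz v) (in_disc z r0 v ur).
  rewrite /l expr_div_n t2 /g polar_half /f [z + _]addrC addrK divff//.
  exact: polar_neq0.
have cl v : {for v, continuous l}.
  have [_ ct] := ht _ (fz v) (in_disc z r0 v ur).
  exact: (contM (continuous_comp (cf v) ct) (contV (g0 v) (cg v))).
have lc v : `[0, pi *+ 2]%classic v ->
    \forall v' \near v, `[0, pi *+ 2]%classic v' -> l v' = l v.
  move=> _; have N : \forall v' \near v, l v' ^+ 2 = 1 by apply: (@filterE _ (nbhs v)).
  by apply: (near_imp (sign_locally_constant (cl v) N)) => v' h _; exact: h.
have p0 : 0 < pi *+ 2 :> R by rewrite pmulrn_lgt0// pi_gt0.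
have E : l 0 = l (pi *+ 2).
  apply: (connected_locally_constant (@segment_connected R 0 (pi *+ 2)) lc).
    by rewrite /= in_itv /= lexx ltW.
  by rewrite /= in_itv /= lexx ltW.
have f2 : f (pi *+ 2) = f 0 by rewrite /f -[pi *+ 2]add0r polar_period.
have g2 : g (pi *+ 2) = - g 0.
  rewrite /g mul0r (_ : pi *+ 2 / 2 = pi); last by rewrite mulr2n; field.
  rewrite /polar cospi sinpi cos0 sin0 -mulrN; congr (_ * _).
  by apply/eqP; rewrite eq_complex /= oppr0 !eqxx.
have tn : t (f 0) != 0.
  have := l2 0; rewrite /l; apply: contra_eq_neq => ->.
  by rewrite mul0r expr0n eq_sym oner_eq0.
move: E; rewrite /l f2 g2 invrN mulrN => /eqP.
by rewrite -subr_eq0 opprK -mulr2n mulrn_eq0 /= mulf_eq0 invr_eq0 (negPf tn) (negPf (g0 0)).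
Qed.

(** With k = 2l + e and a holomorphic root [v] of [h], the quotient [t] of [f] by [v] and the [l]-th
    power of [w - z] has square [(w - z) ^ e]. For e = 1 this is impossible around a puncture; for e
    = 0 it makes [t] a constant sign. *)
Lemma sqrt_order f g z k : punctured_order g z k ->
  (\forall w \near z, w != z -> f w ^+ 2 = g w /\ {for w, continuous f}) ->
  exists2 l : int, k = l * 2 & punctured_order f z l.
Proof.
move=> [h [hh h0 gE]] fE.
have [S HS] := local_sqrt h0.
have hcont := holomorphic_near_cont hh.
have HSh := near_comp (nbhs_singleton hcont) HS.
pose v w : C := S (h w).
have vh : \forall w \near z, v w ^+ 2 = h w by apply: (near_imp HSh) => w [].
have vcont : \forall w \near z, {for w, continuous v}.
  by apply: (near_imp2 HSh hcont) => w [_ cS] ch; exact: (continuous_comp ch cS).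
have hn0 := near_cont_neq (nbhs_singleton hcont) h0.
have vn0 : \forall w \near z, v w != 0.
  apply: (near_imp2 vh hn0) => w vw hw; apply: contra_neq hw => v0.
  by rewrite -vw v0 expr0n.
have vhol : holomorphic_at v z.
  apply: (near_imp2 (near_imp2 (near_near vh) hh (fun _ => @conj _ _))
    (near_imp2 vcont vn0 (fun _ => @conj _ _))) => w [nv dh] [cv v0].
  have nh : \forall u \near w, h u = v u ^+ 2 by apply: (near_imp nv) => u ->.
  exact: (derivable_sqrt (near_eq_derive nh dh).1 cv v0).
pose l := (k %/ 2)%Z; pose e := (k %% 2)%Z.
have ke : k = l * 2 + e := divz_eq k 2.
have N := near_imp2 (near_imp2 gE fE (fun _ => @conj _ _))
  (near_imp2 vh (near_imp2 vcont vn0 (fun _ => @conj _ _)) (fun _ => @conj _ _))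
  (fun _ => @conj _ _).
move: N => /nbhs_ballP[d /= /gt0_complex[r r0 ->] Hd].
pose t w : C := f w / (v w * (w - z) ^ l).
have Ht w : w != z -> `|w - z| < r%:C%C ->
    [/\ t w ^+ 2 = (w - z) ^ e, {for w, continuous t} & f w = t w * v w * (w - z) ^ l].
  move=> wz wr; have wr' : ball z r%:C%C w by rewrite -ball_normE /= distrC.
  have [[gw fw] [vw [cv v0]]] := Hd w wr'.
  have [f2 cfw] := fw wz.
  have wz0 : w - z != 0 by rewrite subr_eq0.
  have wl0 : (w - z) ^ l != 0 by rewrite expfz_neq0.
  split.
  - rewrite /t expr_div_n f2 (gw wz) exprMn vw ke expfzDr//.
    rewrite exprnP [((w - z) ^ l) ^ _]exprz_exp.
    have n1 : (w - z) ^ (l * 2) != 0 by rewrite expfz_neq0.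
    have hw : h w != 0 by rewrite -vw expf_neq0.
    rewrite invfM; apply: (mulIf hw); apply: (mulIf n1); rewrite -!mulrA.
    by rewrite [(h w)^-1 * _]mulrCA; field; rewrite n1 hw.
  - have c1 := contB (f := idfun) (x := w) cvg_id (cont_cst z).
    have c2 := contM cv (contXz (f := fun w => w - z) (k := l) wz0 c1).
    have n2 : v w * (w - z) ^ l != 0 by rewrite mulf_neq0.
    exact: (contM cfw (contV (f := fun w => v w * (w - z) ^ l) n2 c2)).
  - by rewrite /t -mulrA divfK// mulf_neq0.
have e01 : e = 0 \/ e = 1.
  have e2 : (0 <= e < 2)%R by rewrite modz_ge0//= ltz_pmod.
  by move: e2; case: e {ke Ht} => [[|[|]]|]//= _; [left|right].
case: e01 => e0; rewrite e0 in ke Ht.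
  exists l; first by rewrite ke addr0.
  have [|c c0 Hc] := @sign_constant_punctured t z r r0.
    by move=> w wz wr; have [t2 ct _] := Ht w wz wr; rewrite expr0z in t2.
  exists (fun w => c * v w); split.
  - by apply: (near_imp vhol) => w dv; exact: (derivableM (derivable_cst _ _ _) dv).
  - by rewrite mulf_neq0// (nbhs_singleton vn0).
  have Nr : \forall w \near z, `|z - w| < r%:C%C by apply: near_dist; rewrite ltcR.
  apply: (near_imp Nr) => w; rewrite distrC => wr wz.
  by have [_ _ ->] := Ht w wz wr; rewrite (Hc w wz wr) mulrC.
exfalso; apply: (@no_sqrt_punctured t z r r0) => w wz wr.
by have [t2 ct _] := Ht w wz wr; rewrite expr1z in t2.
Qed.

Lemma root_order j f g z k : punctured_order g z k ->
  (\forall w \near z, w != z -> f w ^+ (2 ^ j) = g w /\ {for w, continuous f}) ->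
  exists2 l : int, k = l * (2 ^ j)%N%:Z & punctured_order f z l.
Proof.
elim: j f g k => [|j IH] f g k gk fE.
  exists k; first by rewrite mulr1.
  have [h [hh h0 gE]] := gk; exists h; split => //.
  by apply: (near_imp2 fE gE) => w fw gw wz; rewrite -(gw wz); have [<- _] := fw wz.
have [l kl fl] : exists2 l : int, k = l * (2 ^ j)%N%:Z &
    punctured_order (fun w => f w ^+ 2) z l.
  have f2 : \forall w \near z, w != z -> (f w ^+ 2) ^+ (2 ^ j) = g w /\
      {for w, continuous (fun w => f w ^+ 2)}.
    apply: (near_imp fE) => w fw wz; have [f1 cf] := fw wz.
    by split; [rewrite -exprM -expnS; exact: f1|exact: (contX cf)].
  exact: (IH (fun w => f w ^+ 2) g k gk f2).
have [l' ll' fl'] : exists2 l' : int, l = l' * 2 & punctured_order f z l'.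
  apply: (sqrt_order fl); apply: (near_imp fE) => w fw wz; have [_ f2] := fw wz.
  by split.
by exists l' => //; rewrite kl ll' -mulrA -PoszM -expnS.
Qed.

End PuncturedRoots.

(** * The image of the holonomy *)

(** Such a [k] has order exactly 4/d, and the cyclic group Z/4 has only one subgroup of that
    order. *)
Lemma Z4_generates (k : 'Z_4) (d j : nat) : (d * 2 ^ j.+1 = 4)%N ->
  k *+ 2 ^ j.+1 = 0 -> k *+ 2 ^ j != 0 -> exists l, k *+ l = d%:R.
Proof.
move=> dj; have j2 : (j < 2)%N.
  have /dvdn_leq : (2 ^ j.+1 %| 4)%N by rewrite -dj dvdn_mull.
  by move=> /(_ isT); rewrite -[4%N]/(2 ^ 2)%N leq_exp2l.
case: j j2 dj => [|[|//]] _ /= dj.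
  have -> : d = 2 by lia.
  by case: k => [[|[|[|[|//]]]] kp] //= _ _; exists 1%N; exact/val_inj.
have -> : d = 1%N by lia.
case: k => [[|[|[|[|//]]]] kp] //= _ _; first by exists 1%N; exact/val_inj.
by exists 3; exact/val_inj.
Qed.

Lemma max_divisor4 (P : nat -> bool) : P 1%N ->
  let d := \max_(e <- divisors 4 | P e) e in
  P d /\ forall e, (e %| 4)%N -> P e -> (e <= d)%N.
Proof.
move=> P1 d; have dE : divisors 4 = [:: 1; 2; 4]%N by [].
rewrite /d dE !big_cons big_nil P1; split.
  case P4 : (P 4%N); case P2 : (P 2%N) => //=; rewrite ?maxn0 ?P4 ?P2//.
move=> e; rewrite dvdn_divisors// dE !inE => /or3P[] /eqP -> Pe; rewrite ?Pe.
all: by case: (P 2%N); case: (P 4%N).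
Qed.

Section Classification.
Variables (R : realType) (X : riemannSurface R).
Local Notation C := (complex R)^o.
Local Notation dom a := (chart_dom (rs_chart a)).
Local Notation coord a := (chart_map (rs_chart a)).
Local Notation inv a := (chart_inv (rs_chart a)).
Implicit Types (a b : rs_index X) (x y : X).
Variables (K : {freeg X}) (n : nat) (p : 'I_n -> X) (m : 'I_n -> int).
Hypothesis Xc : compact [set: X].
Hypothesis p_inj : injective p.
Variable w : coefficients X.
Hypothesis ws : section_div 1 w K.

Let Jc a b x (ax : dom a x) (bx : dom b x) := jacobian_cont ws.1 ws.2 ax bx.
Let Y : set X := ~` range p.
Local Notation part e := (divisor_of p (fun i => (m i %/ (e%:Z))%Z)).

Lemma coeff_divisor_of (l : 'I_n -> int) i : coeff (p i) (divisor_of p l) = l i.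
Proof.
rewrite /divisor_of raddf_sum /= (bigD1 i)//= coeffU eqxx mulr1 big1 ?addr0// => j ji.
by rewrite coeffU (inj_eq p_inj) (negPf ji) mulr0.
Qed.

Lemma coeff_divisor_of0 (l : 'I_n -> int) x : Y x -> coeff x (divisor_of p l) = 0.
Proof.
move=> Yx; rewrite /divisor_of raddf_sum /= big1// => j _.
rewrite coeffU; case: eqP => [pjx|]; last by rewrite mulr0.
by exfalso; apply: Yx; exists j.
Qed.

Lemma open_cofinite (A : set X) : finite_set A -> open (~` A).
Proof.
move=> fA; apply: closed_openC.
have /hausdorff_accessible/accessible_finite_set_closed := @rs_hausdorff _ X.
by apply.
Qed.

Lemma Y_open : open Y.
Proof. by apply: open_cofinite; exact: finite_image. Qed.

Lemma near_punctured_Y x : \forall y \near x, y != x -> Y y.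
Proof.
have o : open (~` (range p `\ x)).
  by apply: open_cofinite; apply: finite_setD; exact: finite_image.
have H : (~` (range p `\ x)) x by move=> [_ /(_ erefl)].
apply: (near_imp (open_nbhs_nbhs (conj o H))) => y ny /eqP yx py.
by apply: ny; split.
Qed.

Lemma E_setP e : E_set K p m e <-> [/\ (e %| 4)%N, forall i, (e%:Z %| m i)%Z &
  exists r, section_div (4 %/ e) r (part e)].
Proof.
have le := linearly_equivalent_section (part e) (4 %/ e)%N ws.
split => [[e0 e4 em /le er]|[e4 em /le er]]; split => //.
by rewrite lt0n; apply: contraTneq e4 => ->.
Qed.

(** Here [r], [e] and [j] describe the root of [q] that defines the branches, whereas [i'] and [j']
    describe the root that the vanishing of multiples of the holonomy produces. *)
Lemma section_of_killed r e j (ref q : coefficients X) i' j' :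
  (e * 2 ^ j = 4)%N -> (2 ^ i' * 2 ^ j' = 4)%N ->
  (forall a y, Y y -> dom a y -> has_order (local_expr r a) (coord a y) 0) ->
  (forall a x, dom a x -> q a x = r a x ^+ e) ->
  has_div q (divisor_of p m) ->
  (forall x, transforms_at 1 ref x) ->
  (forall a x, dom a x -> ref a x ^+ (2 ^ j) = r a x) ->
  (forall u : H1 R Y, holonomy (good Y ref) u *+ 2 ^ j' = 0) ->
  E_set K p m (2 ^ i')%N.
Proof.
move=> ej ej' rY qE qD reft refn hk; pose s := global_root Y ref j'.
have st := global_root_transforms Y reft j'.
have sq a x : dom a x -> s a x ^+ (2 ^ i') = q a x.
  exact: (global_root_pow Y ej qE refn ej').
have sY a y : Y y -> dom a y -> has_order (local_expr s a) (coord a y) 0.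
  exact: (global_root_order Jc Y_open ej rY qE reft refn hk).
(* Near [p i] the root is known only to be continuous off [p i]; [root_order] yields both the
   divisibility of [m i] and the order of the root. *)
have atp a i : dom a (p i) -> exists2 l : int, m i = l * (2 ^ i')%N%:Z &
    punctured_order (local_expr s a) (coord a (p i)) l.
  move=> ai; apply: (root_order (g := local_expr q a)).
    by have := has_order_punctured (qD a _ ai); rewrite coeff_divisor_of.
  apply: (near_imp2 (near_inv ai (near_punctured_Y (p i))) (near_image ai)) => v Yv [av vE] vp.
  split; first exact: sq.
  have {}Yv : Y (inv a v) by apply: Yv; apply: contra_neq vp => vp; rewrite -vE vp.
  have [h [hh h0 hE]] := sY a _ Yv av; rewrite vE in hh hE.
  apply: (near_eq_cont _ (holomorphic_cont hh)).
  by apply: (near_imp hE) => u ->; rewrite expr0z mul1r.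
have nE : (4 %/ 2 ^ i')%N = (2 ^ j')%N by rewrite -ej' mulKn// expn_gt0.
have e0 : ((2 ^ i')%N%:Z != 0) by rewrite eqz_nat -lt0n expn_gt0.
apply/E_setP; split; first by rewrite -ej' dvdn_mulr.
  move=> i; have [a ai] := rs_cover (p i); have [l -> _] := atp a i ai.
  exact: dvdz_mull.
rewrite nE; exists (limit_coefficient s); apply: limit_section => //.
move=> a x ax; have [[i _ pix]|nx] := pselect (range p x).
  rewrite -pix in ax *; have [l ml ol] := atp a i ax.
  by rewrite coeff_divisor_of ml mulzK.
by rewrite coeff_divisor_of0//; exact/has_order_punctured/sY.
Qed.

Lemma section_pow r e k D : (0 < e)%N -> section_div k r D ->
  section_div (k * e) (fun a x => r a x ^+ e) (D *+ e).
Proof.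
move=> e0 [rt rD]; split.
  by move=> x a b ax bx; rewrite (rt x a b ax bx) exprMn exprM.
move=> a x ax; have [h [hh h0 hE]] := rD a x ax.
exists (fun v => h v ^+ e); split; [exact: holomorphicX|by rewrite expf_neq0|].
apply: (near_imp hE) => v; rewrite /local_expr /= => ->.
by rewrite exprMn coeffMn exprnP exprz_exp -[coeff x D *+ e]mulr_natr natz.
Qed.

Lemma part_mul e : (forall i, (e%:Z %| m i)%Z) -> part e *+ e = divisor_of p m.
Proof.
move=> em; rewrite /divisor_of -sumrMnl; apply: eq_bigr => i _.
by rewrite freeg_muln -mulr_natr natz divzK.
Qed.

Lemma rotational_holonomy_image q : section_div 4 q (divisor_of p m) ->
  E_set K p m 1%N ->
  exists2 rho : {additive H1 R Y -> 'Z_4}, rotational_holonomy q rho &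
    range rho = [set k | exists j : 'Z_4,
      k = (\max_(e <- divisors 4 | e \in E_set K p m) e)%:R * j].
Proof.
move=> qs E1; have [qt qD] := qs.
have [] := @max_divisor4 (fun e => e \in E_set K p m) (mem_set E1).
set d := \max_(_ <- _ | _) _ => /set_mem /E_setP[d4 dm [r0 r0s]] dmax.
have d0 : (0 < d)%N by rewrite lt0n; apply: contraTneq d4 => ->.
have [i [j [dE ij]]] : exists i j, d = (2 ^ i)%N /\ (2 ^ i * 2 ^ j = 4)%N.
  move: d4; rewrite dvdn_divisors// (_ : divisors 4 = [:: 1; 2; 4]%N)// !inE.
  by move=> /or3P[] /eqP ->; [exists 0%N, 2|exists 1%N, 1%N|exists 2, 0%N].
have nE : (4 %/ d)%N = (2 ^ j)%N by rewrite dE -ij mulKn// expn_gt0.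
have dj : (d * 2 ^ j = 4)%N by rewrite dE.
rewrite nE in r0s.
have ps := section_pow d0 r0s.
rewrite mulnC dj part_mul// in ps.
have [c c0 cE] := section_unique Xc Jc ps qs.
(* By uniqueness, [q] is [c] times the [d]-th power of [r0]; a [d]-th root of the scalar is absorbed
   into [r] to make [q] an exact power. *)
pose c1 : C := d.-root c.
have c1d : c1 ^+ d = c := rootCK d0 c.
have c10 : c1 != 0 by apply: contra_neq c0 => c10; rewrite -c1d c10 expr0n gtn_eqF.
pose r : coefficients X := fun a x => c1 * r0 a x.
have rt x : transforms_at (2 ^ j) r x.
  by move=> a b ax bx; rewrite /r (r0s.1 x a b ax bx) mulrA.
have qE a x : dom a x -> q a x = r a x ^+ d.
  by move=> ax; rewrite /r exprMn c1d cE.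
have rY a y : Y y -> dom a y -> has_order (local_expr r a) (coord a y) 0.
  move=> Yy ay; have [h [hh h0 hE]] := r0s.2 a y ay.
  rewrite coeff_divisor_of0// in hE; exists (fun v => c1 * h v); split.
  - by apply: (near_imp hh) => v dv; exact: (derivableM (derivable_cst _ _ _) dv).
  - by rewrite mulf_neq0.
  - by apply: (near_imp hE) => v; rewrite /local_expr /= /r => ->; rewrite mulrCA.
have [ref [reft refn]] := exists_reference_root rt.
have [rho rhoq rhoE] := holonomy_rotational Jc Y_open dj rY qE reft refn.
have killed u : rho u *+ 2 ^ j = 0.
  by rewrite rhoE /holonomy; exact: (chain_transport_killed Jc Y_open dj rY reft refn).
exists rho => //; apply/seteqP; split => [_ [u _ <-]|k [l ->]] /=.
  by apply: Z4_multiples => //; rewrite nE.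
(* If j = 0, then d is 4 and the right-hand side is 0. Otherwise a value not killed by half of 4/d
   generates d Z/4, and if there is none, then 2d belongs to [E_set], contrary to maximality. *)
case: j nE ij dj r0s rt ps refn killed => [|j] nE ij dj r0s rt ps refn killed; last first.
  have [[u Hu]|nk] := pselect (exists u, rho u *+ 2 ^ j != 0).
    have [t tE] := Z4_generates dj (killed u) Hu.
    exists (u *+ (t * l)) => //.
    by rewrite raddfMn mulrnA tE -[_ *+ l]mulr_natr natr_Zp.
  have hk (u : H1 R Y) : holonomy (good Y ref) u *+ 2 ^ j = 0.
    rewrite -rhoE; apply/eqP; apply: contrapT => hu; apply: nk; exists u.
    exact/negP.
  have ij' : (2 ^ i.+1 * 2 ^ j = 4)%N by rewrite -ij !expnS; lia.
  have E2 := section_of_killed dj ij' rY qE qD reft refn hk.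
  have le2 : (2 ^ i.+1 <= d)%N.
    by apply: dmax; [rewrite -ij' dvdn_mulr|exact: mem_set].
  by move: le2; rewrite dE leq_exp2l// ltnn.
exists 0 => //; rewrite raddf0; move: dj; rewrite expn0 muln1 => ->.
by rewrite (_ : 4%:R = 0 :> 'Z_4) ?mul0r//; exact/val_inj.
Qed.

End Classification.

Theorem proposition6p7 (R : realType) (X : riemannSurface R) (g n : nat)
    (K : {freeg X}) (p : 'I_n -> X) (m : 'I_n -> int) :
  compact [set: X] -> has_genus X g -> canonical_divisor K ->
  injective p -> (forall i, - 4 < m i) ->
  \sum_i m i = 4 * (2 * g%:Z - 2) ->
  ((exists2 q, differential 4 q & has_div q (divisor_of p m)) <->
     E_set K p m 1%N) /\
  (E_set K p m 1%N ->
     (forall q1 q2,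
        differential 4 q1 -> has_div q1 (divisor_of p m) ->
        differential 4 q2 -> has_div q2 (divisor_of p m) ->
        exists2 c : R[i], c != 0 &
          forall a x, chart_dom (rs_chart a) x -> q2 a x = c * q1 a x) /\
     (forall q, differential 4 q -> has_div q (divisor_of p m) ->
        exists2 rho : {additive H1 R (~` range p) -> 'Z_4},
          rotational_holonomy q rho &
          range rho = [set k | exists j : 'Z_4,
            k = (\max_(e <- divisors 4 | e \in E_set K p m) e)%:R * j])).
Proof.
move=> Xc _ [w [[wt _] _] wK] p_inj _ _; have ws : section_div 1 w K by [].
have Jc a b x ax bx := @jacobian_cont R X w K a b x wt wK ax bx.
have sec q : differential 4 q -> has_div q (divisor_of p m) ->
    section_div 4 q (divisor_of p m) by move=> [[qt _] _] qD.
split; last first.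
  move=> E1; split=> [q1 q2 d1 D1 d2 D2|q dq qD].
    exact: (section_unique Xc Jc (sec q1 d1 D1) (sec q2 d2 D2)).
  exact: (rotational_holonomy_image Xc p_inj ws (sec q dq qD) E1).
have part1 : (fun i => (m i %/ 1%N%:Z)%Z) = m by apply/funext => i; rewrite divz1.
have E1P := E_setP p m ws 1; rewrite part1 in E1P.
split=> [[q dq qD]|/E1P[_ _ [q qs]]].
  by apply/E1P; split=> [//|i|]; [exact: dvd1z|exists q; exact: sec].
by exists q; [exact: section_differential qs|exact: qs.2].
Qed.
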